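(* Assume that $(M,\mathcal{V})$ is an involutive structure and $p\in M$. If $M$ is nondegenerate at $p$ and has normal crossing exceptional locus at $p$, then every locally bounded infinitesimal automorphism $X$ of $(M,\mathcal{V})$ defined near $p$ which extends microlocally is smooth near $p$.
   Context: An involutive structure on a smooth manifold $M$ is a smooth complex subbundle $\mathcal{V}\subset\mathbb{C}TM$ whose smooth local sections are closed under Lie bracket. $\mathrm{T}'\subset\mathbb{C}T^*M$ is the subbundle of one-forms annihilating $\mathcal{V}$, $\mathcal{T}'$ its sheaf of smooth sections, and $\mathrm{T}^0_p=\mathrm{T}'_p\cap T_p^*M$ (real covectors). For smooth sections $\omega$ of $\mathrm{T}'$ and $L$ of $\mathcal{V}$, $D_L\omega=d\omega(L,\cdot)$ is again a section of $\mathrm{T}'$ (Lie derivative). Nondegeneracy: the characteristic sheaf $\mathcal{T}^0$ is given by $\mathcal{T}^0(U)=\{\omega\in\mathcal{T}'(U):\omega_q\in\mathrm{T}^0_q\ \forall q\in U\}$. Let $\hat{\mathcal{T}}^0\subset\mathcal{T}'$ be its $\mathcal{V}$-hull, i.e. the smallest subsheaf of modules (over complex-valued $\mathcal{C}^\infty$ functions) which contains $\mathcal{T}^0$ and is closed under $D_L$ for all local smooth sections $L$ of $\mathcal{V}$. $M$ is nondegenerate at $p$ if there is a neighborhood $U$ of $p$ with $\hat{\mathcal{T}}^0|_U=\mathcal{T}'|_U$. $M$ has normal crossing exceptional locus at $p$ if there exist smooth real coordinates $x$ for $M$ near $p$, a neighborhood $U$ of $p$, smooth one-forms $\omega_1,\dots,\omega_N\in\Gamma(U,\mathbb{C}T^*M)$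 spanning $\mathbb{C}T_p^*M$ at $p$, and multiindices $\alpha_1,\dots,\alpha_N\in\mathbb{N}^{\dim M}$ (entries $\geq 0$) such that near $p$ the forms $x^{\alpha_1}\omega_1,\dots,x^{\alpha_N}\omega_N$ are sections of $\mathcal{T}'+\overline{\mathcal{T}'}$ (sums of a smooth section of $\mathrm{T}'$ and the conjugate of one). A locally bounded infinitesimal automorphism on an open set $U$ is a real vector field $X$ on $U$ with locally bounded measurable coefficients such that $\omega([X,L])=0$ in the sense of distributions, equivalently $L(\omega(X))=d\omega(L,X)$, for all smooth local sections $\omega$ of $\mathrm{T}'$ and $L$ of $\mathcal{V}$. $X$ extends microlocally if for every $q$ in its domain there is a convex cone $\Gamma_q\subset\mathrm{T}^0_q\setminus\{0\}$ (possibly empty), closed in $\mathrm{T}^0_q\setminus\{0\}$ (being convex and omitting $0$, it contains no pair $\sigma,-\sigma$), such that $WF(\omega(X))\cap T^*_qM\subset\Gamma_q$ for every smooth section $\omega$ of $\mathrm{T}'$ near $q$ ($WF$ the $\mathcal{C}^\infty$ wave front set). ''Smooth near $p$'' means equal almost everywhere near $p$ to a $\mathcal{C}^\infty$ vector field. *)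

(* Defs.v *)
From HB Require Import structures.
From mathcomp Require Import all_boot all_order all_algebra.
From mathcomp Require Import complex.
From mathcomp Require Import all_classical all_reals all_analysis.
From mathcomp Require Import measurable_realfun.

Set Implicit Arguments.
Unset Strict Implicit.
Unset Printing Implicit Defensive.

Import Order.TTheory GRing.Theory Num.Theory.
Import numFieldNormedType.Exports.

Local Open Scope classical_set_scope.
Local Open Scope ring_scope.

(* The product sigma-algebra on row vectors; over the reals it is the Borel one. *)
Definition measure_rV_display : measure_display -> measure_display.
Proof. exact. Qed.

Section measurable_rV.
Context {d : measure_display} {T : measurableType d}.
Variable n : nat.

Definition rV_coord (i : 'I_n) (v : 'rV[T]_n) : T := v ord0 i.

Let rV_set0 : g_sigma_preimage rV_coord set0.
Proof. exact: sigma_algebra0. Qed.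

Let rV_setC A : g_sigma_preimage rV_coord A -> g_sigma_preimage rV_coord (~` A).
Proof. exact: sigma_algebraC. Qed.

Let rV_bigcup (F : (set 'rV[T]_n)^nat) :
  (forall i, g_sigma_preimage rV_coord (F i)) ->
  g_sigma_preimage rV_coord (\bigcup_i (F i)).
Proof. exact: sigma_algebra_bigcup. Qed.

HB.instance Definition _ := @isMeasurable.Build (measure_rV_display d)
  'rV[T]_n (g_sigma_preimage rV_coord) rV_set0 rV_setC rV_bigcup.

End measurable_rV.

Section lebesgue_rV.
Variable R : realType.

Definition cons_rV n (z : 'rV[R]_n * R) : 'rV[R]_n.+1 :=
  row_mx (z.2%:M : 'rV_1) z.1.

Fixpoint lebesgue_rV n : set 'rV[R]_n -> \bar R :=
  if n is m.+1 return set 'rV[R]_n -> \bar R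
  then pushforward (product_measure1 (@lebesgue_rV m) (@lebesgue_measure R))
         (@cons_rV m)
  else dirac (0 : 'rV[R]_0).

Lemma measurable_rV_coord n (i : 'I_n) :
  measurable_fun [set: 'rV[R]_n] (@rV_coord _ R n i).
Proof.
move=> _ Y mY; rewrite setTI; apply: sub_sigma_algebra => /=.
rewrite -bigcup_seq/=; exists i => /=; first by rewrite mem_index_enum.
by exists Y => //; rewrite setTI.
Qed.

Lemma measurable_cons_rV n : measurable_fun [set: _] (@cons_rV n).
Proof.
suff mc i : measurable_fun [set: 'rV[R]_n * R] (@rV_coord _ R n.+1 i \o @cons_rV n).
  apply: (@measurability _ _ _ _ _ _
    (\big[setU/set0]_(i < n.+1) preimage_set_system setT (@rV_coord _ R n.+1 i)
       measurable)) => //.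
  move=> _ [A + <-]; rewrite -bigcup_seq/= => -[i _ [B mB <-]].
  by rewrite setTI; apply: mc.
case: (@split_ordP 1 n i) => j ->.
- rewrite (_ : _ \o _ = snd) //; apply/funext => z /=.
  by rewrite /rV_coord; apply: etrans (row_mxEl _ _ _ _) _; rewrite mxE !ord1.
- rewrite (_ : _ \o _ = @rV_coord _ R n j \o fst).
    by apply: measurableT_comp => //; exact: measurable_rV_coord.
  by apply/funext => z; exact: row_mxEr.
Qed.

Lemma lebesgue_rV_measure n :
  {m : {measure set 'rV[R]_n -> \bar R} | lebesgue_rV (n := n) = m}.
Proof.
apply/cid; elim: n => [|n [m mE]].
  by exists (dirac (0 : 'rV[R]_0)).
unshelve eexists (pushforward (product_measure1 m (@lebesgue_measure R))
  (@cons_rV n)); first exact: measurable_cons_rV.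
by rewrite /= mE.
Qed.

Let lebesgue_rV0 n : @lebesgue_rV n set0 = 0%E.
Proof. by have [m ->] := lebesgue_rV_measure n; exact: measure0. Qed.

Let lebesgue_rV_ge0 n A : (0 <= @lebesgue_rV n A)%E.
Proof. by have [m ->] := lebesgue_rV_measure n; exact: measure_ge0. Qed.

Let lebesgue_rV_sigma_additive n : semi_sigma_additive (@lebesgue_rV n).
Proof.
by have [m ->] := lebesgue_rV_measure n; exact: measure_semi_sigma_additive.
Qed.

HB.instance Definition _ n := isMeasure.Build _ _ _ (@lebesgue_rV n)
  (lebesgue_rV0 n) (@lebesgue_rV_ge0 n) (@lebesgue_rV_sigma_additive n).
End lebesgue_rV.

Section calculus.
Variables (R : realType) (n : nat).
Local Notation E := 'rV[R]_n.
Local Notation C := R[i].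

Definition partial (i : 'I_n) (f : E -> R) : E -> R :=
  fun x => 'D_(delta_mx ord0 i) f x.

Definition iter_partial (s : seq 'I_n) (f : E -> R) : E -> R :=
  foldr partial f s.

(* meaningful for open D only *)
Definition smooth_on (D : set E) (f : E -> R) : Prop :=
  forall (s : seq 'I_n) (x : E), D x ->
    {for x, continuous (iter_partial s f)} /\
    forall i, derivable (iter_partial s f) x (delta_mx ord0 i).

Definition csmooth_on (D : set E) (f : E -> C) : Prop :=
  smooth_on D (fun x => complex.Re (f x)) /\
  smooth_on D (fun x => complex.Im (f x)).

Definition cpartial (i : 'I_n) (f : E -> C) (x : E) : C :=
  Complex (partial i (fun y => complex.Re (f y)) x)
          (partial i (fun y => complex.Im (f y)) x).

(* measurability for the completion of the Borel sigma-algebra; on such functions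
   the integral against the Borel measure [lebesgue_rV] is the Lebesgue integral *)
Definition lebesgue_measurable_fun (D : set E) (f : E -> R) : Prop :=
  forall B : set R, measurable B ->
    completed_algebra_gen (@lebesgue_rV R n) (D `&` f @^-1` B).

Definition cintegral (D : set E) (f : E -> C) : C :=
  Complex (\int[@lebesgue_rV R n]_(x in D) complex.Re (f x))
          (\int[@lebesgue_rV R n]_(x in D) complex.Im (f x)).

Definition test_function (D : set E) (phi : E -> R) : Prop :=
  smooth_on setT phi /\
  exists K : set E, [/\ compact K, K `<=` D & forall x, ~ K x -> phi x = 0].

Definition dot (x y : E) : R := \sum_(i < n) x ord0 i * y ord0 i.

Definition fourier (D : set E) (f : E -> C) (xi : E) : C :=
  cintegral D (fun x => Complex (cos (dot x xi)) (- sin (dot x xi)) * f x).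

(* For xi != 0 : (x, xi) is not in the wave front set of the locally integrable
   function u on the open set D. *)
Definition microlocally_smooth (D : set E) (u : E -> C) (x xi : E) : Prop :=
  exists (phi : E -> R) (G : set E),
    [/\ test_function D phi, phi x != 0,
        open G /\ G xi,
        forall (t : R) (eta : E), 0 < t -> G eta -> G (t *: eta) &
        forall k : nat, exists B : R, forall eta : E, G eta ->
          complex.Re `|fourier D (fun y => real_complex R (phi y) * u y) eta| *
            (1 + `|eta|) ^+ k <= B].

Definition cplx m1 m2 (A : 'M[R]_(m1, m2)) : 'M[C]_(m1, m2) :=
  map_mx (real_complex R) A.

End calculus.

Section manifolds.
Variables (R : realType) (n : nat).
Local Notation E := 'rV[R]_n.

Record chart (M : topologicalType) := Chart {
  chart_dom : set M ;
  chart_map :> M -> E ;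
  chart_inv : E -> M ;
  chart_dom_open : open chart_dom ;
  chart_cod_open : open (chart_map @` chart_dom) ;
  chart_mapK : forall q, chart_dom q -> chart_inv (chart_map q) = q ;
  chart_map_cont : forall q, chart_dom q -> {for q, continuous chart_map} ;
  chart_inv_cont : forall q, chart_dom q ->
    {for chart_map q, continuous chart_inv} }.

Definition transition (M : topologicalType) (c d : chart M) : E -> E :=
  fun x => d (chart_inv c x).

Definition compatible (M : topologicalType) (c d : chart M) : Prop :=
  forall j : 'I_n,
    smooth_on (c @` (chart_dom c `&` chart_dom d))
      (fun x => transition c d x ord0 j) /\
    smooth_on (d @` (chart_dom c `&` chart_dom d))
      (fun x => transition d c x ord0 j).

(* The charts [chart_at q] form the atlas; the preferred chart [chart_at q] is
   also the one that identifies the (co)tangent spaces at [q] with R^n. *)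
Record smooth_manifold := SmoothManifold {
  manifold_carrier :> topologicalType ;
  manifold_hausdorff : hausdorff_space manifold_carrier ;
  manifold_second_countable : second_countable (T := manifold_carrier) ;
  chart_at : manifold_carrier -> chart manifold_carrier ;
  chart_at_dom : forall q, chart_dom (chart_at q) q ;
  chart_at_compatible : forall q r, compatible (chart_at q) (chart_at r) }.

End manifolds.

Section fields.
Variables (R : realType) (n : nat) (M : smooth_manifold R n).
Local Notation E := 'rV[R]_n.
Local Notation C := R[i].

Definition smooth_chart (c : chart R n M) : Prop :=
  forall q : M, compatible (chart_at q) c.

Definition coord_image (c : chart R n M) (W : set M) : set E :=
  c @` (W `&` chart_dom c).

(* With row vectors, the entry (i, j) is the derivative of the j-th coordinate
   of [d] with respect to the i-th coordinate of [c]. *)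
Definition coord_jacobian (c d : chart R n M) (q : M) : 'M[R]_n :=
  jacobian (transition c d) (c q).

(* Complex vector fields and complex one-forms are both functions
   M -> 'rV[C]_n giving the components at q in the chart [chart_at q]; the two
   definitions below give the components in an arbitrary chart [c]. *)
Definition vfield_coord (c : chart R n M) (X : M -> 'rV[C]_n) (q : M) : 'rV[C]_n :=
  X q *m cplx (coord_jacobian (chart_at q) c q).

Definition form_coord (c : chart R n M) (w : M -> 'rV[C]_n) (q : M) : 'rV[C]_n :=
  w q *m (cplx (coord_jacobian c (chart_at q) q))^T.

Definition smooth_fun (W : set M) (f : M -> C) : Prop :=
  forall c, smooth_chart c ->
    csmooth_on (coord_image c W) (fun x => f (chart_inv c x)).

Definition smooth_vfield (W : set M) (X : M -> 'rV[C]_n) : Prop :=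
  forall c, smooth_chart c -> forall j : 'I_n,
    csmooth_on (coord_image c W)
      (fun x => vfield_coord c X (chart_inv c x) ord0 j).

Definition smooth_form (W : set M) (w : M -> 'rV[C]_n) : Prop :=
  forall c, smooth_chart c -> forall j : 'I_n,
    csmooth_on (coord_image c W)
      (fun x => form_coord c w (chart_inv c x) ord0 j).

Definition pairing (w X : 'rV[C]_n) : C := \sum_(i < n) w ord0 i * X ord0 i.

Definition lie_bracket (L K : M -> 'rV[C]_n) (q : M) : 'rV[C]_n :=
  let c := chart_at q in
  let D (X : M -> 'rV[C]_n) : 'M[C]_n :=
    \matrix_(i, j)
      cpartial i (fun x => vfield_coord c X (chart_inv c x) ord0 j) (c q) in
  L q *m D K - K q *m D L.

(* d w (u, v) = u *m ext_deriv w q *m v^T for tangent vectors u, v at q *)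
Definition ext_deriv (w : M -> 'rV[C]_n) (q : M) : 'M[C]_n :=
  let c := chart_at q in
  let D : 'M[C]_n :=
    \matrix_(i, j)
      cpartial i (fun x => form_coord c w (chart_inv c x) ord0 j) (c q) in
  D - D^T.

(* d w (L, .), which is the Lie derivative when w annihilates L *)
Definition lie_deriv (L w : M -> 'rV[C]_n) (q : M) : 'rV[C]_n :=
  L q *m ext_deriv w q.

Definition real_vfield (X : M -> 'rV[R]_n) : M -> 'rV[C]_n :=
  fun q => cplx (X q).

(* L u = g on W in the sense of distributions, for locally bounded measurable u
   and g. In coordinates the equation is tested as
   - \int u \sum_i d_i (L_i phi) = \int g phi. *)
Definition weak_derivative (W : set M) (L : M -> 'rV[C]_n) (u g : M -> C) : Prop :=
  forall c, smooth_chart c -> forall phi, test_function (coord_image c W) phi ->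
    - cintegral (coord_image c W) (fun x => u (chart_inv c x) *
        \sum_(i < n) cpartial i (fun y =>
          vfield_coord c L (chart_inv c y) ord0 i * real_complex R (phi y)) x) =
    cintegral (coord_image c W)
      (fun x => g (chart_inv c x) * real_complex R (phi x)).

(* The fibre over q, in the coordinates of [chart_at q], of the C^oo wave front
   set of the locally integrable function u on the open set W; the wave front
   set is coordinate invariant, so it may be computed in that chart. *)
Definition wave_front (W : set M) (u : M -> C) (q : M) : set E :=
  let c := chart_at q in
  [set xi | xi != 0 /\
    ~ microlocally_smooth (coord_image c W) (fun x => u (chart_inv c x))
        (c q) xi].

Definition ae_on (W : set M) (P : M -> Prop) : Prop :=
  forall c, smooth_chart c ->
    negligible (@lebesgue_rV R n) (coord_image c (W `&` [set q | ~ P q])).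

Definition smooth_near (p : M) (X : M -> 'rV[R]_n) : Prop :=
  exists (W : set M) (Y : M -> 'rV[R]_n),
    [/\ open W, W p, smooth_vfield W (real_vfield Y) &
        ae_on W (fun q => X q = Y q)].

End fields.

Section involutive_structures.
Variables (R : realType) (n : nat) (M : smooth_manifold R n).
Local Notation E := 'rV[R]_n.
Local Notation C := R[i].

Definition bundle_section (V : M -> {vspace 'rV[C]_n}) (W : set M)
    (L : M -> 'rV[C]_n) : Prop :=
  smooth_vfield W L /\ forall q, W q -> L q \in V q.

Definition smooth_subbundle (V : M -> {vspace 'rV[C]_n}) : Prop :=
  forall q : M, exists (W : set M) (k : nat) (L : 'I_k -> M -> 'rV[C]_n),
    [/\ open W, W q, forall i, smooth_vfield W (L i) &
        forall r, W r -> basis_of (V r) [seq L i r | i : 'I_k]].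

Record involutive_structure := InvolutiveStructure {
  inv_bundle :> M -> {vspace 'rV[C]_n} ;
  inv_subbundle : smooth_subbundle inv_bundle ;
  inv_bracket : forall (W : set M) (L K : M -> 'rV[C]_n), open W ->
    bundle_section inv_bundle W L -> bundle_section inv_bundle W K ->
    bundle_section inv_bundle W (lie_bracket L K) }.

Variable V : involutive_structure.

(* [annihilator q] and [characteristic q] are the fibres T'_q and T^0_q;
   [form_section] and [characteristic_section] are the sections of the
   corresponding sheaves. *)
Definition annihilator (q : M) : set 'rV[C]_n :=
  [set w | forall v, v \in V q -> pairing w v = 0].

Definition characteristic (q : M) : set E :=
  [set xi | annihilator q (cplx xi)].

Definition form_section (W : set M) (w : M -> 'rV[C]_n) : Prop :=
  smooth_form W w /\ forall q, W q -> annihilator q (w q).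

Definition characteristic_section (W : set M) (w : M -> 'rV[C]_n) : Prop :=
  form_section W w /\
  forall q, W q -> exists2 xi, characteristic q xi & w q = cplx xi.

(* S W is the set of sections over W of a subsheaf of C^oo-modules of the sheaf
   [form_section]; the second clause makes membership depend on the restriction
   to W only. *)
Record form_subsheaf (S : set M -> set (M -> 'rV[C]_n)) : Prop := FormSubsheaf {
  subsheaf_sub : forall W w, open W -> S W w -> form_section W w ;
  subsheaf_ext : forall W w w', open W -> (forall q, W q -> w q = w' q) ->
    S W w -> S W w' ;
  subsheaf_res : forall W W' w, open W -> open W' -> W' `<=` W -> S W w -> S W' w ;
  subsheaf_glue : forall W w, open W ->
    (forall q, W q -> exists W', [/\ open W', W' q, W' `<=` W & S W' w]) ->
    S W w ;
  subsheaf0 : forall W, open W -> S W (fun=> 0) ;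
  subsheafD : forall W w w', open W -> S W w -> S W w' ->
    S W (fun q => w q + w' q) ;
  subsheafZ : forall W f w, open W -> smooth_fun W f -> S W w ->
    S W (fun q => f q *: w q) }.

Definition lie_closed (S : set M -> set (M -> 'rV[C]_n)) : Prop :=
  forall W L w, open W -> bundle_section V W L -> S W w -> S W (lie_deriv L w).

Definition hull (W : set M) (w : M -> 'rV[C]_n) : Prop :=
  forall S, form_subsheaf S -> lie_closed S ->
    (forall W' w', open W' -> characteristic_section W' w' -> S W' w') ->
    S W w.

Definition nondegenerate_at (p : M) : Prop :=
  exists U : set M, [/\ open U, U p &
    forall W w, open W -> W `<=` U -> (hull W w <-> form_section W w)].

Definition normal_crossing_at (p : M) : Prop :=
  exists (x : chart R n M) (U : set M) (N : nat) (w : 'I_N -> M -> 'rV[C]_n)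
         (alpha : 'I_N -> 'I_n -> nat),
    [/\ smooth_chart x /\ chart_dom x p,
        open U /\ U p,
        forall k, smooth_form U (w k),
        span [seq w k p | k : 'I_N] = fullv &
        exists W : set M, [/\ open W, W p, W `<=` U `&` chart_dom x &
          forall k, exists th eta : M -> 'rV[C]_n,
            [/\ form_section W th, form_section W eta &
                forall q, W q ->
                  real_complex R (\prod_(j < n) x q ord0 j ^+ alpha k j) *: w k q =
                    th q + map_mx (@conjc R) (eta q)]]].

Definition locally_bounded_measurable (U : set M) (X : M -> 'rV[R]_n) : Prop :=
  forall c, smooth_chart c ->
    (forall j : 'I_n, lebesgue_measurable_fun (coord_image c U)
       (fun x => complex.Re (vfield_coord c (real_vfield X) (chart_inv c x) ord0 j)))
    /\
    (forall q, U q -> chart_dom c q ->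
       exists (W : set M) (B : R), [/\ open W, W q &
         forall r, W r -> U r -> chart_dom c r -> forall j : 'I_n,
           `|complex.Re (vfield_coord c (real_vfield X) r ord0 j)| <= B]).

Definition infinitesimal_automorphism (U : set M) (X : M -> 'rV[R]_n) : Prop :=
  forall (W : set M) (w L : M -> 'rV[C]_n), open W -> W `<=` U ->
    form_section W w -> bundle_section V W L ->
    weak_derivative W L (fun q => pairing (w q) (real_vfield X q))
      (fun q => pairing (lie_deriv L w q) (real_vfield X q)).

Definition extends_microlocally (U : set M) (X : M -> 'rV[R]_n) : Prop :=
  forall q, U q -> exists G : set E,
    [/\ G `<=` [set xi | characteristic q xi /\ xi != 0],
        convex_set (G : set (convex_lmodType E)),
        forall (t : R) xi, 0 < t -> G xi -> G (t *: xi),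
        exists2 F : set E, closed F &
          G = F `&` [set xi | characteristic q xi /\ xi != 0] &
        forall (W : set M) (w : M -> 'rV[C]_n), open W -> W q -> W `<=` U ->
          form_section W w ->
          wave_front W (fun r => pairing (w r) (real_vfield X r)) q `<=` G].

End involutive_structures.

(* Main.v *)
(* Let S be the sheaf of sections w of T' for which the bounded function w(X) is almost
   everywhere equal to a smooth function.  S is a module over the smooth functions.  If w is
   characteristic, then w(X) is real, so its wave front set is symmetric; lying over each point
   in a convex cone of nonzero covectors, it is empty, and w is in S.  If w is in S, the weak
   equation L(w(X)) = (D_L w)(X) has a smooth left-hand side, so D_L w is in S.  Hence S contains
   the hull, which is all of T' by nondegeneracy.  At a normal crossing, x^alpha * omega(X) is
   then smooth for forms omega spanning the cotangent space at p; since omega(X) is bounded,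
   Hadamard's lemma divides by the coordinates one at a time, so omega(X) is smooth, and
   inverting the coefficient matrix gives X.
   Emptiness of the wave front set is turned into smoothness through Fourier series on a
   period box: compactness of the unit sphere gives one cutoff with rapidly decaying
   coefficients, and the resulting smooth sum equals the function by completeness of the
   trigonometric system. *)
Require Import Defs.
From HB Require Import structures.
From mathcomp Require Import all_boot all_order all_algebra.
From mathcomp Require Import complex.
From mathcomp Require Import all_classical all_reals all_analysis.
From mathcomp Require Import measurable_realfun.
From mathcomp Require Import ring lra zify.

Set Implicit Arguments.
Unset Strict Implicit.
Unset Printing Implicit Defensive.

Import Order.TTheory GRing.Theory Num.Theory.
Import numFieldNormedType.Exports.

Local Open Scope classical_set_scope.
Local Open Scope ring_scope.

(** * Calculus on row vectors *)

(** The functions [w(X)] are merely bounded and Lebesgue measurable, so identities between them hold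
    only off null sets. Locally they are replaced by Borel functions that are bounded with bounded
    support ([bounded_supp]), and null sets have to be carried through chart changes, which is where
    the Lipschitz estimates enter. Limits of series are quantitative: errors have the form
    [C / N.+1], and [le_archi] removes them. The frequencies are integers, so the period box has
    half-side [pi], while the supports lie in a ball of radius [pi / 2] about its centre. A point of
    the box and a point of the ball then differ by at most [3 * pi / 2 < 2 * pi] in each coordinate,
    so a kernel that peaks at the second does not peak again elsewhere in the box. Fourier series
    also take the place of convolution: a cutoff is expanded in its series, and multiplication by it
    becomes a lattice sum of translates of the Fourier integral. *)

Section row_vector_norm.
Variables (R : realType) (n : nat).
Implicit Types x y : 'rV[R]_n.

Lemma coord_le_norm x i : `|x ord0 i| <= `|x|.
Proof.
rewrite [leRHS]/Num.Def.normr/= mx_normrE.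
exact: (le_bigmax _ (fun ij : 'I_1 * 'I_n => `|x ij.1 ij.2|) (ord0, i)).
Qed.

Lemma norm_le_coord x (B : R) : 0 <= B -> (forall i, `|x ord0 i| <= B) -> `|x| <= B.
Proof.
move=> B0 xB; rewrite [leLHS]/Num.Def.normr/= mx_normrE.
by apply: bigmax_le => // -[i j] _ /=; rewrite ord1.
Qed.

Lemma norm_lt_coord x (B : R) : 0 < B -> (forall i, `|x ord0 i| < B) -> `|x| < B.
Proof.
move=> B0 xB; rewrite [ltLHS]/Num.Def.normr/= mx_normrE.
by apply: bigmax_lt => // -[i j] _ /=; rewrite ord1.
Qed.

Lemma ballP_coord x (r : R) y : 0 < r ->
  ball x r y <-> forall i, `|x ord0 i - y ord0 i| < r.
Proof.
move=> r0; rewrite -ball_normE /=; split => [xy i|xy].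
  by rewrite (le_lt_trans _ xy)// (le_trans _ (coord_le_norm _ i))// !mxE.
by apply: norm_lt_coord => // i; rewrite !mxE.
Qed.

End row_vector_norm.

Lemma coord_cvg (R : realType) n (x : 'rV[R]_n) i :
  (fun y : 'rV[R]_n => y ord0 i) @ x --> x ord0 i.
Proof. exact: (@coord_continuous R 1 n ord0 i x). Qed.

Section lines.
Variables (R : realType) (V : normedModType R).
Implicit Types f : V -> R.

Lemma is_derive_line f (x v : V) (t : R) : derivable f (t *: v + x) v ->
  is_derive t 1 (fun s => f (s *: v + x)) ('D_v f (t *: v + x)).
Proof.
move=> df; have E : (fun h : R => h^-1 *: (f ((h *: 1 + t) *: v + x) - f (t *: v + x))) =
    (fun h => h^-1 *: (f (h *: v + (t *: v + x)) - f (t *: v + x))).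
  by apply/funext => h; rewrite addrA -scalerDl [h *: 1]mulr1.
by split; [rewrite /derivable E | rewrite /derive E].
Qed.

Lemma mean_value_line f (x v : V) (s : R) :
  (forall t : R, 0 <= t <= 1 -> derivable f ((t * s) *: v + x) v) ->
  exists2 t : R, 0 <= t <= 1 & f (s *: v + x) - f x = s * 'D_v f ((t * s) *: v + x).
Proof.
move=> df.
have H (t : R) : t \in `[0, 1]%R -> is_derive t 1 (fun t => f ((t * s) *: v + x))
    (s * 'D_v f ((t * s) *: v + x)).
  move=> t01; have [|d1 d2] := @is_derive_line f x v (t * s).
    by apply: df; move: t01; rewrite in_itv.
  apply: (@is_derive_eq _ _ _ _ _ _ _ _ _).
    apply: (@is_derive1_comp _ (fun s => f (s *: v + x)) (fun t => t * s)).
      exact: (DeriveDef d1 d2).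
  by rewrite scaler0 add0r [_%:A]mulr1 mulrC.
have cg : {within `[0 : R, 1], continuous (fun t : R => f ((t * s) *: v + x))}.
  by apply: derivable_within_continuous => t /H[].
have [t t01 E] := MVT (@ltr01 R) (fun t t01 => H t (subset_itv_oo_cc t01)) cg.
exists t; first exact: subset_itv_oo_cc.
by move: E; rewrite mul1r mul0r scale0r add0r subr0 mulr1.
Qed.
End lines.

Section partial_calculus.
Variables (R : realType) (n : nat).
Local Notation E := 'rV[R]_n.
Local Notation dl i := (delta_mx ord0 i : E).
Implicit Types (f g : E -> R) (x y z : E) (D : set E).

Lemma mean_value_ball f x (r : R) y z : 0 < r -> ball x r y -> ball x r z ->
  (forall w i, ball x r w -> derivable f w (dl i)) ->
  exists2 c : 'I_n -> E, forall i, ball x r (c i) &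
    f z - f y = \sum_(i < n) (z ord0 i - y ord0 i) * partial i f (c i).
Proof.
move=> r0 /(ballP_coord _ _ r0) by_ /(ballP_coord _ _ r0) bz df.
pose m (k : nat) : E := \row_j (if (j < k)%N then z ord0 j else y ord0 j).
have step (i : 'I_n) : exists2 c, ball x r c &
    f (m i.+1) - f (m i) = (z ord0 i - y ord0 i) * partial i f c.
  have mS : m i.+1 = (z ord0 i - y ord0 i) *: dl i + m i.
    apply/rowP => j; rewrite !mxE eqxx /= ltnS leq_eqVlt.
    have [<-|ij] := eqVneq i j; first by rewrite eqxx/= ltnn mulr1 subrK.
    by have /negPf -> : (j != i :> nat); [rewrite eq_sym|rewrite mulr0 add0r].
  have bt (t : R) : 0 <= t <= 1 -> ball x r ((t * (z ord0 i - y ord0 i)) *: dl i + m i).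
    move=> /andP[t0 t1]; apply/ballP_coord => // j; rewrite !mxE eqxx /=.
    have [<-|ij] := eqVneq i j; last first.
      by rewrite mulr0 add0r; case: ifP => _; [exact: bz|exact: by_].
    rewrite ltnn mulr1 -(addrC (y _ _)).
    have [M Mr [aM bM]] : exists2 M : R, M < r &
        `|x ord0 i - y ord0 i| <= M /\ `|x ord0 i - z ord0 i| <= M.
      exists (Num.max `|x ord0 i - y ord0 i| `|x ord0 i - z ord0 i|).
        by rewrite gt_max by_ bz.
      by rewrite !le_max !lexx orbT.
    rewrite (le_lt_trans _ Mr)//.
    move: aM bM; rewrite !ler_norml => /andP[? ?] /andP[? ?].
    by apply/andP; split; nra.
  have [|t t01 E] := @mean_value_line R E f (m i) (dl i) (z ord0 i - y ord0 i).
    by move=> t t01; apply: df; exact: bt.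
  by exists ((t * (z ord0 i - y ord0 i)) *: dl i + m i); [exact: bt|rewrite mS].
have [c cb cE] : exists2 c : 'I_n -> E, (forall i, ball x r (c i)) &
    forall i : 'I_n, f (m i.+1) - f (m i) = (z ord0 i - y ord0 i) * partial i f (c i).
  exists (fun i => projT1 (cid2 (step i))) => i; by case: cid2.
exists c => //.
have -> : z = m n by apply/rowP => j; rewrite mxE ltn_ord.
have -> : y = m 0%N by apply/rowP => j; rewrite mxE ltn0.
rewrite -(telescope_sumr (fun k => f (m k)))// big_mkord; apply: eq_bigr => i _.
by rewrite cE !mxE ltn_ord.
Qed.

Lemma partial_lipschitz f x (r B : R) : 0 < r -> 0 <= B ->
  (forall w i, ball x r w -> derivable f w (dl i) /\ `|partial i f w| <= B) ->
  forall y z, ball x r y -> ball x r z -> `|f z - f y| <= n%:R * B * `|z - y|.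
Proof.
move=> r0 B0 H y z yb zb.
have [|c cb ->] := mean_value_ball (f := f) r0 yb zb.
  by move=> w i /H -/(_ i)[].
apply: le_trans (ler_norm_sum _ _ _) _.
have -> : n%:R * B * `|z - y| = \sum_(i < n) (B * `|z - y|).
  by rewrite sumr_const card_ord -mulrA mulr_natl.
apply: ler_sum => i _; rewrite normrM mulrC; apply: ler_pM => //.
  by have [] := H _ i (cb i).
by have := coord_le_norm (z - y) i; rewrite !mxE.
Qed.

(** The increment of [f] is a combination of partial derivatives at points near [x], by
    [mean_value_ball]; continuity of the partials at [x] replaces them by their values at [x] at the
    cost of a small multiple of the norm. *)
Lemma continuous_partial_differentiable f D x : open D -> D x ->
  (forall y i, D y -> derivable f y (dl i)) ->
  (forall i, {for x, continuous (partial i f)}) ->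
  differentiable f x /\
  forall v, 'd f x v = \sum_(i < n) v ord0 i * partial i f x.
Proof.
move=> oD Dx df cf.
pose l : E -> R := fun v => \sum_(i < n) v ord0 i * partial i f x.
have llin : linear l.
  move=> a u v; rewrite /l scaler_sumr -big_split/=; apply: eq_bigr => i _.
  by rewrite !mxE mulrDl scalerAl.
pose L : {linear E -> R} := HB.pack l (GRing.isLinear.Build _ _ _ _ l llin).
have Lc : continuous L.
  change (continuous l); apply: continuous_big => [|i _ v]; first exact: add_continuous.
  by apply: (@cvgMr_tmp _ _ (nbhs v) _ (fun y : E => y ord0 i) (v ord0 i)); exact: coord_cvg.
have H : f \o shift x = (cst (f x) + (L : E -> R) : E -> R) +o_ (0 : E) id.
  apply/eqaddoP => _/posnumP[e].
  (* There are [n] error terms, so each gets the share [e / n.+1]; the successor keeps the quotient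
     meaningful in dimension 0. *)
  have e1 : 0 < e%:num / (n.+1)%:R by rewrite divr_gt0.
  have [r /= r0 rP] : exists2 r : R, 0 < r & forall y, ball x r y ->
      D y /\ forall i, `|partial i f x - partial i f y| < e%:num / (n.+1)%:R.
    have : \forall y \near x, D y /\ forall i, `|partial i f x - partial i f y| < e%:num / (n.+1)%:R.
      near=> y; split; first by near: y; exact: open_nbhs_nbhs.
      near: y; apply: filter_forall => i.
      exact: (cvgrPdist_lt _ _).1 (cf i) _ e1.
    by move=> /nbhs_ballP[r r0 rP]; exists r.
  near=> y; rewrite !fctE/=.
  have [->|y0] := eqVneq y 0.
    have -> : l 0 = 0 by rewrite /l big1// => i _; rewrite mxE mul0r.
    by rewrite add0r addr0 subrr normr0 mulr_ge0.
  have ny : 0 < `|y| by rewrite normr_gt0.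
  have yr : `|y| < r.
    have : ball (0 : E) r y by near: y; exact: nbhsx_ballx.
    by rewrite -ball_normE /= sub0r normrN.
  pose s := Num.min r (2 * `|y|).
  have s0 : 0 < s by rewrite lt_min r0/= mulr_gt0.
  have xs : ball x s x by exact: ballxx.
  have ys : ball x s (y + x).
    rewrite -ball_normE /ball_/= opprD addrA addrAC subrr add0r normrN /s lt_min yr/=; lra.
  have sr w : ball x s w -> ball x r w.
    by apply: le_ball; rewrite /s ge_min lexx.
  have [|c cb fE] := mean_value_ball (f := f) s0 xs ys.
    by move=> w i /sr/rP[Dw _]; exact: df.
  rewrite opprD addrA fE /l -sumrB.
  apply: le_trans (ler_norm_sum _ _ _) _.
  apply: (@le_trans _ _ (\sum_(i < n) e%:num / (n.+1)%:R * `|y|)).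
    apply: ler_sum => i _; rewrite !mxE addrK -mulrBr normrM mulrC.
    apply: ler_pM => //; last exact: coord_le_norm.
    by rewrite distrC; apply: ltW; have [_] := rP _ (sr _ (cb i)); exact.
  rewrite sumr_const card_ord -[leLHS]mulr_natl mulrA ler_wpM2r//.
  rewrite mulrA ler_pdivrMr ?ltr0n// mulrC ler_wpM2l//.
  by rewrite ler_nat.
have dE := diff_unique Lc H.
split; last by move=> v; rewrite dE.
by apply/diff_locallyP; rewrite dE; split.
Unshelve. all: by end_near. Qed.


(** A recursive form of finite differentiability, suited to induction on the order: the product and
    chain rules for order [k.+1] use the functions at order [k] only, through [CkS], whereas
    [smooth_on] quantifies over lists of derivatives. *)
Fixpoint Ck (k : nat) (D : set E) (f : E -> R) : Prop :=
  if k is k'.+1 then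
    (forall x, D x -> {for x, continuous f}) /\
    (forall i, (forall x, D x -> derivable f x (dl i)) /\ Ck k' D (partial i f))
  else forall x, D x -> {for x, continuous f}.

Lemma Ck_continuous k D f x : Ck k D f -> D x -> {for x, continuous f}.
Proof. by case: k => [|k] /=; [exact|case=> + _; exact]. Qed.

Lemma CkS k D f : Ck k.+1 D f -> Ck k D f.
Proof.
elim: k f => [|k IH] f; first by case.
by move=> [cf H]; split => // i; have [? ?] := H i; split => //; exact: IH.
Qed.

(** [iter_partial] applies the last index of the list first, while [Ck] peels off the derivative
    that is applied first; hence lists are taken apart from the right. *)
Lemma smooth_onP D f : smooth_on D f <-> forall k, Ck k D f.
Proof.
split=> [+ k|].
  elim: k f => [|k IH] f sf; first by move=> x Dx; have [] := sf [::] x Dx.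
  split; first by move=> x Dx; have [] := sf [::] x Dx.
  move=> i; split; first by move=> x Dx; have [_] := sf [::] x Dx; exact.
  by apply: IH => s x Dx; have := sf (rcons s i) x Dx; rewrite /iter_partial foldr_rcons.
move=> + s; elim/last_ind: s f => [|s i IH] f H x Dx.
  by have [/= c d] := H 1%N; split; [exact: c|move=> i; have [+ _] := d i; exact].
rewrite /iter_partial foldr_rcons; apply: (IH (partial i f)) => // k.
by have [_ /(_ i)[]] := H k.+1.
Qed.

Lemma near_open D x : open D -> D x -> \forall y \near x, D y.
Proof. by move=> oD Dx; exact: open_nbhs_nbhs. Qed.

Lemma partial_congr D f g x i : open D -> (forall y, D y -> f y = g y) -> D x ->
  partial i f x = partial i g x.
Proof.
move=> oD fg Dx; apply: near_eq_derive.
by near do rewrite fg //; exact: near_open Dx.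
Unshelve. all: by end_near. Qed.

Lemma derivable_congr D f g x i : open D -> (forall y, D y -> f y = g y) -> D x ->
  derivable f x (dl i) -> derivable g x (dl i).
Proof.
move=> oD fg Dx; apply: near_eq_derivable.
by near do rewrite fg //; exact: near_open Dx.
Unshelve. all: by end_near. Qed.

Lemma continuous_congr D f g x : open D -> (forall y, D y -> f y = g y) -> D x ->
  {for x, continuous f} -> {for x, continuous g}.
Proof.
move=> oD fg Dx; rewrite /prop_for /continuous_at fg// => cf.
apply: cvg_trans cf; apply: (@near_eq_cvg _ _ (nbhs x)).
by near do rewrite fg //; exact: near_open Dx.
Unshelve. all: by end_near. Qed.

Lemma Ck_congr k D f g : open D -> (forall y, D y -> f y = g y) ->
  Ck k D f -> Ck k D g.
Proof.
move=> oD; elim: k f g => [|k IH] f g fg /=.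
  by move=> H x Dx; apply: continuous_congr fg Dx (H x Dx).
move=> [cf df]; split; first by move=> x Dx; apply: continuous_congr fg Dx (cf x Dx).
move=> i; have [d c] := df i; split.
  by move=> x Dx; apply: derivable_congr fg Dx (d x Dx).
by apply: IH c => y; exact: partial_congr.
Qed.

Lemma Ck_cst k D a : Ck k D (fun=> a).
Proof.
have p i : partial i (fun=> a) = (fun=> 0) :> (E -> R).
  by apply/funext => x; rewrite /partial derive_cst.
elim: k a p => [|k IH] a p /=; first by move=> x _; exact: cst_continuous.
split; first by move=> x _; exact: cst_continuous.
move=> i; split; first by move=> x _; exact: derivable_cst.
rewrite p; apply: IH => j.
by apply/funext => x; rewrite /partial derive_cst.
Qed.

Lemma is_derive_coord x i v : is_derive x v (fun y : E => y ord0 i) (v ord0 i).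
Proof.
have E : (fun h : R => h^-1 *: (((h *: v + x) : E) ord0 i - x ord0 i)) @ 0^' --> (v ord0 i : R).
  apply: cvg_near_cst; near=> h.
  rewrite !mxE addrK [_ *: _]mulrA mulVf ?mul1r//; near: h; exact: nbhs_dnbhs_neq.
by split; [apply/cvg_ex; exists (v ord0 i)|apply/cvg_lim].
Unshelve. all: by end_near. Qed.

Lemma Ck_coord k D i : Ck k D (fun x => x ord0 i).
Proof.
case: k => [|k] /=; first by move=> x _; exact: coord_cvg.
split; first by move=> x _; exact: coord_cvg.
move=> j; split; first by move=> x _; have [] := is_derive_coord x i (dl j).
rewrite (_ : partial _ _ = fun=> (dl j) ord0 i); first exact: Ck_cst.
by apply/funext => x; have [_] := is_derive_coord x i (dl j).
Qed.

Lemma CkD k D f g : open D -> Ck k D f -> Ck k D g -> Ck k D (fun x => f x + g x).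
Proof.
move=> oD; elim: k f g => [|k IH] f g /=.
  by move=> cf cg x Dx; apply: continuousD; [exact: cf|exact: cg].
move=> [cf df] [cg dg]; split; first by move=> x Dx; apply: continuousD; [exact: cf|exact: cg].
move=> i; have [d1 c1] := df i; have [d2 c2] := dg i; split.
  by move=> x Dx; apply: derivableD; [exact: d1|exact: d2].
apply: Ck_congr (IH _ _ c1 c2) => // x Dx.
by rewrite /partial; apply/esym; exact: deriveD (d1 x Dx) (d2 x Dx).
Qed.

Lemma CkM k D f g : open D -> Ck k D f -> Ck k D g -> Ck k D (fun x => f x * g x).
Proof.
move=> oD; elim: k f g => [|k IH] f g.
  by move=> cf cg x Dx; apply: continuousM; [exact: cf|exact: cg].
move=> Hf Hg; have [cf df] := Hf; have [cg dg] := Hg.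
split; first by move=> x Dx; apply: continuousM; [exact: cf|exact: cg].
move=> i; have [d1 c1] := df i; have [d2 c2] := dg i; split.
  by move=> x Dx; apply: derivableM; [exact: d1|exact: d2].
have := CkD oD (IH _ _ (CkS Hf) c2) (IH _ _ (CkS Hg) c1).
apply: Ck_congr => // x Dx.
by rewrite /partial; apply/esym; exact: deriveM (d1 x Dx) (d2 x Dx).
Qed.

Lemma Ck_sum k D (I : Type) (r : seq I) (P : pred I) (F : I -> E -> R) : open D ->
  (forall i, P i -> Ck k D (F i)) -> Ck k D (fun x => \sum_(i <- r | P i) F i x).
Proof.
move=> oD H; elim: r => [|j r IH].
  by apply: Ck_congr (Ck_cst k D 0) => // y _; rewrite big_nil.
case Pj : (P j); last by apply: Ck_congr IH => // y _; rewrite big_cons Pj.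
by apply: Ck_congr (CkD oD (H _ Pj) IH) => // y _; rewrite big_cons Pj.
Qed.

Lemma Ck_prod k D (I : Type) (r : seq I) (P : pred I) (F : I -> E -> R) : open D ->
  (forall i, P i -> Ck k D (F i)) -> Ck k D (fun x => \prod_(i <- r | P i) F i x).
Proof.
move=> oD H; elim: r => [|j r IH].
  by apply: Ck_congr (Ck_cst k D 1) => // y _; rewrite big_nil.
case Pj : (P j); last by apply: Ck_congr IH => // y _; rewrite big_cons Pj.
by apply: Ck_congr (CkM oD (H _ Pj) IH) => // y _; rewrite big_cons Pj.
Qed.

(** Restriction to the line through [x] in direction [v] reduces this to the one-variable chain
    rule, since [f] is only derivable in that direction. *)
Lemma is_derive_comp_real f (phi : R -> R) x v (d : R) : derivable f x v ->
  is_derive (f x) 1 phi d -> is_derive x v (phi \o f) (d * 'D_v f x).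
Proof.
move=> df dphi.
have df0 : is_derive (0 : R) 1 (fun s => f (s *: v + x)) ('D_v f x).
  by have := @is_derive_line R E f x v 0; rewrite scale0r add0r => /(_ df).
have H : is_derive (0 : R) 1 (phi \o (fun s => f (s *: v + x))) (d * 'D_v f x).
  have dphi0 : is_derive (f ((0 : R) *: v + x)) 1 phi d by rewrite scale0r add0r.
  exact: (@is_derive1_comp _ phi (fun s => f (s *: v + x)) 0 d _ dphi0 df0).
have E : (fun h : R => h^-1 *: ((phi \o f) (h *: v + x) - (phi \o f) x)) =
   (fun h : R => h^-1 *: ((phi \o (fun s => f (s *: v + x))) (h *: (1 : R) + 0) -
       (phi \o (fun s => f (s *: v + x))) 0)).
  by apply/funext => h /=; rewrite scale0r add0r addr0 [h *: 1]mulr1.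
have [H1 H2] := H; split; first by move: H1; rewrite /derivable E.
by rewrite -H2 /derive E.
Qed.

(** [phi m] is the [m]-th derivative of [phi 0]. The whole sequence is a parameter because the
    induction on [k] passes to the shifted sequence. *)
Lemma Ck_comp_real k D (O : set R) (phi : nat -> R -> R) f : open D ->
  (forall m t, O t -> is_derive t 1 (phi m) (phi m.+1 t)) ->
  Ck k D f -> (forall x, D x -> O (f x)) -> Ck k D (phi 0%N \o f).
Proof.
move=> oD dphi; elim: k phi dphi => [|k IH] phi dphi cf fO.
  move=> x Dx; apply: continuous_comp; first exact: cf.
  apply: differentiable_continuous; apply/derivable1_diffP.
  by have [] := dphi 0%N _ (fO _ Dx).
have [_ df] := cf; split.
  move=> x Dx; apply: continuous_comp; first exact: Ck_continuous cf Dx.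
  apply: differentiable_continuous; apply/derivable1_diffP.
  by have [] := dphi 0%N _ (fO _ Dx).
move=> i; have [d c] := df i; split.
  move=> x Dx; have [] // := is_derive_comp_real (d x Dx) (dphi 0%N _ (fO _ Dx)).
have := IH (fun m => phi m.+1) (fun m => dphi m.+1) (CkS cf) fO.
move=> /(CkM oD)/(_ c); apply: Ck_congr => // x Dx /=.
by have [_ <-] := is_derive_comp_real (d x Dx) (dphi 0%N _ (fO _ Dx)).
Qed.

Lemma Ck_differentiable k D f x : open D -> Ck k.+1 D f -> D x ->
  differentiable f x /\
  forall v, 'd f x v = \sum_(i < n) v ord0 i * partial i f x.
Proof.
move=> oD [_ H] Dx; apply: (continuous_partial_differentiable oD Dx).
  by move=> y i Dy; have [+ _] := H i; exact.
by move=> i; have [_ /Ck_continuous] := H i; exact.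
Qed.

End partial_calculus.

Section composition.
Variables (R : realType) (n m : nat).
Implicit Types (D : set 'rV[R]_n) (O : set 'rV[R]_m) (T : 'rV[R]_n -> 'rV[R]_m).

Lemma continuous_rowP T (x : 'rV[R]_n) :
  (forall j, {for x, continuous (fun y : 'rV[R]_n => T y ord0 j)}) -> {for x, continuous T}.
Proof.
move=> H; rewrite /prop_for /continuous_at.
apply/(@cvgrPdist_lt _ _ _ (nbhs x)) => e e0; near=> y.
apply: norm_lt_coord => // i; rewrite !mxE; move: i.
by near: y; apply: filter_forall => j; exact: (cvgrPdist_lt _ _).1 (H j) _ e0.
Unshelve. all: by end_near. Qed.

Lemma chain_rule (f : 'rV[R]_m -> R) T (x v : 'rV[R]_n) : differentiable f (T x) ->
  (forall j, derivable (fun y => T y ord0 j) x v) ->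
  is_derive x v (f \o T) ('d f (T x) ('D_v T x) : R) /\
  forall j, 'D_v T x ord0 j = 'D_v (fun y => T y ord0 j) x.
Proof.
move=> df dT.
have dTx : derivable T x v by apply/derivable_mxP => i j; rewrite ord1; exact: dT.
split; last by move=> j; rewrite derive_mx// mxE.
have [L1 L2] : is_derive (0 : R) 1 (fun s => T (s *: v + x)) ('D_v T x).
  have E : (fun h : R => h^-1 *: (T ((h *: (1 : R) + 0) *: v + x) - T ((0 : R) *: v + x))) =
      (fun h => h^-1 *: (T (h *: v + x) - T x)).
    by apply/funext => h; rewrite addr0 [h *: 1]mulr1 scale0r add0r.
  by split; [rewrite /derivable E | rewrite /derive E].
have Ld : differentiable (fun s : R => T (s *: v + x)) (0 : R) by apply/derivable1_diffP.
have df0 : differentiable f (T ((0 : R) *: v + x)) by rewrite scale0r add0r.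
have Cd := differentiable_comp Ld df0.
have C0 : is_derive (0 : R) 1 (f \o (fun s : R => T (s *: v + x))) ('d f (T x) ('D_v T x)).
  split; first exact: diff_derivable.
  rewrite (deriveE _ Cd) (diff_comp Ld df0) /= -(deriveE _ Ld) L2.
  by rewrite scale0r add0r.
have E : (fun h : R => h^-1 *: ((f \o T) (h *: v + x) - (f \o T) x)) =
   (fun h : R => h^-1 *: ((f \o (fun s : R => T (s *: v + x))) (h *: (1 : R) + 0) -
       (f \o (fun s : R => T (s *: v + x))) 0)).
  by apply/funext => h /=; rewrite scale0r add0r addr0 [h *: 1]mulr1.
have [H1 H2] := C0; split; first by move: H1; rewrite /derivable E.
by rewrite -H2 /derive E.
Qed.

(** By the chain rule a partial of the composite is a sum of products of [partial j f] composed with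
    [T] and a partial of [T]; the induction hypothesis handles the first factor once the components
    of [T] are demoted by one order. *)
Lemma Ck_comp k D O f T : open D -> open O ->
  Ck k O f -> (forall j, Ck k D (fun x => T x ord0 j)) ->
  (forall x, D x -> O (T x)) -> Ck k D (f \o T).
Proof.
move=> oD oO + + DO; elim: k f => [|k IH] f cf cT.
  move=> x Dx; apply: continuous_comp; last exact/cf/DO.
  by apply: continuous_rowP => j; exact: cT.
split.
  move=> x Dx; apply: continuous_comp; last exact: Ck_continuous cf (DO _ Dx).
  by apply: continuous_rowP => j; exact: Ck_continuous (cT j) Dx.
have [_ df] := cf.
have chain i x : D x -> is_derive x (delta_mx ord0 i) (f \o T)
    (\sum_j partial j f (T x) * partial i (fun y => T y ord0 j) x).
  move=> Dx; have [fd fdE] := Ck_differentiable oO cf (DO _ Dx).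
  have [|H1 H2] := @chain_rule f T x (delta_mx ord0 i) fd.
    by move=> j; have [_ /(_ i)[+ _]] := cT j; exact.
  apply: is_derive_eq H1 _; rewrite fdE; apply: eq_bigr => j _.
  by rewrite H2 mulrC.
move=> i; split; first by move=> x Dx; have [] := chain i x Dx.
apply: (@Ck_congr _ _ _ _ (fun x =>
    \sum_j (partial j f \o T) x * partial i (fun y => T y ord0 j) x)) => //.
  by move=> x Dx; have [_] := chain i x Dx.
apply: Ck_sum => // j _; apply: CkM => //.
  apply: IH; first by have [] := df j.
  by move=> l; exact: CkS.
by have [_ /(_ i)[]] := cT j.
Qed.

End composition.

Section smooth_functions.
Variables (R : realType) (n : nat).
Local Notation E := 'rV[R]_n.
Local Notation dl i := (delta_mx ord0 i : E).
Implicit Types (f g : E -> R) (x y z : E) (D : set E).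

Lemma smooth_on_continuous D f x : smooth_on D f -> D x -> {for x, continuous f}.
Proof. by move=> /smooth_onP/(_ 0%N); exact. Qed.

Lemma smooth_on_derivable D f x i : smooth_on D f -> D x -> derivable f x (dl i).
Proof. by move=> sf Dx; have [_] := sf [::] x Dx; exact. Qed.

Lemma smooth_on_partial D f i : smooth_on D f -> smooth_on D (partial i f).
Proof.
by move=> sf s x Dx; have := sf (rcons s i) x Dx; rewrite /iter_partial foldr_rcons.
Qed.

Lemma smooth_on_iter_partial D f s : smooth_on D f -> smooth_on D (iter_partial s f).
Proof. by move=> sf; elim: s => [//|i s IH]; exact: smooth_on_partial. Qed.

Lemma smooth_on_congr D f g : open D -> (forall y, D y -> f y = g y) ->
  smooth_on D f -> smooth_on D g.
Proof.
by move=> oD fg /smooth_onP sf; apply/smooth_onP => k; exact: Ck_congr (sf k).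
Qed.

Lemma smooth_on_sub D D' f : D' `<=` D -> smooth_on D f -> smooth_on D' f.
Proof. by move=> DD sf s x /DD; exact: sf. Qed.

Lemma smooth_on_local D f :
  (forall x, D x -> exists2 D', D' x & smooth_on D' f) -> smooth_on D f.
Proof. by move=> H s x /H[D' D'x sf]; exact: sf. Qed.

Lemma smooth_on_cst {D} a : smooth_on D (fun=> a).
Proof. by apply/smooth_onP => k; exact: Ck_cst. Qed.

Lemma smooth_on_coord {D} i : smooth_on D (fun x => x ord0 i).
Proof. by apply/smooth_onP => k; exact: Ck_coord. Qed.

Lemma smooth_onD D f g : open D -> smooth_on D f -> smooth_on D g ->
  smooth_on D (fun x => f x + g x).
Proof.
move=> oD /smooth_onP sf /smooth_onP sg; apply/smooth_onP => k; exact: CkD.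
Qed.

Lemma smooth_onM D f g : open D -> smooth_on D f -> smooth_on D g ->
  smooth_on D (fun x => f x * g x).
Proof.
move=> oD /smooth_onP sf /smooth_onP sg; apply/smooth_onP => k; exact: CkM.
Qed.

Lemma smooth_onN D f : open D -> smooth_on D f -> smooth_on D (fun x => - f x).
Proof.
move=> oD sf; apply: (smooth_on_congr oD _ (smooth_onM oD (smooth_on_cst (-1)) sf)).
by move=> y _; rewrite mulN1r.
Qed.

Lemma smooth_onB D f g : open D -> smooth_on D f -> smooth_on D g ->
  smooth_on D (fun x => f x - g x).
Proof. by move=> oD sf sg; exact: (smooth_onD oD sf (smooth_onN oD sg)). Qed.

Lemma smooth_on_sum D (I : Type) (r : seq I) (P : pred I) (F : I -> E -> R) : open D ->
  (forall i, P i -> smooth_on D (F i)) ->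
  smooth_on D (fun x => \sum_(i <- r | P i) F i x).
Proof.
move=> oD H; apply/smooth_onP => k; apply: Ck_sum => // i /H /smooth_onP; exact.
Qed.

Lemma smooth_on_prod D (I : Type) (r : seq I) (P : pred I) (F : I -> E -> R) : open D ->
  (forall i, P i -> smooth_on D (F i)) ->
  smooth_on D (fun x => \prod_(i <- r | P i) F i x).
Proof.
move=> oD H; apply/smooth_onP => k; apply: Ck_prod => // i /H /smooth_onP; exact.
Qed.

Lemma smooth_on_comp_real D (O : set R) (phi : nat -> R -> R) f : open D ->
  (forall m t, O t -> is_derive t 1 (phi m) (phi m.+1 t)) ->
  smooth_on D f -> (forall x, D x -> O (f x)) -> smooth_on D (fun x => phi 0%N (f x)).
Proof.
move=> oD dphi /smooth_onP sf fO; apply/smooth_onP => k.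
exact: (Ck_comp_real oD dphi (sf k) fO).
Qed.

Lemma smooth_on_differentiable D f x : open D -> smooth_on D f -> D x ->
  differentiable f x /\
  forall v, 'd f x v = \sum_(i < n) v ord0 i * partial i f x.
Proof. by move=> oD /smooth_onP /(_ 1%N); exact: Ck_differentiable. Qed.

Lemma smooth_onV D f : open D -> smooth_on D f -> (forall x, D x -> f x != 0) ->
  smooth_on D (fun x => (f x)^-1).
Proof.
move=> oD sf f0.
(* The successive derivatives of the inverse function. *)
pose phi (m : nat) (t : R) : R := (-1) ^+ m * (m`!)%:R * (t^-1) ^+ m.+1.
have := @smooth_on_comp_real D [set t | t != 0] phi f oD _ sf f0.
rewrite /phi => H; apply: (smooth_on_congr oD _ (H _)).
  by move=> y _; rewrite fact0 expr0 !mul1r expr1.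
move=> m t /= t0.
have -> : (fun t : R => (-1) ^+ m * (m`!)%:R * t^-1 ^+ m.+1) =
    ((-1) ^+ m * (m`!)%:R) *: ((fun t : R => t^-1) ^+ m.+1).
  by apply/funext => u; rewrite /= fctE.
have dV : is_derive t 1 (fun t : R => t^-1) (- t ^- 2).
  have dt : derivable (id : R -> R) t 1 by [].
  split; first exact: (derivableV t0 dt).
  by have := deriveV t0 dt; rewrite derive_id [_ *: _]mulr1.
apply: is_derive_eq; rewrite factS natrM.
change (((-1) ^+ m * m`!%:R) * ((m.+1%:R * t^-1 ^+ m) * - (t ^+ 2)^-1) =
  (-1) ^+ m.+1 * (m.+1%:R * m`!%:R) * t^-1 ^+ m.+2).
rewrite -exprVn !exprS expr0; move: (t^-1) (m.+1%:R) (m`!%:R) => u a b.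
by move: (u ^+ m) ((-1) ^+ m) => w z; ring.
Qed.

Lemma smooth_on_cos D f : open D -> smooth_on D f -> smooth_on D (fun x => cos (f x)).
Proof.
move=> oD sf.
(* Each derivative of the cosine shifts its argument by a quarter period. *)
have := @smooth_on_comp_real D setT (fun m t => cos (t + m%:R * (pi / 2))) f oD _ sf.
move=> H; apply: (smooth_on_congr oD _ (H _ _)) => //.
  by move=> y _; rewrite mul0r addr0.
move=> m t _.
have dc : is_derive t 1 (fun t : R => t + m%:R * (pi / 2)) (1 + 0).
  by apply: is_deriveD.
have := @is_derive1_comp R cos _ t _ _ (is_derive_cos _) dc.
move=> /is_derive_eq; apply.
have -> : t + m.+1%:R * (pi / 2) = t + m%:R * (pi / 2) + pi / 2.
  by rewrite -[m.+1%:R]natr1; move: (pi / 2) => p; ring.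
by rewrite cosDpihalf addr0 mulr1.
Qed.

Lemma smooth_on_exp D f : open D -> smooth_on D f -> smooth_on D (fun x => expR (f x)).
Proof.
move=> oD sf.
have H := @smooth_on_comp_real D setT (fun m t => expR t) f oD _ sf.
by apply: H.
Qed.

(** The open sets [D] and the complement of [K] cover the space; the product is smooth on the first
    as a product and is zero on the second, whatever values [f] takes outside [D]. *)
Lemma smooth_on_extend D (K : set E) f phi : open D -> closed K -> K `<=` D ->
  smooth_on D f -> smooth_on setT phi -> (forall x, ~ K x -> phi x = 0) ->
  smooth_on setT (fun x => f x * phi x).
Proof.
move=> oD cK KD sf sphi phi0; apply: smooth_on_local => x _.
have [Kx|nKx] := pselect (K x).
  exists D; first exact: KD.
  exact: (smooth_onM oD sf (smooth_on_sub (@subsetT _ D) sphi)).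
exists (~` K) => //; apply: (smooth_on_congr (closed_openC cK) _ (smooth_on_cst 0)).
by move=> y /phi0 ->; rewrite mulr0.
Qed.

Lemma partialD D f g x i : open D -> smooth_on D f -> smooth_on D g -> D x ->
  partial i (fun y => f y + g y) x = partial i f x + partial i g x.
Proof.
move=> oD sf sg Dx; apply: deriveD; exact: smooth_on_derivable Dx.
Qed.

Lemma partialM D f g x i : open D -> smooth_on D f -> smooth_on D g -> D x ->
  partial i (fun y => f y * g y) x = f x * partial i g x + partial i f x * g x.
Proof.
move=> oD sf sg Dx; rewrite [X in _ + X]mulrC.
by apply: deriveM; exact: smooth_on_derivable Dx.
Qed.

End smooth_functions.

Section smooth_composition.
Variables (R : realType) (n m : nat).
Implicit Types (D : set 'rV[R]_n) (O : set 'rV[R]_m) (T : 'rV[R]_n -> 'rV[R]_m).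

Lemma smooth_on_comp D O (f : 'rV[R]_m -> R) T : open D -> open O ->
  smooth_on O f -> (forall j, smooth_on D (fun x => T x ord0 j)) ->
  (forall x, D x -> O (T x)) -> smooth_on D (fun x => f (T x)).
Proof.
move=> oD oO /smooth_onP sf sT DO; apply/smooth_onP => k.
apply: (Ck_comp oD oO (sf k)) => // j; have /smooth_onP := sT j; exact.
Qed.

Lemma smooth_on_map_differentiable D T x : open D ->
  (forall j, smooth_on D (fun x => T x ord0 j)) -> D x -> differentiable T x /\
  jacobian T x = \matrix_(i, j) partial i (fun y => T y ord0 j) x.
Proof.
move=> oD sT Dx.
have Td : differentiable T x.
  have -> : T = \sum_j (fun y => T y ord0 j *: (delta_mx ord0 j : 'rV[R]_m)).
    by apply/funext => y; rewrite fct_sumE; exact: matrix.row_sum_delta.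
  apply: differentiable_sum => j; apply: differentiableZl.
  by have [] := smooth_on_differentiable oD (sT j) Dx.
split => //; apply/matrixP => i j; rewrite !mxE.
have := deriveE (delta_mx ord0 i) Td; rewrite derive_mx; last exact: diff_derivable.
by move=> <-; rewrite mxE.
Qed.

End smooth_composition.

(** The archimedean property in the form in which limits are taken below: an inequality that holds
    up to every error [c / N.+1] holds without error. *)
Lemma le_archi (R : realType) (a b c : R) :
  (forall N : nat, a <= b + c / N.+1%:R) -> a <= b.
Proof.
move=> H; rewrite leNgt; apply/negP => ba.
have c0 : 0 < c.
  rewrite ltNge; apply/negP => c0; have := H 0%N; rewrite divr1; lra.
have [N] : exists N : nat, c / (a - b) < N%:R.
  exists (Num.truncn (c / (a - b))).+1; exact: truncnS_gt.
rewrite ltr_pdivrMr ?subr_gt0// => cN.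
have := H N; rewrite -lerBlDl ler_pdivlMr ?ltr0n// => H2.
suff : (a - b) * N.+1%:R < (a - b) * N.+1%:R by rewrite ltxx.
apply: le_lt_trans H2 _; apply: lt_le_trans cN _.
by rewrite mulrC ler_wpM2l ?ler_nat// subr_ge0 ltW.
Qed.

Lemma cvg_harmonic_rate (R : realType) (u : nat -> R) (C : R) :
  (forall N M, (N <= M)%N -> `|u N - u M| <= C / N.+1%:R) ->
  exists l, forall N, `|u N - l| <= C / N.+1%:R.
Proof.
move=> H.
have C0 : 0 <= C by have := H 0%N 0%N (leqnn _); rewrite subrr normr0 divr1.
have [l ul] : exists l : R, (u : R^nat) @ \oo --> l.
  suff : cvg (u @ \oo) by move=> /cvg_ex.
  apply: cauchy_cvg; apply/cauchy_exP => e e0; rewrite -/(0 < e) in e0.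
  pose N := (Num.truncn (C / e)).
  exists (u N); exists N => // M NM /=; apply: le_lt_trans (H _ _ NM) _.
  rewrite ltr_pdivrMr ?ltr0n// mulrC -ltr_pdivrMr//; exact: truncnS_gt.
exists l => N; apply: (@le_archi _ _ _ 1) => k.
have k1 : 0 < 1 / k.+1%:R :> R by rewrite divr_gt0.
have [M NM Ml] : exists2 M, (N <= M)%N & `|l - u M| < 1 / k.+1%:R.
  have [M _ Ml] := (cvgrPdist_lt _ _).1 ul _ k1.
  by exists (maxn N M); [exact: leq_maxl|apply: Ml; exact: leq_maxr].
rewrite -(subrKA (u M)); apply: le_trans (ler_normD _ _) _.
by apply: lerD; [exact: H|rewrite distrC; exact: ltW].
Qed.

(** * Uniform limits of smooth functions *)

Section smooth_limit.
Variables (R : realType) (n : nat).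
Local Notation E := 'rV[R]_n.
Local Notation dl i := (delta_mx ord0 i : E).

Lemma continuous_limit_rate (F : nat -> E -> R) (G : E -> R) (C : R) :
  (forall N, continuous (F N)) ->
  (forall N x, `|F N x - G x| <= C / N.+1%:R) -> continuous G.
Proof.
move=> cF FG x; apply/(@cvgrPdist_le _ _ _ (nbhs x)) => e e0.
have e3 : 0 < e / 3 by lra.
have [N Ne] : exists N : nat, C / N.+1%:R <= e / 3.
  exists (Num.truncn (C / (e / 3))).
  rewrite ler_pdivrMr ?ltr0n// mulrC -ler_pdivrMr//; exact/ltW/truncnS_gt.
near=> y.
have -> : G x - G y = (G x - F N x) + (F N x - F N y) + (F N y - G y) by ring.
have h1 : `|G x - F N x| <= e / 3 by rewrite distrC (le_trans (FG _ _)).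
have h2 : `|F N y - G y| <= e / 3 by rewrite (le_trans (FG _ _)).
have h3 : `|F N x - F N y| <= e / 3.
  by near: y; exact: (@cvgrPdist_le _ _ _ (nbhs x) _ _ _).1 (cF N x) _ e3.
apply: le_trans (ler_normD _ _) _; have := ler_normD (G x - F N x) (F N x - F N y); lra.
Unshelve. all: by end_near. Qed.

(** For a fixed increment [h] the mean value theorem applies to [F N] on the segment; [N] is sent to
    infinity before [h] tends to 0, and continuity of [H] absorbs the unknown intermediate point. *)
Lemma is_derive_limit_rate (F : nat -> E -> R) (G H : E -> R) (C C' : R) (v x : E) :
  (forall N y, derivable (F N) y v) -> continuous H ->
  (forall N y, `|F N y - G y| <= C / N.+1%:R) ->
  (forall N y, `|'D_v (F N) y - H y| <= C' / N.+1%:R) ->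
  is_derive x v G (H x).
Proof.
move=> dF cH FG FH.
suff L : (fun h : R => h^-1 *: (G (h *: v + x) - G x)) @ 0^' --> H x.
  by split; [apply/cvg_ex; exists (H x)|apply/cvg_lim].
apply/cvgrPdist_le => e e0.
have [d /= d0 dP] : exists2 d : R, 0 < d &
    forall t : R, `|t| < d -> `|H (t *: v + x) - H x| <= e.
  have cHt : (fun t : R => H (t *: v + x)) @ (0 : R) --> H x.
    have -> : H x = H ((0 : R) *: v + x) by rewrite scale0r add0r.
    apply: (@continuous_comp _ _ _ (fun t : R => t *: v + x) H); last exact: cH.
    apply: (@cvgD _ _ _ (nbhs (0 : R))); last exact: cvg_cst.
    exact: (@cvgZr_tmp).
  have /nbhs_ballP[d d0 dP] : nbhs (0 : R) [set t : R | `|H x - H (t *: v + x)| <= e].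
    exact: (cvgrPdist_le _ _).1 cHt _ e0.
  exists d => // t td; rewrite distrC; apply: dP.
  by rewrite /ball/= sub0r normrN.
near=> h.
have h0 : h != 0 by near: h; exact: nbhs_dnbhs_neq.
have hd : `|h| < d.
  by near: h; exact: dnbhs0_lt.
suff K : `|G (h *: v + x) - G x - h * H x| <= `|h| * e.
  have -> : H x - h^-1 *: (G (h *: v + x) - G x) =
      - (h^-1 * (G (h *: v + x) - G x - h * H x)).
    by rewrite mulrBr mulrA mulVf// mul1r opprB.
  by rewrite normrN normrM normfV ler_pdivrMl ?normr_gt0.
(* Two values of [F N] are compared with [G], and one derivative, multiplied by [h], with [H]. *)
apply: (@le_archi _ _ _ (2 * C + `|h| * C')) => N.
have [t t01 FE] := @mean_value_line R E (F N) x v h (fun t _ => dF N _).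
have h1 := FG N (h *: v + x); have h2 := FG N x; have h3 := FH N ((t * h) *: v + x).
have h4 : `|H ((t * h) *: v + x) - H x| <= e.
  apply: dP; rewrite normrM; apply: le_lt_trans hd.
  by rewrite ler_piMl// ger0_norm//; case/andP: t01.
have -> : G (h *: v + x) - G x - h * H x =
   - (F N (h *: v + x) - G (h *: v + x)) + (F N x - G x) +
   (h * ('D_v (F N) ((t * h) *: v + x) - H ((t * h) *: v + x)) +
    h * (H ((t * h) *: v + x) - H x)).
  by rewrite mulrBr -FE; ring.
apply: le_trans (ler_normD _ _) _.
have g1 := ler_normD (- (F N (h *: v + x) - G (h *: v + x))) (F N x - G x).
have g2 := ler_normD (h * ('D_v (F N) ((t * h) *: v + x) - H ((t * h) *: v + x)))
   (h * (H ((t * h) *: v + x) - H x)).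
rewrite normrN in g1; rewrite !normrM in g2.
have g3 : `|h| * `|'D_v (F N) ((t * h) *: v + x) - H ((t * h) *: v + x)| <=
    `|h| * (C' / N.+1%:R) by rewrite ler_wpM2l.
have g4 : `|h| * `|H ((t * h) *: v + x) - H x| <= `|h| * e by rewrite ler_wpM2l.
move: g1 g2 g3 g4 h1 h2 h3 h4; move: (N.+1%:R^-1) => iN; lra.
Unshelve. all: by end_near. Qed.

(** Every derivative sequence is Cauchy at its own uniform rate and so has a limit [g s]. Each
    [g (i :: s)] is the partial derivative of [g s], and induction on the list identifies [g s] with
    the iterated partial of [g [::]]. *)
Lemma smooth_limit (f : nat -> E -> R) :
  (forall N, smooth_on setT (f N)) ->
  (forall s, exists C, forall N M x, (N <= M)%N ->
    `|iter_partial s (f N) x - iter_partial s (f M) x| <= C / N.+1%:R) ->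
  exists2 g, smooth_on setT g & exists C, forall N x, `|f N x - g x| <= C / N.+1%:R.
Proof.
move=> sf Cf.
have [g gP] : exists g : seq 'I_n -> E -> R, forall s, exists C, forall N x,
    `|iter_partial s (f N) x - g s x| <= C / N.+1%:R.
  have H s x : exists l, forall N,
      `|iter_partial s (f N) x - l| <= projT1 (cid (Cf s)) / N.+1%:R.
    by apply: cvg_harmonic_rate => N M NM; case: cid => C /=; exact.
  exists (fun s x => projT1 (cid (H s x))) => s.
  by exists (projT1 (cid (Cf s))) => N x; case: (cid (H s x)).
have cg s : continuous (g s).
  have [C HC] := gP s; apply: (continuous_limit_rate _ HC) => N x.
  by have [] := sf N s x I.
have dg s i x : is_derive x (dl i) (g s) (g (i :: s) x).
  have [C HC] := gP s; have [C' HC'] := gP (i :: s).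
  apply: (@is_derive_limit_rate (fun N => iter_partial s (f N)) (g s) (g (i :: s)) C C' (dl i) x _ (cg _) HC HC').
  by move=> N y; have [_] := sf N s y I; exact.
have gE s : iter_partial s (g [::]) = g s.
  elim: s => [//|i s IH] /=; apply/funext => x; rewrite /partial -/(iter_partial s _) IH.
  by have [_] := dg s i x.
exists (g [::]); last exact: (gP [::]).
move=> s x _; rewrite gE; split; first exact: cg.
by move=> i; have [] := dg s i x.
Qed.

End smooth_limit.

(** * Lebesgue measure on row vectors *)

Section borel_rV.
Variables (R : realType) (n : nat).
Local Notation E := 'rV[R]_n.

(** A countable basis of the topology, made of balls with rational centre and radius [1 / m.+1].
    Indexing by [nat] through [unpickle] makes it directly usable in countable unions; codes of
    nothing give the empty set. *)
Definition rat_ball (k : nat) : set E :=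
  if @unpickle ('rV[rat]_n * nat)%type k is Some (q, m)
  then ball (\row_i (ratr (q ord0 i) : R)) m.+1%:R^-1 else set0.

Lemma rat_ball_basis (G : set E) x : open G -> G x ->
  exists k, rat_ball k x /\ rat_ball k `<=` G.
Proof.
move=> oG Gx; have /nbhs_ballP[e /= e0 eG] : nbhs x G by exact: open_nbhs_nbhs.
(* A rational ball of radius [1 / m.+1] that contains [x] has diameter at most [2 / m.+1 < e]. *)
pose m := Num.truncn (2 / e).
have m0 : 0 < m.+1%:R^-1 :> R by rewrite invr_gt0.
have me : 2 * m.+1%:R^-1 < e.
  rewrite ltr_pdivrMr ?ltr0n// mulrC -ltr_pdivrMr//; exact: truncnS_gt.
have H i : exists q : rat, ratr q \in `]x ord0 i - m.+1%:R^-1, x ord0 i + m.+1%:R^-1[.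
  by move: m0; move: (m.+1%:R^-1 : R) => u u0; apply: rat_in_itvoo; lra.
pose q : 'rV[rat]_n := \row_i projT1 (cid (H i)).
have qx i : `|ratr (q ord0 i) - x ord0 i| < m.+1%:R^-1.
  rewrite mxE; case: cid => r /=; rewrite in_itv/= => /andP[r1 r2].
  rewrite ltr_norml; move: r1 r2; move: (m.+1%:R^-1 : R) => u r1 r2.
  by apply/andP; split; lra.
have E1 : rat_ball (pickle (q, m)) = ball (\row_i (ratr (q ord0 i) : R)) m.+1%:R^-1.
  by rewrite /rat_ball pickleK.
exists (pickle (q, m)); rewrite E1; split.
  by apply/ballP_coord => // i; rewrite mxE.
move=> y /(ballP_coord _ _ m0) qy; apply: eG; apply/ballP_coord => // i.
have := qy i; rewrite mxE => qyi; have := qx i; move: qyi; rewrite !ltr_norml => /andP[+ +] /andP[].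
by move: (ratr _) (m.+1%:R^-1 : R) me => w u *; apply/andP; split; lra.
Qed.

Lemma measurable_coord_ball (x : E) (r : R) : measurable (ball x r).
Proof.
have [r0|r0] := ltP 0 r; last first.
  rewrite (_ : ball x r = set0)//; apply/seteqP; split => // y.
  by rewrite -ball_normE /= => xy; have := le_lt_trans (normr_ge0 _) xy; lra.
have -> : ball x r = \big[setI/setT]_(i < n) (@rV_coord _ R n i @^-1` (ball (x ord0 i) r)).
  apply/seteqP; split => y.
    move=> /(ballP_coord _ _ r0) xy; rewrite -bigcap_seq => i _ /=.
    exact: xy.
  rewrite -bigcap_seq => xy; apply/ballP_coord => // i.
  by apply: xy => /=; rewrite mem_index_enum.
apply: bigsetI_measurable => i _; rewrite -[X in measurable X]setTI.
by apply: measurable_rV_coord => //; exact: measurable_ball.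
Qed.

Lemma measurable_rat_ball k : measurable (rat_ball k).
Proof.
rewrite /rat_ball; case: unpickle => [[q m]|]; last exact: measurable0.
exact: measurable_coord_ball.
Qed.

Lemma open_measurable_rV (G : set E) : open G -> measurable G.
Proof.
move=> oG; have -> : G = \bigcup_k (if `[< rat_ball k `<=` G >] then rat_ball k else set0).
  apply/seteqP; split => x.
    move=> /(rat_ball_basis oG)[k [kx kG]]; exists k => //.
    by rewrite (asboolT kG).
  by case=> k _; case: asboolP => // H; exact: H.
apply: bigcupT_measurable => k; case: ifP => _; [exact: measurable_rat_ball|exact: measurable0].
Qed.

Lemma closed_measurable_rV (G : set E) : closed G -> measurable G.
Proof.
move=> cG; rewrite -[G]setCK; apply: measurableC; apply: open_measurable_rV.
exact: closed_openC.
Qed.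

Lemma continuous_measurable_rV (D : set E) (f : E -> R) : open D ->
  (forall x, D x -> {for x, continuous f}) -> measurable_fun D f.
Proof.
move=> oD cf; apply: (measurability _ (RGenOpens.measurableE R)).
move=> _ [_ [a [b ->] <-]]; apply: open_measurable_rV.
rewrite openE => x [Dx fx]; apply: filterI; first exact: open_nbhs_nbhs.
by apply: (cf _ Dx); apply: open_nbhs_nbhs; split => //; exact: interval_open.
Qed.

(** A Lindelof argument: the basis balls on which the trace of [A] is null are countably many and
    cover [A]. *)
Lemma negligible_local (m : {measure set E -> \bar R}) (A : set E) :
  (forall x, A x -> exists2 G, open G /\ G x & m.-negligible (A `&` G)) ->
  m.-negligible A.
Proof.
move=> H.
have : m.-negligible (\bigcup_k
    (if `[< m.-negligible (A `&` rat_ball k) >] then A `&` rat_ball k else set0)).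
  by apply: negligible_bigcup => k; case: asboolP => // _; exact: negligible_set0.
apply: negligibleS => x Ax.
have [W [oO Ox] mO] := H x Ax.
have [k [kx kO]] := rat_ball_basis oO Ox; exists k => //.
rewrite asboolT//; apply: negligibleS mO; exact: setIS.
Qed.

Definition prod_set (B : 'I_n -> set R) : set E := [set x | forall i, B i (x ord0 i)].

Lemma measurable_prod_set B : (forall i, measurable (B i)) -> measurable (prod_set B).
Proof.
move=> mB.
have -> : prod_set B = \big[setI/setT]_(i < n) (@rV_coord _ R n i @^-1` (B i)).
  apply/seteqP; split => y /=.
    by move=> xy; rewrite -bigcap_seq => i _ /=; exact: xy.
  by rewrite -bigcap_seq => xy i; apply: xy => /=; rewrite mem_index_enum.
apply: bigsetI_measurable => i _; rewrite -[X in measurable X]setTI.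
exact: measurable_rV_coord.
Qed.

End borel_rV.

Section box_measure.
Variable R : realType.

Lemma cons_rV0 n (z : 'rV[R]_n * R) : cons_rV z ord0 ord0 = z.2.
Proof.
rewrite /cons_rV (_ : (ord0 : 'I_n.+1) = lshift n (ord0 : 'I_1)); last exact/val_inj.
by apply: etrans (row_mxEl _ _ _ _) _; rewrite mxE !ord1.
Qed.

Lemma cons_rVS n (z : 'rV[R]_n * R) j : cons_rV z ord0 (lift ord0 j) = z.1 ord0 j.
Proof. by rewrite -rshift1; exact: row_mxEr. Qed.

Lemma lebesgue_rVS n (A : set 'rV[R]_n.+1) :
  lebesgue_rV A = product_measure1 (@lebesgue_rV R n) (@lebesgue_measure R)
    (@cons_rV R n @^-1` A).
Proof. by []. Qed.

Lemma lebesgue_prod_set n (B : 'I_n -> set R) (b : 'I_n -> R) :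
  (forall i, measurable (B i)) -> (forall i, lebesgue_measure (B i) = (b i)%:E) ->
  lebesgue_rV (prod_set B) = (\prod_(i < n) b i)%:E.
Proof.
elim: n B b => [|n IH] B b mB bB.
  rewrite big_ord0 /= diracE (_ : _ \in _ = true)//.
  by apply/mem_set => -[].
rewrite lebesgue_rVS.
have -> : @cons_rV R n @^-1` prod_set B =
    prod_set (fun j : 'I_n => B (lift ord0 j)) `*` B ord0.
  apply/seteqP; split => z.
    move=> Bz; split; first by move=> j; rewrite -cons_rVS; exact: Bz.
    by rewrite -[z.2]cons_rV0; exact: Bz.
  move=> [z1 z2] i; have [j ->|->] := unliftP ord0 i.
    by rewrite cons_rVS; exact: z1.
  by rewrite cons_rV0.
have mP : measurable (prod_set (fun j : 'I_n => B (lift ord0 j))).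
  exact: measurable_prod_set.
transitivity (lebesgue_rV (prod_set (fun j : 'I_n => B (lift ord0 j))) *
    lebesgue_measure (B ord0))%E.
  by rewrite product_measure1E//; exact: mB.
rewrite (IH _ (fun j => b (lift ord0 j)))// bB -EFinM.
by rewrite big_ord_recl mulrC.
Qed.

Definition cube n (r : R) : set 'rV[R]_n := prod_set (fun=> `]- r, r[%classic).

Lemma measurable_cube n r : measurable (@cube n r).
Proof. exact: measurable_prod_set. Qed.

Lemma cube_lty n r : (lebesgue_rV (@cube n r) < +oo)%E.
Proof.
rewrite /cube (lebesgue_prod_set (b := fun=> if - r < r then r + r else 0)) ?ltry//.
move=> i; rewrite lebesgue_measure_itv /= lte_fin.
by case: ifP => // _; rewrite -EFinB opprK.
Qed.

Lemma norm_cube n (x : 'rV[R]_n) (r : R) : `|x| < r -> cube r x.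
Proof.
move=> xr i /=; rewrite in_itv/= -ltr_norml; exact: le_lt_trans (coord_le_norm _ _) xr.
Qed.

Lemma lebesgue_rV_sigma_finite n : sigma_finite [set: 'rV[R]_n] (@lebesgue_rV R n).
Proof.
exists (fun k => cube k%:R).
  apply/seteqP; split => // x _.
  exists (Num.truncn `|x|).+1 => //; apply: norm_cube; exact: truncnS_gt.
by move=> k; split; [exact: measurable_cube|exact: cube_lty].
Qed.

HB.instance Definition _ n := Measure_isSigmaFinite.Build _ _ _ (@lebesgue_rV R n)
  (lebesgue_rV_sigma_finite n).

End box_measure.

(** * Integrals of bounded functions with bounded support *)

Section bounded_support.
Variables (R : realType) (n : nat).
Local Notation E := 'rV[R]_n.
Local Notation mu := (@lebesgue_rV R n).
Implicit Types f g : E -> R.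

(** A class of integrands stable under all operations used below and contained in the integrable
    functions, so that integrability never has to be argued separately. *)
Definition bounded_supp f :=
  measurable_fun setT f /\
  exists r B : R, forall x, `|f x| <= B /\ (r <= `|x| -> f x = 0).

Lemma integrable_bounded_on_cube (A : set E) f (r B : R) : measurable A ->
  A `<=` cube r -> measurable_fun A f -> (forall x, A x -> `|f x| <= B) ->
  mu.-integrable A (EFin \o f).
Proof.
move=> mA Ar mf fB; apply: measurable_bounded_integrable => //.
  apply: le_lt_trans (cube_lty n r).
  by apply: le_measure => //; rewrite inE//; exact: measurable_cube.
exists B; split; first exact: num_real.
by move=> M BM x Ax; exact: le_trans (fB _ Ax) (ltW BM).
Qed.

Lemma bounded_supp_integrable f : bounded_supp f -> mu.-integrable setT (EFin \o f).
Proof.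
move=> [mf [r [B fB]]].
have E0 : EFin \o f = (EFin \o f) \_ (cube r).
  apply/funext => x; rewrite patchE; case: ifPn => // /negP xr /=.
  have [xr'|xr'] := ltP `|x| r; first by case: xr; apply/mem_set; exact: norm_cube.
  by rewrite (fB x).2.
rewrite E0; apply: (integrable_mkcond _ (@measurable_cube R n r)).1.
apply: (@integrable_bounded_on_cube _ _ r B) => //; first exact: measurable_cube.
  exact: measurable_funTS.
by move=> x _; have [] := fB x.
Qed.

Lemma bounded_suppM f g : bounded_supp f -> measurable_fun setT g ->
  (exists B, forall x, `|g x| <= B) -> bounded_supp (fun x => g x * f x).
Proof.
move=> [mf [r [B fB]]] mg [C gC]; split; first exact: measurable_funM.
exists r, (C * B) => x; have [h1 h2] := fB x; split.
  by rewrite normrM; apply: ler_pM.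
by move=> /h2 ->; rewrite mulr0.
Qed.

Lemma bounded_suppD f g : bounded_supp f -> bounded_supp g ->
  bounded_supp (fun x => f x + g x).
Proof.
move=> [mf [r [B fB]]] [mg [s [C gC]]]; split; first exact: measurable_funD.
exists (Num.max r s), (B + C) => x; have [h1 h2] := fB x; have [h3 h4] := gC x; split.
  by apply: le_trans (ler_normD _ _) _; exact: lerD.
by rewrite ge_max => /andP[/h2 -> /h4 ->]; rewrite addr0.
Qed.

Lemma bounded_suppZ f c : bounded_supp f -> bounded_supp (fun x => c * f x).
Proof.
move=> bf; apply: (@bounded_suppM f (fun=> c)) => //.
by exists `|c|.
Qed.

Lemma bounded_supp0 : bounded_supp (fun=> 0).
Proof. by split => //; exists 0, 0 => x; rewrite normr0. Qed.

Lemma bounded_supp_sum (I : Type) (s : seq I) (P : pred I) (F : I -> E -> R) :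
  (forall i, P i -> bounded_supp (F i)) ->
  bounded_supp (fun x => \sum_(i <- s | P i) F i x).
Proof.
move=> H; elim: s => [|i s IH].
  have -> : (fun x => \sum_(i <- [::] | P i) F i x) = fun=> 0.
    by apply/funext => x; rewrite big_nil.
  exact: bounded_supp0.
case Pi : (P i).
  have -> : (fun x => \sum_(j <- i :: s | P j) F j x) =
      (fun x => F i x + \sum_(j <- s | P j) F j x).
    by apply/funext => x; rewrite big_cons Pi.
  by apply: bounded_suppD => //; exact: H.
have -> : (fun x => \sum_(j <- i :: s | P j) F j x) =
    (fun x => \sum_(j <- s | P j) F j x).
  by apply/funext => x; rewrite big_cons Pi.
exact: IH.
Qed.

Definition integ f : R := \int[mu]_x f x.

Lemma integD f g : bounded_supp f -> bounded_supp g ->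
  integ (fun x => f x + g x) = integ f + integ g.
Proof. by move=> bf bg; apply: RintegralD => //; exact: bounded_supp_integrable. Qed.

Lemma integZ f c : bounded_supp f -> integ (fun x => c * f x) = c * integ f.
Proof. by move=> bf; apply: RintegralZl => //; exact: bounded_supp_integrable. Qed.

Lemma integ0 : integ (fun=> 0) = 0.
Proof. by rewrite /integ Rintegral_cst// mul0r. Qed.

Lemma integB f g : bounded_supp f -> bounded_supp g ->
  integ (fun x => f x - g x) = integ f - integ g.
Proof. by move=> bf bg; apply: RintegralB => //; exact: bounded_supp_integrable. Qed.

Lemma integ_sum (I : Type) (s : seq I) (P : pred I) (F : I -> E -> R) :
  (forall i, P i -> bounded_supp (F i)) ->
  integ (fun x => \sum_(i <- s | P i) F i x) = \sum_(i <- s | P i) integ (F i).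
Proof.
move=> H; elim: s => [|i s IH].
  rewrite big_nil -[RHS]integ0; congr integ.
  by apply/funext => x; rewrite big_nil.
rewrite big_cons; case: ifPn => Pi; rewrite -IH.
  rewrite -integD; [|exact: H|exact: bounded_supp_sum].
  by congr integ; apply/funext => x; rewrite big_cons Pi.
by congr integ; apply/funext => x; rewrite big_cons (negPf Pi).
Qed.

Lemma le_integ f g : bounded_supp f -> bounded_supp g -> (forall x, f x <= g x) ->
  integ f <= integ g.
Proof. by move=> bf bg fg; apply: le_Rintegral => //; exact: bounded_supp_integrable. Qed.

Lemma integ_abs f : bounded_supp f -> `|integ f| <= integ (fun x => `|f x|).
Proof. by move=> bf; apply: le_normr_Rintegral => //; exact: bounded_supp_integrable. Qed.

Lemma bounded_supp_abs f : bounded_supp f -> bounded_supp (fun x => `|f x|).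
Proof.
move=> [mf [r [B fB]]]; split; first exact: measurableT_comp.
by exists r, B => x; have [h1 h2] := fB x; rewrite normr_id; split => // /h2 ->; rewrite normr0.
Qed.

Lemma integ_dominated (f_ : nat -> E -> R) f g :
  (forall N, measurable_fun setT (f_ N)) -> measurable_fun setT f -> bounded_supp g ->
  (forall x, (fun N => f_ N x) @ \oo --> f x) ->
  (forall N x, `|f_ N x| <= g x) ->
  (fun N => integ (f_ N)) @ \oo --> integ f.
Proof.
move=> mf_ mf bg f_f f_g.
have [|||||h1 h2 h3] := @dominated_convergence _ E R mu setT measurableT
    (fun N x => (f_ N x)%:E) (fun x => (f x)%:E) (EFin \o g).
- by move=> N; exact/measurable_EFinP.
- exact/measurable_EFinP.
- by apply: aeW => x _; apply: cvg_EFin; [exact: nearW|exact: f_f].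
- exact: bounded_supp_integrable.
- by apply: aeW => x N _; rewrite /= lee_fin.
apply: fine_cvg => /=; rewrite fineK; first exact: h3.
exact: integrable_fin_num.
Qed.

Lemma smooth_measurable f : smooth_on setT f -> measurable_fun setT f.
Proof.
move=> sf; apply: continuous_measurable_rV => [|x _]; first exact: openT.
exact: smooth_on_continuous sf I.
Qed.

Lemma continuous_bounded_supp f (r : R) : continuous f ->
  (forall x, r <= `|x| -> f x = 0) -> bounded_supp f.
Proof.
move=> cf f0; split.
  by apply: continuous_measurable_rV => [|x _]; [exact: openT|exact: cf].
have [B fB] : exists B : R, forall x : E, `|x| <= r -> `|f x| <= B.
  have cK : compact [set x : E | `|x| <= r].
    apply: bounded_closed_compact.
      by exists r; split; [exact: num_real|move=> M rM x /= /le_trans; apply; exact: ltW].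
    apply: (@preimage_closed _ _ (fun x : E => `|x|) [set t : R | t <= r]).
      by move=> x _; exact: norm_continuous.
    exact: closed_le.
  have /compact_bounded[M [_ MP]] : compact (f @` [set x : E | `|x| <= r]).
    by apply: continuous_compact => //; exact: continuous_subspaceT.
  exists (M + 1) => x xr; apply: (MP (M + 1)); first by rewrite ltrDl.
  by exists x.
exists r, `|B| => x; split; last exact: f0.
have [xr|xr] := leP `|x| r; first exact: le_trans (fB _ xr) (ler_norm _).
by rewrite f0 ?normr0// ltW.
Qed.

End bounded_support.

(** * Fubini's theorem and integrals of partial derivatives *)

Section fubini_rV.
Variable R : realType.

Lemma bounded_supp_slice1 n (f : 'rV[R]_n.+1 -> R) t : bounded_supp f ->
  bounded_supp (fun z : 'rV[R]_n => f (cons_rV (z, t))).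
Proof.
move=> [mf [r [B fB]]]; split.
  apply: measurableT_comp => //; apply: measurableT_comp => //.
  exact: measurable_cons_rV.
exists r, B => z; have [h1 h2] := fB (cons_rV (z, t)); split => // rz; apply: h2.
apply: le_trans rz _; apply: norm_le_coord => // i.
by rewrite -[z]/((z, t).1) -cons_rVS coord_le_norm.
Qed.

Lemma integrable_real_bounded (g : R -> R) (r B : R) : measurable_fun setT g ->
  (forall t, `|g t| <= B) -> (forall t, r <= `|t| -> g t = 0) ->
  (@lebesgue_measure R).-integrable setT (EFin \o g).
Proof.
move=> mg gB g0.
have E0 : EFin \o g = (EFin \o g) \_ `]- r, r[%classic.
  apply/funext => x; rewrite patchE; case: ifPn => // /negP xr /=.
  have [xr'|xr'] := ltP `|x| r; last by rewrite g0.
  by case: xr; apply/mem_set; rewrite /= in_itv/= -ltr_norml.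
have mI : measurable (`]- r, r[%classic : set (measurableTypeR R)) by exact: measurable_itv.
rewrite E0; apply: (integrable_mkcond (mu := @lebesgue_measure R) (EFin \o g) mI).1.
apply: measurable_bounded_integrable => //.
- rewrite [X in (X < _)%E](@lebesgue_measure_itv R `](- r), r[)/=.
  case: ifP => _; last by rewrite ltry.
  by rewrite -EFinB ltry.
- exact: measurable_funTS.
exists B; split; first exact: num_real.
by move=> M BM x Ax; exact: le_trans (gB _) (ltW BM).
Qed.

(** Both iterated orders are recorded for [integ_slice0]: with the first coordinate outermost,
    induction on the dimension applies to the slices; with it innermost, information on lines in the
    first direction applies. *)
Lemma integ_cons n (f : 'rV[R]_n.+1 -> R) : bounded_supp f ->
  integ f = \int[lebesgue_measure]_t integ (fun z => f (cons_rV (z, t))) /\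
  integ f = integ (fun z => \int[lebesgue_measure]_t f (cons_rV (z, t))).
Proof.
move=> bf; have [mf [r [B fB]]] := bf.
have If := bounded_supp_integrable bf.
have mc := @measurable_cons_rV R n.
have mfc : measurable_fun setT (fun z : 'rV[R]_n * R => f (cons_rV z)).
  exact: measurableT_comp.
have Ipi : ((@lebesgue_rV R n) \x (@lebesgue_measure R))%E.-integrable setT
    (fun z => (f (cons_rV z))%:E).
  apply/integrableP; split; first exact/measurable_EFinP.
  have /integrableP[_] := If; apply: le_lt_trans.
  rewrite le_eqVlt; apply/orP; left; apply/eqP; apply/esym.
  have ma : measurable_fun setT (fun x : 'rV[R]_n.+1 => `|(f x)%:E|)%E.
    by apply: measurableT_comp => //; exact/measurable_EFinP.
  transitivity (\int[pushforward ((@lebesgue_rV R n) \x (@lebesgue_measure R))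
    (@cons_rV R n)]_x `|(f x)%:E|)%E; first by [].
  by apply: ge0_integral_pushforward => // x _; exact: abse_ge0.
have Ip : (\int[@lebesgue_rV R n.+1]_x (f x)%:E =
    \int[(@lebesgue_rV R n) \x (@lebesgue_measure R)]_z (f (cons_rV z))%:E)%E.
  have mfE : measurable_fun setT (EFin \o f) by exact/measurable_EFinP.
  transitivity (\int[pushforward ((@lebesgue_rV R n) \x (@lebesgue_measure R))
    (@cons_rV R n)]_x (f x)%:E)%E; first by [].
  by apply: integral_pushforward.
split; rewrite /integ /Rintegral Ip.
  rewrite -(integral21_prod_meas1 Ipi); congr fine; apply: eq_integral => t _.
  rewrite /fubini_G fineK//; apply: integrable_fin_num => //.
  exact: (bounded_supp_integrable (bounded_supp_slice1 t bf)).
rewrite -(integral12_prod_meas1 Ipi); congr fine; apply: eq_integral => z _.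
rewrite /fubini_F fineK//; apply: integrable_fin_num => //.
apply: (@integrable_real_bounded (fun t => f (cons_rV (z, t))) r B).
- by apply: (measurableT_comp mfc); exact: pair1_measurable.
- by move=> t; have [] := fB (cons_rV (z, t)).
move=> t rt; apply: (fB (cons_rV (z, t))).2; apply: le_trans rt _.
by have := coord_le_norm (cons_rV (z, t)) ord0; rewrite cons_rV0.
Qed.

Definition upd n (x : 'rV[R]_n) (i : 'I_n) (t : R) : 'rV[R]_n :=
  \row_j (if j == i then t else x ord0 j).

Lemma updE n (x : 'rV[R]_n) i t j :
  upd x i t ord0 j = if j == i then t else x ord0 j.
Proof. by rewrite mxE. Qed.

Lemma upd_norm n (x : 'rV[R]_n) i t : `|t| <= `|upd x i t|.
Proof. by have := coord_le_norm (upd x i t) i; rewrite mxE eqxx. Qed.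

Lemma upd_line n (x : 'rV[R]_n) i t : upd x i t = t *: delta_mx ord0 i + upd x i 0.
Proof.
apply/rowP => j; rewrite !mxE eqxx/=; case: eqVneq => _.
  by rewrite mulr1 addr0.
by rewrite mulr0 add0r.
Qed.

Lemma integ_slice0 n (f : 'rV[R]_n -> R) i : bounded_supp f ->
  (forall x, \int[lebesgue_measure]_t f (upd x i t) = 0) -> integ f = 0.
Proof.
elim: n f i => [|n IH] f i bf f0; first by case: i f0.
have [j ij|i0] := unliftP ord0 i.
  rewrite (integ_cons bf).1.
  transitivity (\int[@lebesgue_measure R]_(t in setT) (0 : R)); last first.
    by rewrite Rintegral_cst ?mul0r.
  apply: eq_Rintegral => t _; apply: (IH _ j); first exact: bounded_supp_slice1.
  move=> x; rewrite -[RHS](f0 (cons_rV (x, t))); apply: eq_Rintegral => s _.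
  congr f; apply/rowP => k; rewrite updE ij; have [l ->|->] := unliftP ord0 k.
    by rewrite !cons_rVS updE (inj_eq lift_inj).
  by rewrite !cons_rV0.
rewrite (integ_cons bf).2 -[RHS](integ0 R n); congr integ; apply/funext => z.
rewrite -[RHS](f0 (cons_rV (z, 0))); apply: eq_Rintegral => t _.
congr f; apply/rowP => k; rewrite updE i0; have [l ->|->] := unliftP ord0 k.
  by rewrite !cons_rVS.
by rewrite !cons_rV0 eqxx.
Qed.

Lemma continuous_upd n (x : 'rV[R]_n) i : continuous (upd x i).
Proof.
move=> t; apply/cvgrPdist_lt => e e0; near=> s.
apply: norm_lt_coord => // j; rewrite !mxE; case: eqP => _; last by rewrite subrr normr0.
by near: s; exact: (cvgrPdist_lt _ _).1 (@cvg_id _ (nbhs t)) _ e0.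
Unshelve. all: by end_near. Qed.

Lemma partial_eq0 n (F : 'rV[R]_n -> R) (r : R) i x : (forall x, r <= `|x| -> F x = 0) ->
  r < `|x| -> partial i F x = 0.
Proof.
move=> F0 rx.
have oV : open [set y : 'rV[R]_n | r < `|y|].
  have -> : [set y : 'rV[R]_n | r < `|y|] = (fun y => `|y|) @^-1` [set t | r < t] by [].
  apply: open_comp; last exact: open_gt.
  by move=> y _; exact: norm_continuous.
rewrite (@partial_congr _ _ _ F (fun=> 0) x i oV)//.
  by rewrite /partial derive_cst.
by move=> y /= ry; rewrite F0// ltW.
Qed.

(** On each line parallel to the axis [i] the fundamental theorem of calculus leaves two boundary
    values, both outside the support. *)
Lemma integ_partial n (F : 'rV[R]_n -> R) (r : R) i : smooth_on setT F ->
  (forall x, r <= `|x| -> F x = 0) ->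
  bounded_supp (partial i F) /\ integ (partial i F) = 0.
Proof.
(* [s] exceeds [r] strictly because the partial derivative is known to vanish only where [r < |x|];
   it is positive so that the interval from [- s] to [s] is nondegenerate. *)
move=> sF F0; pose s := Num.max r 0 + 1.
have rs : r < s by rewrite /s ltr_pwDr// le_max lexx.
have s0 : 0 < s by rewrite /s ltr_pwDr// le_max lexx orbT.
have P0 x : s <= `|x| -> partial i F x = 0.
  by move=> sx; apply: (partial_eq0 _ F0); exact: lt_le_trans sx.
have cP : continuous (partial i F).
  by move=> x; apply: (smooth_on_continuous (smooth_on_partial i sF)).
have bP : bounded_supp (partial i F) by exact: continuous_bounded_supp P0.
split => //; apply: (integ_slice0 (i := i)) => // x.
have dF (t : R) : is_derive t 1 (fun t : R => F (upd x i t)) (partial i F (upd x i t)).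
  have -> : (fun t : R => F (upd x i t)) = (fun t : R => F (t *: delta_mx ord0 i + upd x i 0)).
    by apply/funext => u; rewrite -upd_line.
  have dd : derivable F (t *: delta_mx ord0 i + upd x i 0) (delta_mx ord0 i).
    by have [_] := sF [::] (t *: delta_mx ord0 i + upd x i 0) I; exact.
  have := @is_derive_line R _ F (upd x i 0) (delta_mx ord0 i) t dd.
  by rewrite -upd_line.
have -> : \int[lebesgue_measure]_t partial i F (upd x i t) =
    \int[lebesgue_measure]_(t in `[- s, s]) partial i F (upd x i t).
  rewrite [RHS]Rintegral_mkcond; apply: eq_Rintegral => t _.
  rewrite patchE; case: ifPn => // /negP ts; apply: P0.
  rewrite leNgt; apply/negP => sx; apply: ts; apply/mem_set.
  rewrite /= in_itv/= -ler_norml; apply: ltW; apply: le_lt_trans sx; exact: upd_norm.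
have cg : continuous (fun t : R => F (upd x i t)).
  move=> t; apply: differentiable_continuous; apply/derivable1_diffP.
  by have [] := dF t.
have Fs u : `|u| = s -> F (upd x i u) = 0.
  by move=> us; apply: F0; apply: le_trans (ltW rs) _; rewrite -us; exact: upd_norm.
rewrite /Rintegral (@continuous_FTC2 _ _ (fun t : R => F (upd x i t))).
- by rewrite !Fs ?normrN ?gtr0_norm// -EFinB subrr.
- by rewrite gtrN.
- apply: continuous_subspaceT => t; apply: continuous_comp; first exact: continuous_upd.
  exact: cP.
- split.
  + by move=> t _; have [] := dF t.
  + by apply: cvg_at_right_filter; exact: cg.
  + by apply: cvg_at_left_filter; exact: cg.
by move=> t _; rewrite derive1E; have [_] := dF t.
Qed.

End fubini_rV.

(** * Null sets and their smooth images *)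

Section regularity.
Variables (R : realType) (n : nat).
Local Notation E := 'rV[R]_n.
Local Notation mu := (@lebesgue_rV R n).

Lemma measurable_rV_ind (P : set (set E)) : sigma_algebra setT P ->
  (forall i a b, P (@rV_coord _ R n i @^-1` `]a, b[%classic)) ->
  forall A : set E, measurable A -> P A.
Proof.
move=> [P0 PC PU] Pi A; apply: smallest_sub; first by split.
move=> B; rewrite -bigcup_seq/= => -[i _ [C mC <-]]; rewrite setTI.
have : (@RGenOpens.G R).-sigma.-measurable C by rewrite -RGenOpens.measurableE.
pose Q : set (set R) := [set C | P (@rV_coord _ R n i @^-1` C)].
suff : <<s @RGenOpens.G R >> `<=` Q by exact.
apply: smallest_sub; last by move=> _ [a [b ->]]; exact: Pi.
split; first by rewrite /Q/= preimage_set0.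
  by move=> D; exact: PC.
by move=> F FQ; rewrite /Q/= preimage_bigcup; exact: PU.
Qed.

Section regular.
Variable r : R.
Let C : set E := cube r.

(** Inner closed and outer open approximation are carried together, since complementation exchanges
    them. The cube keeps measures finite, as continuity from above requires. *)
Definition regular_in_cube (A : set E) := measurable A /\ forall e : R, 0 < e ->
  exists F G : set E, [/\ closed F, open G, F `<=` A, A `<=` G &
    (mu ((G `\` F) `&` C) <= e%:E)%E].

Lemma regular_in_cube_sigma : sigma_algebra setT regular_in_cube.
Proof.
have mC : measurable C by exact: measurable_cube.
split.
- split=> // e e0; exists set0, set0; rewrite setD0 set0I measure0 lee_fin ltW//.
  by split => //; exact: closed0.
- move=> A [mA rA]; rewrite setTD; split; first exact: measurableC.
  move=> e /rA[F [G [cF oG FA AG FG]]]; exists (~` G), (~` F); split.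
  + exact: open_closedC.
  + exact: closed_openC.
  + exact: subsetC.
  + exact: subsetC.
  + by have -> : ~` F `\` ~` G = G `\` F by rewrite !setDE setCK setIC.
move=> A rA; have mA k : measurable (A k) by have [] := rA k.
split; first exact: bigcupT_measurable.
(* One half of [e] is distributed geometrically over the approximations of the [A k]; the other half
   pays for replacing the infinite union of closed sets, which need not be closed, by a finite
   one. *)
move=> e e0; have e2 k : 0 < e / 2 / (2 ^ k.+1)%:R.
  by rewrite !divr_gt0// ltr0n expn_gt0.
have /choice[FG FGP] : forall k, exists FG : set E * set E,
    [/\ closed FG.1, open FG.2, FG.1 `<=` A k, A k `<=` FG.2 &
     (mu ((FG.2 `\` FG.1) `&` C) <= (e / 2 / (2 ^ k.+1)%:R)%:E)%E].
  move=> k; have [_ /(_ _ (e2 k))[F [G [h1 h2 h3 h4 h5]]]] := rA k.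
  by exists (F, G).
have cF k : closed (FG k).1 by have [] := FGP k.
have oG k : open (FG k).2 by have [] := FGP k.
have mF k : measurable (FG k).1 by exact: closed_measurable_rV.
have mG k : measurable (FG k).2 by exact: open_measurable_rV.
pose G := \bigcup_k (FG k).2.
pose H m := (G `\` \big[setU/set0]_(k < m) (FG k).1) `&` C.
have mGG : measurable G by exact: bigcupT_measurable.
have mH m : measurable (H m).
  apply: measurableI => //; apply: measurableD => //.
  exact: bigsetU_measurable.
have niH : nonincreasing_seq H.
  move=> a b ab; apply/subsetPset; apply: setSI; apply: setDS.
  rewrite -(bigcup_mkord a (fun k => (FG k).1)) -(bigcup_mkord b (fun k => (FG k).1)).
  move=> x [k /= ka Fx]; exists k => //=.
  exact: leq_trans ka ab.
have H0 : (mu (H 0%N) < +oo)%E.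
  apply: le_lt_trans (cube_lty n r); apply: le_measure; rewrite ?inE//.
  exact: subIsetr.
have mcap : measurable (\bigcap_m H m) by exact: bigcapT_measurable.
have muH : (mu (\bigcap_m H m) <= (e / 2)%:E)%E.
  apply: (@le_trans _ _ (\sum_(k <oo) mu (((FG k).2 `\` (FG k).1) `&` C))%E).
    apply: measure_sigma_subadditive => //.
      by move=> k; apply: measurableI => //; exact: measurableD.
    move=> x Hx; have [[[k _ Gx] _] Cx] := Hx 0%N I; exists k => //; split => //; split => //.
    move=> Fx; have [[_ + _]] := Hx k.+1 I; apply.
    by rewrite -(bigcup_mkord k.+1 (fun k => (FG k).1)); exists k => //=.
  apply: le_trans (epsilon_trick0 xpredT _); last by rewrite divr_ge0// ltW.
  by apply: lee_nneseries => // k _; have [] := FGP k.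
have cvH := nonincreasing_cvg_mu H0 mH mcap niH.
have [m mHm] : exists m, (mu (H m) < e%:E)%E.
  have He : (mu (\bigcap_m H m) < e%:E)%E.
    by apply: le_lt_trans muH _; rewrite lte_fin; lra.
  have [m _ Hm] := cvH _ (open_ereal_lt' He).
  by exists m; exact: (Hm m (leqnn m)).
exists (\big[setU/set0]_(k < m) (FG k).1), G; split.
- by apply: closed_bigsetU => k _.
- by apply: bigcup_open.
- rewrite -(bigcup_mkord m (fun k => (FG k).1)); apply: bigcup_sub => k _ x Fx; exists k => //.
  by have [_ _ + _ _] := FGP k; exact.
- move=> x [k _ Ax]; exists k => //.
  by have [_ _ _ + _] := FGP k; exact.
exact: ltW.
Qed.

Lemma regular_in_cubeP (A : set E) : measurable A -> regular_in_cube A.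
Proof.
apply: measurable_rV_ind; first exact: regular_in_cube_sigma.
move=> i a b.
have mC : measurable C by exact: measurable_cube.
pose U (a b : R) : set E := @rV_coord _ R n i @^-1` `]a, b[%classic.
have cc : continuous (@rV_coord _ R n i) by move=> x; exact: coord_cvg.
have oU a' b' : open (U a' b').
  by apply: open_comp; [move=> x _; exact: cc|exact: interval_open].
have mU a' b' : measurable (U a' b') by exact: open_measurable_rV.
split; first exact: mU.
move=> e e0.
pose F (m : nat) : set E :=
  @rV_coord _ R n i @^-1` `[a + m.+1%:R^-1, b - m.+1%:R^-1]%classic.
have cF m : closed (F m).
  by apply: preimage_closed; [move=> x _; exact: cc|exact: interval_closed].
have mF m : measurable (F m) by exact: closed_measurable_rV.
have m0 m : 0 < m.+1%:R^-1 :> R by rewrite invr_gt0.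
pose H m := (U a b `\` F m) `&` C.
have mH m : measurable (H m) by apply: measurableI => //; exact: measurableD.
have niH : nonincreasing_seq H.
  move=> k l kl; apply/subsetPset; apply: setSI; apply: setDS.
  move=> x; rewrite /F/= !in_itv/= => /andP[h1 h2].
  have kl' : l.+1%:R^-1 <= k.+1%:R^-1 :> R.
    by rewrite lef_pV2 ?posrE ?ltr0n// ler_nat.
  by move: h1 h2 kl'; move: (l.+1%:R^-1) (k.+1%:R^-1) => u v *; apply/andP; split; lra.
have H0 : (mu (H 0%N) < +oo)%E.
  apply: le_lt_trans (cube_lty n r); apply: le_measure; rewrite ?inE//.
  exact: subIsetr.
have capH : \bigcap_m H m = set0.
  apply/seteqP; split => // x Hx.
  have [[+ _] _] := Hx 0%N I; rewrite /U/= in_itv/= => /andP[h1 h2].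
  pose d := Num.min (rV_coord i x - a) (b - rV_coord i x).
  have d0 : 0 < d by rewrite lt_min !subr_gt0 h1.
  pose m := Num.truncn d^-1.
  have md : m.+1%:R^-1 < d.
    by rewrite -[ltRHS]invrK ltf_pV2 ?posrE ?ltr0n ?invr_gt0//; exact: truncnS_gt.
  have [[_ + _]] := Hx m I; apply; rewrite /F/= in_itv/=.
  move: md; rewrite lt_min => /andP[]; move: (m.+1%:R^-1) => u *.
  by apply/andP; split; lra.
have cvH : mu \o H @ \oo --> mu (\bigcap_m H m).
  by apply: nonincreasing_cvg_mu => //; rewrite capH.
have [m mHm] : exists m, (mu (H m) < e%:E)%E.
  have He : (mu (\bigcap_m H m) < e%:E)%E by rewrite capH measure0 lte_fin.
  have [m _ Hm] := cvH _ (open_ereal_lt' He).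
  by exists m; exact: (Hm m (leqnn m)).
exists (F m), (U a b); split => //; last exact: ltW.
move=> x; rewrite /F/U/= !in_itv/= => /andP[h1 h2].
by move: (m0 m) h1 h2; move: (m.+1%:R^-1) => u *; apply/andP; split; lra.
Qed.

Lemma null_set_open_cover (N : set E) (e : R) : measurable N -> mu N = 0 -> 0 < e ->
  exists G : set E, [/\ open G, N `<=` G & (mu (G `&` C) <= e%:E)%E].
Proof.
move=> mN N0 e0; have [_ /(_ _ e0)[F [G [cF oG FN NG GF]]]] := regular_in_cubeP mN.
have mF : measurable F by exact: closed_measurable_rV.
have mG : measurable G by exact: open_measurable_rV.
have mC : measurable C by exact: measurable_cube.
exists G; split => //; apply: le_trans GF.
have F0 : mu F = 0%E.
  by apply/eqP; rewrite -measure_le0 -N0; apply: le_measure; rewrite ?inE.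
have -> : G `&` C = ((G `\` F) `&` C) `|` (F `&` C).
  rewrite -setIUl setDE; congr (_ `&` _).
  apply/seteqP; split => x; last by case=> [[]//|Fx]; exact/NG/FN.
  by have [Fx|nFx] := pselect (F x); [right|left].
apply: (@le_trans _ _ (mu ((G `\` F) `&` C) + mu (F `&` C))%E).
  apply: measureU2; apply: measurableI => //; exact: measurableD.
rewrite -[leRHS]adde0 leeD2l// -[X in (_ <= X)%E]F0.
by apply: le_measure; rewrite ?inE//; exact: measurableI.
Qed.

End regular.
End regularity.

Section finite_unions.
Context d (T : measurableType d) (R : realType) (m : {measure set T -> \bar R}).
Variables (I : choiceType) (F : I -> set T).
Hypothesis mF : forall i, measurable (F i).

Lemma measure_bigsetU_le (s : seq I) (P : pred I) :
  (m (\big[setU/set0]_(i <- s | P i) F i) <= \sum_(i <- s | P i) m (F i))%E.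
Proof.
elim: s => [|i s IH]; first by rewrite !big_nil measure0.
rewrite !big_cons; case: ifP => // _.
apply: le_trans (leeD2l _ IH); apply: measureU2 => //.
exact: bigsetU_measurable.
Qed.

Lemma measure_bigsetU_uniq (s : seq I) (P : pred I) : uniq s ->
  (forall i j, i != j -> F i `&` F j = set0) ->
  m (\big[setU/set0]_(i <- s | P i) F i) = (\sum_(i <- s | P i) m (F i))%E.
Proof.
move=> + dF; elim: s => [_|i s IH /= /andP[is_ us]]; first by rewrite !big_nil measure0.
rewrite !big_cons; case: ifP => [_|_]; last exact: IH.
rewrite -IH// measureU//; first exact: bigsetU_measurable.
rewrite big_mkcond -bigcup_seq; apply/seteqP; split => // x [Fi [j /= js]].
case: ifP => // _ Fj.
have ij : i != j by apply: contraNneq is_ => ->.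
by have /seteqP[/(_ x) + _] := dF _ _ ij; apply.
Qed.

End finite_unions.

(** * Lipschitz images of null sets *)

Section lipschitz_null.
Variables (R : realType) (n : nat).
Local Notation E := 'rV[R]_n.
Local Notation mu := (@lebesgue_rV R n).

Lemma lebesgue_ball (x : E) (r : R) : 0 < r -> mu (ball x r) = ((2 * r) ^+ n)%:E.
Proof.
move=> r0; have -> : ball x r = prod_set (fun i => `]x ord0 i - r, x ord0 i + r[%classic).
  apply/seteqP; split => y.
    move=> /(ballP_coord _ _ r0) xy i /=; have := xy i.
    by rewrite in_itv/= ltr_norml => /andP[? ?]; apply/andP; split; lra.
  move=> xy; apply/ballP_coord => // i; have := xy i.
  by rewrite /= in_itv/= ltr_norml => /andP[? ?]; apply/andP; split; lra.
rewrite (lebesgue_prod_set (b := fun=> 2 * r)) ?prodr_const ?card_ord//.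
move=> i; rewrite lebesgue_measure_itv/= lte_fin ifT; last by lra.
by rewrite -EFinB; congr EFin; ring.
Qed.

Variables (x0 : E) (rho L : R) (T : E -> E).
Hypotheses (rho0 : 0 < rho) (L0 : 0 < L).
Hypothesis LT : forall y z, ball x0 rho y -> ball x0 rho z -> `|T z - T y| <= L * `|z - y|.

Let h (K : nat) := 2 * rho / K.+1%:R.
Let h0 K : 0 < h K. Proof. by rewrite /h divr_gt0// mulr_gt0. Qed.
Let a i := x0 ord0 i - rho.
(** A grid of half-open cells of side [h K]: they are pairwise disjoint, so volumes add up, and they
    cover the open ball. *)
Let cell K (k : {ffun 'I_n -> 'I_K.+1}) : set E :=
  prod_set (fun i => `[a i + (k i)%:R * h K, a i + (k i).+1%:R * h K[%classic).

Let cell_measurable K (k : {ffun 'I_n -> 'I_K.+1}) : measurable (cell k).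
Proof. exact: measurable_prod_set. Qed.

Let cell_measure K (k : {ffun 'I_n -> 'I_K.+1}) : mu (cell k) = (h K ^+ n)%:E.
Proof.
rewrite /cell (lebesgue_prod_set (b := fun=> h K)) ?prodr_const ?card_ord//.
move=> i; rewrite lebesgue_measure_itv/= lte_fin -natr1 mulrDl mul1r.
rewrite ifT; last by have := h0 K; lra.
by rewrite -EFinB; congr EFin; ring.
Qed.

Let cell_disjoint K (k l : {ffun 'I_n -> 'I_K.+1}) : k != l -> cell k `&` cell l = set0.
Proof.
move=> kl; apply/seteqP; split => // x [xk xl]; case/eqP: kl; apply/ffunP => i.
have h1 (p q : nat) : a i + p%:R * h K <= x ord0 i -> x ord0 i < a i + q.+1%:R * h K ->
    (p <= q)%N.
  move=> px xq; have : a i + p%:R * h K < a i + q.+1%:R * h K by exact: le_lt_trans xq.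
  by rewrite ltrD2l ltr_pM2r// ltr_nat ltnS.
have := xk i; have := xl i; rewrite /= !in_itv/= => /andP[l1 l2] /andP[k1 k2].
by apply/val_inj/eqP; rewrite eqn_leq (h1 _ _ k1 l2) (h1 _ _ l1 k2).
Qed.

Let cell_dist K (k : {ffun 'I_n -> 'I_K.+1}) x y : cell k x -> cell k y ->
  `|x - y| <= h K.
Proof.
move=> xk yk; apply: norm_le_coord; first exact: ltW.
move=> i; have := xk i; have := yk i; rewrite /= !in_itv/= !mxE -natr1 mulrDl mul1r.
by rewrite ler_norml => /andP[? ?] /andP[? ?]; apply/andP; split; lra.
Qed.

Let cell_cover K x : ball x0 rho x -> exists k : {ffun 'I_n -> 'I_K.+1}, cell k x.
Proof.
move=> /(ballP_coord _ _ rho0) xb.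
have H i : (Num.truncn ((x ord0 i - a i) / h K) < K.+1)%N.
  have := xb i; rewrite ltr_norml => /andP[h1 h2].
  have q0 : 0 <= (x ord0 i - a i) / h K by rewrite divr_ge0// /a; [lra|exact: ltW].
  have /andP[t1 _] := truncn_itv q0.
  rewrite -(ltr_nat R); apply: le_lt_trans t1 _.
  by rewrite ltr_pdivrMr// /h [ltRHS]mulrC divfK ?pnatr_eq0// /a; lra.
exists [ffun i => Ordinal (H i)] => i /=; rewrite in_itv/= ffunE/=.
have q0 : 0 <= (x ord0 i - a i) / h K.
  have := xb i; rewrite ltr_norml => /andP[h1 h2].
  by rewrite divr_ge0// /a; [lra|exact: ltW].
have /andP[t1 t2] := truncn_itv q0.
rewrite ler_pdivlMr// in t1; rewrite ltr_pdivrMr// in t2.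
by apply/andP; split; lra.
Qed.

Let cell_cube K (k : {ffun 'I_n -> 'I_K.+1}) : cell k `<=` cube (`|x0| + rho + 1).
Proof.
move=> x xk i /=; have := xk i; rewrite /= !in_itv/= => /andP[h1 h2].
have k0 : 0 <= (k i)%:R * h K by rewrite mulr_ge0// ltW.
have kK : (k i).+1%:R * h K <= 2 * rho.
  have -> : 2 * rho = K.+1%:R * h K by rewrite /h [RHS]mulrC divfK ?pnatr_eq0.
  by rewrite ler_pM2r// ler_nat ltn_ord.
have := coord_le_norm x0 i; rewrite ler_norml => /andP[? ?].
by move: h1 h2; rewrite /a => *; apply/andP; split; lra.
Qed.

(** A ball that contains the image of the part of the cell inside the ball about [x0], centred at
    the image of some point of that part. The radius is twice the Lipschitz bound to make the
    inequality strict. If the part is empty the centre is arbitrary, which does not affect the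
    volume. *)
Let D K (k : {ffun 'I_n -> 'I_K.+1}) : set E :=
  ball (T (get (cell k `&` ball x0 rho))) (2 * L * h K).

Let B (G : set E) K : set E :=
  \big[setU/set0]_(k : {ffun 'I_n -> 'I_K.+1} | `[< cell k `<=` G >]) D k.

Let B_measurable G K : measurable (B G K).
Proof. by apply: bigsetU_measurable => k _; exact: measurable_coord_ball. Qed.

(** A ball of radius [2 * L * h] has volume [(4 * L) ^+ n] times that of a cell of side [h], and the
    disjoint cells inside [G] have total volume at most that of [G] in the cube. *)
Let B_measure G K e : open G -> (mu (G `&` cube (`|x0| + rho + 1)) <= e%:E)%E ->
  (mu (B G K) <= ((4 * L) ^+ n * e)%:E)%E.
Proof.
move=> oG Ge; have mD k : measurable (@D K k) by exact: measurable_coord_ball.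
rewrite /B; apply: (le_trans (measure_bigsetU_le mu mD _ _)).
have H0 : 0 < 2 * L * h K by rewrite !mulr_gt0.
rewrite (eq_bigr (fun=> ((4 * L) ^+ n * h K ^+ n)%:E)); last first.
  move=> k _; transitivity ((2 * (2 * L * h K)) ^+ n)%:E; first exact: lebesgue_ball.
  congr EFin.
  by rewrite -exprMn; congr (_ ^+ n); ring.
rewrite sumEFin -mulr_sumr EFinM [leRHS]EFinM.
apply: lee_wpmul2l; first by rewrite lee_fin exprn_ge0// mulr_ge0// ltW.
apply: le_trans Ge; rewrite -sumEFin.
rewrite (eq_bigr (fun k : {ffun 'I_n -> 'I_K.+1} => mu (cell k))); last first.
  by move=> k _; rewrite cell_measure.
rewrite -(measure_bigsetU_uniq mu (@cell_measurable K) _ (index_enum_uniq _) (@cell_disjoint K)).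
apply: le_measure; rewrite ?inE.
- exact: bigsetU_measurable.
- by apply: measurableI; [exact: open_measurable_rV|exact: measurable_cube].
rewrite big_mkcond -bigcup_seq => x [k _] /=; case: asboolP => // kG xk.
split; first exact: kG.
exact: cell_cube xk.
Qed.

Let B_eventually G (N : set E) x : open G -> N `<=` G -> N `<=` ball x0 rho -> N x ->
  exists M, forall K, (M <= K)%N -> B G K (T x).
Proof.
move=> oG NG Nb Nx.
have /nbhs_ballP[e /= e0 eG] : nbhs x G by apply: open_nbhs_nbhs; split => //; exact: NG.
exists (Num.truncn (2 * rho / e)) => K MK.
have he : h K < e.
  rewrite /h ltr_pdivrMr ?ltr0n// [ltRHS]mulrC -ltr_pdivrMr//.
  by apply: lt_le_trans (truncnS_gt _) _; rewrite ler_nat ltnS.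
have [k xk] := cell_cover K (Nb _ Nx).
rewrite /B big_mkcond -bigcup_seq; exists k; first by rewrite /= mem_index_enum.
rewrite asboolT; last first.
  move=> y yk; apply: eG.
  by rewrite -ball_normE /=; apply: le_lt_trans he; exact: cell_dist xk yk.
have ne : cell k `&` ball x0 rho !=set0 by exists x; split => //; exact: Nb.
have [yk yb] := getPex ne.
rewrite /D; move: yk yb; set y := get _ => yk yb; rewrite -ball_normE /= distrC.
apply: le_lt_trans (LT yb (Nb _ Nx)) _; rewrite -mulrA mulrCA ltr_pM2l//.
have := cell_dist xk yk; have := h0 K; lra.
Qed.

(** Let [G] be an open set of small measure around [N]. For fine grids each point of [N] lies in a
    cell contained in [G], so its image is in [B G K] for all large [K]. How large depends on the
    point; the image is thus covered by the increasing union of the sets [F M], each no larger in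
    measure than [B G M]. *)
Lemma lipschitz_null_image (N : set E) : measurable N -> mu N = 0 -> N `<=` ball x0 rho ->
  mu.-negligible (T @` N).
Proof.
move=> mN N0 Nb.
have H (j : nat) : exists Z : set E, [/\ measurable Z, T @` N `<=` Z &
    (mu Z <= ((4 * L) ^+ n * j.+1%:R^-1)%:E)%E].
  have j0 : 0 < j.+1%:R^-1 :> R by rewrite invr_gt0.
  have [G [oG NG Ge]] := null_set_open_cover (`|x0| + rho + 1) mN N0 j0.
  pose F M := \bigcap_K (B G (M + K)%N).
  have mF M : measurable (F M) by apply: bigcapT_measurable => K; exact: B_measurable.
  exists (\bigcup_M F M); split; first exact: bigcupT_measurable.
    move=> _ [x Nx <-]; have [M HM] := B_eventually oG NG Nb Nx.
    by exists M => // K _; apply: HM; exact: leq_addr.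
  have ndF : nondecreasing_seq F.
    move=> k l kl; apply/subsetPset => x Fx K _.
    by have := Fx (l - k + K)%N I; rewrite addnA subnKC.
  have cvF := nondecreasing_cvg_mu (mu := mu) mF (bigcupT_measurable _ mF) ndF.
  apply: cvge_to_le cvF _; apply: nearW => M /=.
  apply: le_trans (B_measure M oG Ge); apply: le_measure; rewrite ?inE//.
  by move=> x /(_ 0%N I); rewrite addn0.
have /choice[Z ZP] := H.
exists (\bigcap_j Z j); split.
- by apply: bigcapT_measurable => j; have [] := ZP j.
- apply/eqP; rewrite -measure_le0; apply/lee_addgt0Pr => e e0; rewrite add0e.
  pose j := Num.truncn ((4 * L) ^+ n / e).
  have [mZ _ Zj] := ZP j; apply: le_trans (_ : (mu (Z j) <= _)%E).
    apply: le_measure; rewrite ?inE//; last by move=> x; exact.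
    by apply: bigcapT_measurable => k; have [] := ZP k.
  apply: le_trans Zj _; rewrite lee_fin ler_pdivrMr ?ltr0n//.
  by rewrite [leRHS]mulrC -ler_pdivrMr//; exact/ltW/truncnS_gt.
by move=> y Ny j _; have [_ + _] := ZP j; exact.
Qed.

End lipschitz_null.

Section smooth_null.
Variables (R : realType) (n : nat).
Local Notation E := 'rV[R]_n.
Local Notation mu := (@lebesgue_rV R n).

Lemma locally_lipschitz (D : set E) (T : E -> E) x : open D -> D x ->
  (forall j, smooth_on D (fun y => T y ord0 j)) ->
  exists r L : R, [/\ 0 < r, 0 < L, ball x r `<=` D & forall y z,
    ball x r y -> ball x r z -> `|T z - T y| <= L * `|z - y|].
Proof.
move=> oD Dx sT.
pose B := \sum_(i < n) \sum_(j < n) `|partial i (fun y => T y ord0 j) x| + 1.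
have Bp i j : `|partial i (fun y => T y ord0 j) x| < B.
  rewrite /B (bigD1 i)//= (bigD1 j)//= -!addrA ltrDl -[ltLHS]addr0.
  by rewrite ler_ltD ?sumr_ge0// ltr_wpDl// sumr_ge0// => k _; rewrite sumr_ge0.
have B0 : 0 < B.
  by rewrite /B ltr_wpDl// sumr_ge0// => i _; rewrite sumr_ge0.
have : \forall y \near x, D y /\ forall i j, `|partial i (fun y => T y ord0 j) y| <= B.
  near=> y; split; first by near: y; exact: near_open.
  near: y; apply: filter_forall => i; apply: filter_forall => j.
  have c : {for x, continuous (partial i (fun y => T y ord0 j))}.
    exact: (smooth_on_continuous (smooth_on_partial i (sT j)) Dx).
  have c1 : (fun y => `|partial i (fun z => T z ord0 j) y|) @ x -->
      `|partial i (fun y => T y ord0 j) x| .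
    apply: (@continuous_comp _ _ _ (partial i (fun z => T z ord0 j)) (fun t : R => `|t|)) => //.
    exact: norm_continuous.
  near=> y; apply: ltW; near: y.
  by apply: (c1 [set t | t < B]); apply: open_nbhs_nbhs; split; [exact: open_lt|exact: Bp].
move=> /nbhs_ballP[r /= r0 rP].
exists r, (n%:R * B + 1); split => //.
- by rewrite ltr_wpDl// mulr_ge0// ltW.
- by move=> y /rP[].
move=> y z yr zr; apply: norm_le_coord => [|j].
  by rewrite mulr_ge0// addr_ge0// mulr_ge0// ltW.
rewrite !mxE; apply: le_trans (_ : n%:R * B * `|z - y| <= _).
  apply: (@partial_lipschitz _ _ (fun y => T y ord0 j) x r B r0 (ltW B0)) => // w i /rP[Dw wB].
  by split; [have [_] := sT j [::] w Dw; exact|exact: wB].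
by rewrite ler_wpM2r// lerDl.
Unshelve. all: by end_near. Qed.

(** A smooth map is Lipschitz near each point, and countably many rational balls collect the local
    statements. *)
Lemma smooth_null_image (D : set E) (T : E -> E) (N : set E) : open D ->
  (forall j, smooth_on D (fun y => T y ord0 j)) -> N `<=` D ->
  mu.-negligible N -> mu.-negligible (T @` N).
Proof.
move=> oD sT ND [N' [mN' N'0 NN']].
have H x : D x -> exists r : R, 0 < r /\ mu.-negligible (T @` (N `&` ball x r)).
  move=> Dx; have [r [L [r0 L0 rD LT]]] := locally_lipschitz oD Dx sT.
  exists r; split => //.
  apply: negligibleS (lipschitz_null_image r0 L0 LT (N := N' `&` ball x r) _ _ _).
  - by move=> _ [y [Ny yr] <-]; exists y => //; split => //; exact: NN'.
  - by apply: measurableI => //; exact: measurable_coord_ball.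
  - apply/eqP; rewrite -measure_le0 -N'0; apply: le_measure; rewrite ?inE//.
    by apply: measurableI => //; exact: measurable_coord_ball.
  - exact: subIsetr.
pose F k := if `[< mu.-negligible (T @` (N `&` rat_ball k)) >]
  then T @` (N `&` rat_ball k) else set0.
have : mu.-negligible (\bigcup_k F k).
  by apply: negligible_bigcup => k; rewrite /F; case: asboolP => // _; exact: negligible_set0.
apply: negligibleS; move=> _ [x Nx <-]; have [r [r0 Hr]] := H x (ND _ Nx).
have [k [kx kb]] := rat_ball_basis (ball_open x r) (ballxx x r0).
exists k => //; rewrite /F asboolT; first by exists x.
by apply: negligibleS Hr; apply: image_subset; exact: setIS.
Qed.

End smooth_null.

(** * Integrals and measurability modulo null sets *)

Section ae_integral.
Context d (T : measurableType d) (R : realType) (m : {measure set T -> \bar R}).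

Import HBNNSimple.

Let nnintegral (f : T -> \bar R) := ereal_sup [set sintegral m h |
  h in [set h : {nnsfun T >-> R} | forall x, ((h x)%:E <= f x)%E]].

Let nnintegral_ae_le (f g : T -> \bar R) (N : set T) : measurable N -> m N = 0%E ->
  (forall x, 0 <= g x)%E -> (forall x, ~ N x -> f x = g x) ->
  (nnintegral f <= nnintegral g)%E.
Proof.
move=> mN N0 g0 fg; apply: ge_ereal_sup => _ [h hf <-].
rewrite -integralT_nnsfun.
rewrite (ge0_negligible_integral mN measurableT _ _ N0)//; last 2 first.
- exact/measurable_EFinP.
- by move=> x _; rewrite lee_fin.
rewrite ge0_integralE; last by move=> x _; rewrite lee_fin.
apply: ereal_sup_le => _ [k kh <-]; exists k => // x.
apply: le_trans (kh x) _; rewrite patchE; case: ifPn => [/set_mem[_ Nx]|_].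
  by rewrite -fg.
exact: g0.
Qed.

(** The integral is a difference of suprema over simple functions below the integrand, measurable or
    not, and a simple function may be set to 0 on a Borel null set without changing its integral.
    This is how the integrands of the weak equation and of [fourier], which are only Lebesgue
    measurable, are exchanged for Borel ones. *)
Lemma Rintegral_ae_eq (D N : set T) (f g : T -> R) : measurable N -> m N = 0%E ->
  (forall x, D x -> ~ N x -> f x = g x) ->
  \int[m]_(x in D) f x = \int[m]_(x in D) g x.
Proof.
move=> mN N0 fg; congr fine.
have fgD x : ~ N x -> ((EFin \o f) \_ D) x = ((EFin \o g) \_ D) x.
  by move=> Nx; rewrite !patchE; case: ifPn => // /set_mem Dx /=; rewrite fg.
rewrite /integral; congr (_ - _)%E; apply/eqP; rewrite eq_le; apply/andP; split;
  apply: (nnintegral_ae_le mN N0) => x //; move=> /fgD.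
all: by rewrite ?funeposE ?funenegE => ->.
Qed.

End ae_integral.

Section null_sets.
Variables (R : realType) (n : nat).
Local Notation E := 'rV[R]_n.
Local Notation mu := (@lebesgue_rV R n).

Lemma null_set_codense (N : set E) (x : E) (G : set E) : mu.-negligible N ->
  open G -> G x -> exists y, G y /\ ~ N y.
Proof.
move=> [N' [mN' N'0 NN']] oG Gx; apply: contrapT => H.
have /nbhs_ballP[e /= e0 eG] : nbhs x G by exact: open_nbhs_nbhs.
have : (mu (ball x e) <= mu N')%E.
  apply: le_measure; rewrite ?inE//; first exact: measurable_coord_ball.
  move=> y /eG Gy; apply: NN'; apply: contrapT => Ny; apply: H.
  by exists y.
rewrite lebesgue_ball// N'0 lee_fin leNgt exprn_gt0// mulr_gt0//.
Qed.

Lemma hyperplane_null (j : 'I_n) (c : R) : mu.-negligible [set x : E | x ord0 j = c].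
Proof.
pose B (k : nat) : set E :=
  prod_set (fun i => if i == j then [set c] else `]- k%:R, k%:R[%classic).
have : mu.-negligible (\bigcup_k B k).
  apply: negligible_bigcup => k; exists (B k); split => //.
    by apply: measurable_prod_set => i; case: ifP.
  transitivity (\prod_(i < n) (if i == j then 0 else 2 * k%:R : R))%:E; last first.
    by rewrite (bigD1 j)//= eqxx mul0r.
  apply: lebesgue_prod_set; first by move=> i; case: ifP.
  move=> i; case: ifP => _; first by rewrite lebesgue_measure_set1.
  rewrite lebesgue_measure_itv/= lte_fin; case: ltP => h.
    by rewrite -EFinB; congr EFin; ring.
  have k0 : 0 <= k%:R :> R by [].
  by congr EFin; lra.
apply: negligibleS => x /= xj; exists (Num.truncn `|x|).+1 => // i /=.
case: eqP => [->//|_] /=; rewrite in_itv/= -ltr_norml.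
by apply: le_lt_trans (coord_le_norm _ _) _; exact: truncnS_gt.
Qed.

(** Rational half-lines generate the Borel sets: the preimage of each of them is Borel up to a null
    set, and [N] is the countable union of the exceptional sets. *)
Lemma lebesgue_measurable_borel (D : set E) (f : E -> R) : measurable D ->
  lebesgue_measurable_fun D f ->
  exists N f0, [/\ measurable N, mu N = 0%E, measurable_fun setT f0 &
    forall x, f0 x = if x \in D `\` N then f x else 0].
Proof.
move=> mD mf.
have /choice[AN ANP] : forall q : rat, exists AN : set E * set E,
    [/\ measurable AN.1, measurable AN.2, mu AN.2 = 0%E &
     (D `&` f @^-1` `]-oo, (ratr q : R)[%classic) `\` AN.2 = AN.1].
  move=> q; have [A mA [N [N' [mN' N'0 NN']] AN]] := mf _ (measurable_itv `]-oo, (ratr q : R)[).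
  exists (A `\` N', N'); split => //=; first exact: measurableD.
  have NN0 : N `\` N' = set0 by apply/seteqP; split => // x [/NN'].
  by rewrite -AN setDUl NN0 setU0.
pose N := \bigcup_(q in [set: rat]) (AN q).2.
have mN : measurable N.
  by apply: countable_bigcupT_measurable => // q; have [] := ANP q.
have N0 : mu N = 0%E.
  have : mu.-negligible N.
    pose F k : set E := if unpickle k is Some q then (AN q).2 else set0.
    have : mu.-negligible (\bigcup_k F k).
      apply: negligible_bigcup => k; rewrite /F; case: unpickle => [q|].
        by have [_ m2 z2 _] := ANP q; exists (AN q).2; split.
      exact: negligible_set0.
    have FE q : F (pickle q) = (AN q).2 by rewrite /F pickleK.
    by move: F FE => F FE; apply: negligibleS => x [q _ Hq]; exists (pickle q); rewrite ?FE.
  by case=> N' [mN' N'0 NN']; apply/eqP; rewrite -measure_le0 -N'0; apply: le_measure; rewrite ?inE.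
have mDN : measurable (D `\` N) by exact: measurableD.
exists N, (f \_ (D `\` N)); split => //.
  apply/(measurable_restrictT _ mDN).
  apply: (measurability _ (RGenInftyO.measurableE R)).
  move=> _ [_ [c ->] <-].
  have -> : (D `\` N) `&` f @^-1` `]-oo, c[%classic =
      \bigcup_q (if ratr q < c then (AN q).1 `\` N else set0).
    apply/seteqP; split => x.
      move=> [[Dx Nx]]; rewrite /= in_itv/= => fc.
      have [q /[!in_itv]/= /andP[fq qc]] := rat_in_itvoo fc.
      exists q => //; rewrite qc; split => //.
      have [_ _ _ <-] := ANP q; split; last by move=> ANx; apply: Nx; exists q.
      by split => //=; rewrite in_itv.
    move=> [q _]; case: ifP => // qc [ANx Nx].
    have [_ _ _ E1] := ANP q; move: ANx; rewrite -E1 => -[[Dx +] _].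
    rewrite /= !in_itv/= => fq; split; first by split.
    exact: lt_trans fq qc.
  apply: countable_bigcupT_measurable => // q; case: ifP => // _.
  by apply: measurableD => //; have [] := ANP q.
Qed.

End null_sets.

(** * Bump functions and the fundamental lemma *)

Section bump.
Variable R : realType.
Implicit Type P : {poly R}.

Definition flat_fun P (t : R) : R := if 0 < t then P.[t^-1] * expR (- t^-1) else 0.

(** From [exp u >= u ^ (k + 2) / (k + 2)!] at [u = 1 / t], monomial by monomial. Quadratic decay is
    what makes the derivative at 0 vanish. *)
Lemma flat_fun_small P : exists C : R, forall t, 0 < t -> `|flat_fun P t| <= C * t ^+ 2.
Proof.
exists (\sum_(k < size P) `|P`_k| * (k.+2`!)%:R) => t t0.
rewrite /flat_fun t0 horner_coef mulr_suml mulr_suml.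
apply: le_trans (ler_norm_sum _ _ _) _; apply: ler_sum => k _.
rewrite -!mulrA normrM ler_wpM2l//.
have u0 : 0 < t^-1 by rewrite invr_gt0.
rewrite ger0_norm; last by rewrite mulr_ge0 ?expR_ge0 ?exprn_ge0// ltW.
have H : t^-1 ^+ k.+2 / (k.+2`!)%:R <= expR t^-1.
  by have := expR_ge1Dxn k.+1 (ltW u0); apply: le_trans; rewrite lerDr.
rewrite expRN ler_pdivrMr ?expR_gt0//.
have -> : t^-1 ^+ k = t^-1 ^+ k.+2 / (k.+2`!)%:R * ((k.+2`!)%:R * t ^+ 2).
  rewrite mulrA divfK ?pnatr_eq0 -?lt0n ?fact_gt0//.
  by rewrite -addn2 exprD -mulrA -exprMn mulVf ?gt_eqF// expr1n mulr1.
by rewrite mulrC ler_wpM2l// mulr_ge0// exprn_ge0// ltW.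
Qed.

Lemma is_derive_flat_fun P (t : R) :
  is_derive t 1 (flat_fun P) (flat_fun ('X ^+ 2 * (P - P^`())) t).
Proof.
have [t0|t0|t0] := ltgtP t 0.
- have -> : flat_fun ('X ^+ 2 * (P - P^`())) t = 0 by rewrite /flat_fun ltNge ltW.
  have dc : is_derive t 1 (cst 0 : R -> R) 0 by exact: is_derive_cst.
  apply: near_eq_is_derive dc.
  near=> s; rewrite /flat_fun ltNge ltW//=.
  by near: s; exact: lt_nbhsl.
- have dV : is_derive t 1 (fun t : R => t^-1) (- t ^- 2).
    have t1 : t != 0 by rewrite gt_eqF.
    have dt : derivable (id : R -> R) t 1 by [].
    split; first exact: (derivableV t1 dt).
    by have := deriveV t1 dt; rewrite derive_id [_ *: _]mulr1.
  have dh : is_derive (t^-1) 1 (fun s : R => P.[s]) (P^`().[t^-1]).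
    have dd : derivable (fun s : R => P.[s]) t^-1 1 by exact: derivable_horner.
    by split => //; rewrite -derive1E -derivE.
  have dP : is_derive t 1 (fun s : R => P.[s^-1]) (P^`().[t^-1] * - t ^- 2).
    exact: (@is_derive1_comp _ (fun s : R => P.[s]) (fun s : R => s^-1) t _ _ dh dV).
  have dE : is_derive t 1 (fun s : R => expR (- s^-1)) (expR (- t^-1) * t ^- 2).
    apply: (@is_derive1_comp _ expR (fun s : R => - s^-1)).
    by rewrite -[X in is_derive _ _ _ X]opprK; exact: is_deriveN.
  have dM := @is_deriveM _ _ _ _ _ _ _ _ dP dE.
  have -> : flat_fun ('X ^+ 2 * (P - P^`())) t =
      P.[t^-1] *: (expR (- t^-1) * t ^- 2) + expR (- t^-1) *: (P^`().[t^-1] * - t ^- 2).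
    rewrite /flat_fun t0 !hornerE -exprVn.
    change ((t^-1 ^+ 2 * (P.[t^-1] - P^`().[t^-1])) * expR (- t^-1) =
      P.[t^-1] * (expR (- t^-1) * t^-1 ^+ 2) + expR (- t^-1) * (P^`().[t^-1] * - t^-1 ^+ 2)).
    ring.
  apply: near_eq_is_derive dM.
  near=> s; rewrite /flat_fun ifT//.
  by near: s; exact: lt_nbhsr.
rewrite t0 /flat_fun ltxx -/(flat_fun P).
have [C HC] := flat_fun_small P.
suff L : (fun h : R => h^-1 *: (flat_fun P (h *: 1 + 0) - flat_fun P 0)) @ 0^' --> (0 : R).
  by split; [apply/cvg_ex; exists 0|apply/cvg_lim].
have C0 : 0 <= C by have := le_trans (normr_ge0 _) (HC 1 ltr01); rewrite expr1n mulr1.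
apply/cvgrPdist_le => e e0; near=> h.
rewrite sub0r normrN [h *: 1]mulr1 addr0 {2}/flat_fun ltxx subr0.
change (`|h^-1 * flat_fun P h| <= e).
have [h0|h0] := ltP 0 h; last by rewrite /flat_fun ltNge h0/= mulr0 normr0 ltW.
rewrite normrM gtr0_norm ?invr_gt0// ler_pdivrMl//.
apply: le_trans (HC _ h0) _.
have hC : h < e / (C + 1).
  have : `|h| < e / (C + 1).
    rewrite -[h]subr0 -normrN opprB; near: h; apply: nbhs_dnbhs.
    by apply: nbhsx_ballx; rewrite divr_gt0// ltr_wpDl.
  by rewrite gtr0_norm.
have C1 : 0 < C + 1 by rewrite ltr_wpDl.
move: hC; rewrite ltr_pdivlMr// => hC; nra.
Unshelve. all: by end_near. Qed.

End bump.

Section box_bump.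
Variables (R : realType) (n : nat).
Local Notation E := 'rV[R]_n.
Local Notation mu := (@lebesgue_rV R n).
Local Notation flat := (@flat_fun R 1).

Lemma smooth_on_flat (D : set E) (f : E -> R) : open D -> smooth_on D f ->
  smooth_on D (fun x => flat (f x)).
Proof.
move=> oD sf.
apply: (@smooth_on_comp_real R n D setT
  (fun m => flat_fun (iter m (fun P : {poly R} => 'X ^+ 2 * (P - P^`())) 1)) f oD _ sf) => // m t _.
exact: is_derive_flat_fun.
Qed.

Lemma flat_gt0 (t : R) : 0 < t -> 0 < flat t.
Proof. by move=> t0; rewrite /flat_fun t0 hornerC mul1r expR_gt0. Qed.

Lemma flat_le0 (t : R) : t <= 0 -> flat t = 0.
Proof. by move=> t0; rewrite /flat_fun ltNge t0. Qed.

Lemma flat_ge0 (t : R) : 0 <= flat t.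
Proof. by have [/flat_le0 ->//|/flat_gt0 /ltW] := leP t 0. Qed.

Definition open_box (a b : E) : set E :=
  [set x | forall i, a ord0 i < x ord0 i < b ord0 i].

Definition box_bump (a b x : E) : R :=
  \prod_(i < n) (flat (x ord0 i - a ord0 i) * flat (b ord0 i - x ord0 i)).

Lemma box_bump_ge0 a b x : 0 <= box_bump a b x.
Proof. by apply: prodr_ge0 => i _; rewrite mulr_ge0// flat_ge0. Qed.

Lemma box_bump_gt0 a b x : open_box a b x -> 0 < box_bump a b x.
Proof.
move=> abx; apply: prodr_gt0 => i _; have /andP[ax xb] := abx i.
by rewrite mulr_gt0// flat_gt0// subr_gt0.
Qed.

Lemma box_bump_eq0 a b x : ~ open_box a b x -> box_bump a b x = 0.
Proof.
move=> /existsNP[i /negP/nandP H]; rewrite /box_bump (bigD1 i)//=.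
case: H; rewrite -leNgt => H; first by rewrite flat_le0 ?subr_le0// !mul0r.
by rewrite (@flat_le0 (b _ _ - _)) ?subr_le0// mulr0 mul0r.
Qed.

Lemma smooth_box_bump a b : smooth_on setT (box_bump a b).
Proof.
apply: smooth_on_prod; first exact: openT.
move=> i _; apply: smooth_onM; first exact: openT.
  apply: smooth_on_flat; first exact: openT.
  by apply: smooth_onB; [exact: openT|exact: smooth_on_coord|exact: smooth_on_cst].
apply: smooth_on_flat; first exact: openT.
by apply: smooth_onB; [exact: openT|exact: smooth_on_cst|exact: smooth_on_coord].
Qed.

Definition closed_box (a b : E) : set E :=
  [set x | forall i, a ord0 i <= x ord0 i <= b ord0 i].

Lemma closed_box_compact a b : compact (closed_box a b).
Proof.
have -> : closed_box a b =
    [set x : E | forall i, `[a ord0 i, b ord0 i]%classic (x ord0 i)].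
  by apply/seteqP; split=> x H i; have := H i; rewrite /= in_itv/=.
apply: (@rV_compact R n (fun i => `[a ord0 i, b ord0 i]%classic)) => i.
exact: segment_compact.
Qed.

Lemma open_box_sub_closed a b : open_box a b `<=` closed_box a b.
Proof. by move=> x H i; have /andP[? ?] := H i; rewrite !ltW. Qed.

Lemma measurable_open_box a b : measurable (open_box a b).
Proof.
have -> : open_box a b = prod_set (fun i => `]a ord0 i, b ord0 i[%classic).
  by apply/seteqP; split=> x H i; have := H i; rewrite /= in_itv/=.
exact: measurable_prod_set.
Qed.

Lemma open_box_open a b : open (open_box a b).
Proof.
rewrite openE => x H; apply: (@filter_forall _ _ (fun i (y : E) => is_true (a ord0 i < y ord0 i < b ord0 i)) (nbhs x)) => i; have /andP[h1 h2] := H i.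
have cx : {for x, continuous (fun y : E => y ord0 i)} by exact: coord_cvg.
near=> y; apply/andP; split; near: y.
- by apply: (cx (fun t => a ord0 i < t)); exact: lt_nbhsr.
- by apply: (cx (fun t => t < b ord0 i)); exact: lt_nbhsl.
Unshelve. all: by end_near. Qed.

End box_bump.

Section fundamental_lemma.
Variables (R : realType) (n : nat).
Local Notation E := 'rV[R]_n.
Local Notation mu := (@lebesgue_rV R n).

Definition boxes : set (set E) := [set A | exists a b, A = open_box a b].

Lemma boxes_setI : setI_closed boxes.
Proof.
move=> _ _ [a [b ->]] [a' [b' ->]].
exists (\row_i Num.max (a ord0 i) (a' ord0 i)), (\row_i Num.min (b ord0 i) (b' ord0 i)).
apply/seteqP; split=> x.
  move=> [H H'] i; have := H i; have := H' i.
  by rewrite !mxE gt_max lt_min => /andP[-> ->] /andP[-> ->].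
by move=> H; split=> i; have := H i; rewrite !mxE gt_max lt_min =>
  /andP[/andP[h1 h2] /andP[h3 h4]]; rewrite ?h1 ?h2 ?h3 ?h4.
Qed.

Lemma boxes_generate : measurable = <<s boxes >>.
Proof.
apply/seteqP; split; last first.
  apply: smallest_sub; first exact: sigma_algebra_measurable.
  by move=> _ [a [b ->]]; exact: measurable_open_box.
apply: measurable_rV_ind; first exact: smallest_sigma_algebra.
move=> i a b.
have -> : @rV_coord _ R n i @^-1` `]a, b[%classic = \bigcup_(k : nat)
    open_box (\row_j if j == i then a else - k%:R) (\row_j if j == i then b else k%:R).
  apply/seteqP; split=> x.
    rewrite /= in_itv/= => H; exists (Num.truncn `|x|).+1 => // j; rewrite !mxE.
    case: eqP => [->//|_]; rewrite -ltr_norml.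
    by apply: le_lt_trans (coord_le_norm _ _) _; exact: truncnS_gt.
  by move=> [k _ /(_ i)]; rewrite !mxE eqxx /= in_itv.
apply: sigma_algebra_bigcup => k; apply: sub_sigma_algebra.
by eexists; eexists.
Qed.

(* [1 - exp (- N b)] is smooth and vanishes where the bump [b] does, so indicators of boxes
   are bounded pointwise limits of test functions. *)
Lemma box_approx a b (x : E) :
  (fun N : nat => 1 - expR (- (N%:R * box_bump a b x))) @ \oo --> (\1_(open_box a b) x : R).
Proof.
have [x0|x0] := pselect (open_box a b x); last first.
  rewrite indicE memNset// box_bump_eq0//.
  under eq_fun do rewrite mulr0 oppr0 expR0 subrr.
  exact: cvg_cst.
rewrite indicE mem_set// -[X in _ --> X]subr0; apply: cvgB; first exact: cvg_cst.
have H : (fun N : nat => N%:R * box_bump a b x) @ \oo --> +oo.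
  have b0 := box_bump_gt0 x0; apply/cvgryPge => A; near=> N.
  by rewrite -ler_pdivrMr//; near: N; exact: nbhs_infty_ger.
exact: cvg_comp H (@cvgr_expR R).
Unshelve. all: by end_near. Qed.

Lemma indic_bound (A : set E) (x : E) : `|\1_A x : R| <= 1.
Proof. by rewrite indicE; case: (x \in A); rewrite ?normr1 ?normr0. Qed.

Lemma measurable_indic_rV (A : set E) : measurable A -> measurable_fun setT (\1_A : E -> R).
Proof. by move=> mA; exact: measurable_indic. Qed.

(** A Dynkin class argument: open boxes are stable under intersection and generate the Borel sets.
    Everything is cut by one fixed box so that complements are differences of vanishing integrals;
    disjoint unions pass by domination by [|h|]. *)
Lemma integ_indic_eq0 a b (h : E -> R) : bounded_supp h ->
  (forall c d, closed_box c d `<=` closed_box a b ->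
     integ (fun x => \1_(open_box c d) x * h x) = 0) ->
  forall A, measurable A -> integ (fun x => \1_(A `&` open_box a b) x * h x) = 0.
Proof.
move=> bh H A; rewrite boxes_generate.
have bI (B : set E) : measurable B -> bounded_supp (fun x => \1_B x * h x).
  by move=> mB; apply: bounded_suppM => //; exists 1 => x; exact: indic_bound.
have mQ := measurable_open_box a b.
move: A; apply: (dynkin_induction boxes_generate boxes_setI).
- by rewrite setTI; exact: H.
- move=> _ [c [d ->]].
  pose c' : E := \row_i Num.max (c ord0 i) (a ord0 i).
  pose d' : E := \row_i Num.min (d ord0 i) (b ord0 i).
  have -> : open_box c d `&` open_box a b = open_box c' d'.
    apply/seteqP; split=> x.
      move=> [K K'] i; have := K i; have := K' i.
      by rewrite !mxE gt_max lt_min => /andP[-> ->] /andP[-> ->].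
    by move=> K; split=> i; have := K i; rewrite !mxE gt_max lt_min =>
      /andP[/andP[h1 h2] /andP[h3 h4]]; rewrite ?h1 ?h2 ?h3 ?h4.
  apply: H => x K i; have := K i; rewrite !mxE ge_max le_min.
  by move=> /andP[/andP[_ ->] /andP[_ ->]].
- move=> S mS PS.
  have mSQ : measurable (S `&` open_box a b) by exact: measurableI.
  have := H a b (@subset_refl _ _); rewrite -[in X in _ = X -> _]PS => E0.
  have -> : (fun x => \1_(~` S `&` open_box a b) x * h x) =
      (fun x => \1_(open_box a b) x * h x - \1_(S `&` open_box a b) x * h x).
    apply/funext => x; rewrite -mulrBl; congr (_ * _).
    rewrite !indicE !in_setI in_setC.
    by case: (x \in S); case: (x \in _); rewrite /= ?subrr ?subr0.
  by rewrite integB ?E0 ?subrr//; exact: bI.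
- move=> F mF tF PF.
  have mFQ k : measurable (F k `&` open_box a b) by exact: measurableI.
  pose f_ (N : nat) (x : E) : R := \sum_(k < N) (\1_(F k `&` open_box a b) x * h x).
  have f_E N x : f_ N x = \1_(\bigcup_(k < N) F k `&` open_box a b) x * h x.
    rewrite /f_ -mulr_suml; congr (_ * _); rewrite indicE in_setI.
    have [Qx|Qx] := boolP (x \in open_box a b); last first.
      by rewrite andbF big1// => k _; rewrite indicE in_setI (negbTE Qx) andbF.
    rewrite andbT; have [[k kN Fk]|Fx] := pselect ((\bigcup_(k < N) F k) x).
      rewrite mem_set; last by exists k.
      rewrite (bigD1 (Ordinal kN))//= indicE in_setI Qx mem_set//= big1 ?addr0// => l lk.
      rewrite indicE in_setI Qx andbT memNset// => Fl; move/eqP: lk; apply.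
      apply/val_inj => /=; apply: (tF l k) => //; by exists x.
    rewrite memNset// big1// => k _; rewrite indicE in_setI Qx andbT memNset// => Fk.
    by apply: Fx; exists k => //=.
  have mN N : measurable (\bigcup_(k < N) F k `&` open_box a b).
    by apply: measurableI => //; exact: bigcup_measurable.
  have L : (fun N => integ (f_ N)) @ \oo -->
      integ (fun x => \1_(\bigcup_k F k `&` open_box a b) x * h x).
    apply: (integ_dominated (g := fun x => `|h x|)).
    - move=> N; have -> : f_ N = fun x => \1_(\bigcup_(k < N) F k `&` open_box a b) x * h x.
        by apply/funext => x; exact: f_E.
      by have [] := bI _ (mN N).
    - have mU : measurable (\bigcup_k F k `&` open_box a b).
        by apply: measurableI => //; exact: bigcupT_measurable.
      by have [] := bI _ mU.
    - exact: bounded_supp_abs.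
    - move=> x; apply: cvg_near_cst.
      have [[k _ Fk]|Fx] := pselect ((\bigcup_k F k) x).
        exists k.+1 => // N /= kN; rewrite f_E !indicE !in_setI; congr (_ * _).
        rewrite (_ : x \in \bigcup_(k0 < N) F k0)//; last by apply/mem_set; exists k.
        by rewrite (_ : x \in \bigcup_k0 F k0)//; apply/mem_set; exists k.
      apply: nearW => N; rewrite f_E !indicE !in_setI.
      rewrite (_ : x \in \bigcup_k0 F k0 = false); last by rewrite memNset.
      rewrite (_ : x \in \bigcup_(k0 < N) F k0 = false)// memNset//.
      by move=> [k _ Fk]; apply: Fx; exists k.
    - move=> N x; rewrite f_E normrM ler_piMl// indic_bound.
      by [].
  have E0 : (fun N => integ (f_ N)) = fun=> 0.
    apply/funext => N; rewrite integ_sum; last by move=> k _; exact: bI.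
    by rewrite big1// => k _; exact: PF.
  by move: L; rewrite E0 => /(cvg_unique _ (cvg_cst _)) ->.
Qed.

(** Near a point of [D] a closed box fits into [D]. Indicators of smaller boxes are limits of test
    functions, so [h] integrates to 0 over every Borel subset of the box, in particular over the
    parts where it is positive and where it is negative. *)
Lemma fundamental_lemma (D : set E) (h : E -> R) : open D -> bounded_supp h ->
  (forall phi, test_function D phi -> integ (fun x => phi x * h x) = 0) ->
  mu.-negligible (D `&` [set x | h x <> 0]).
Proof.
move=> oD bh H; apply: negligible_local => x0 [Dx0 _].
have /nbhs_ballP[e /= e0 eD] : nbhs x0 D by exact: open_nbhs_nbhs.
pose a : E := \row_i (x0 ord0 i - e / 2); pose b : E := \row_i (x0 ord0 i + e / 2).
exists (open_box a b).
  split; first exact: open_box_open.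
  by move=> i; rewrite !mxE; apply/andP; split; lra.
have abD : closed_box a b `<=` D.
  move=> y yab; apply: eD; apply/ballP_coord => // i.
  have := yab i; rewrite !mxE => /andP[h1 h2]; rewrite ltr_norml; lra.
have K c d : closed_box c d `<=` closed_box a b ->
    integ (fun x => \1_(open_box c d) x * h x) = 0.
  move=> cdab.
  pose f_ (N : nat) (x : E) : R := (1 - expR (- (N%:R * box_bump c d x))) * h x.
  have sN N : smooth_on setT (fun x : E => 1 - expR (- (N%:R * box_bump c d x))).
    apply: smooth_onB; [exact: openT|exact: smooth_on_cst|].
    apply: smooth_on_exp; first exact: openT.
    apply: smooth_onN; first exact: openT.
    by apply: smooth_onM; [exact: openT|exact: smooth_on_cst|exact: smooth_box_bump].
  have tN N : test_function D (fun x : E => 1 - expR (- (N%:R * box_bump c d x))).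
    split; first exact: sN.
    exists (closed_box c d); split.
    - exact: closed_box_compact.
    - exact: subset_trans abD.
    - move=> y cdy; rewrite box_bump_eq0 ?mulr0 ?oppr0 ?expR0 ?subrr//.
      by move=> /open_box_sub_closed.
  have f_0 N : integ (f_ N) = 0 by exact: H (tN N).
  have L : (fun N => integ (f_ N)) @ \oo --> integ (fun x => \1_(open_box c d) x * h x).
    apply: (integ_dominated (g := fun x => `|h x|)).
    - by move=> N; apply: measurable_funM; [exact: smooth_measurable|exact: bh.1].
    - apply: measurable_funM; [exact: measurable_indic_rV (measurable_open_box _ _)|exact: bh.1].
    - exact: bounded_supp_abs.
    - by move=> x; apply: cvgMl; exact: box_approx.
    - move=> N x; rewrite normrM ler_piMl// ger0_norm.
        by rewrite lerBlDr lerDl expR_ge0.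
      rewrite subr_ge0 -expR0 ler_expR oppr_le0 mulr_ge0//; exact: box_bump_ge0.
  have E0 : (fun N => integ (f_ N)) = fun=> 0 by apply/funext.
  by move: L; rewrite E0 => /(cvg_unique _ (cvg_cst _)) ->.
have Z := integ_indic_eq0 bh K.
have mQ := measurable_open_box a b.
have nonneg (g : E -> R) : bounded_supp g -> (forall x, 0 <= g x) -> integ g = 0 ->
    mu.-negligible [set x | g x <> 0].
  move=> bg g0 ig.
  have : (\int[mu]_x `|(g x)%:E| = 0)%E.
    have -> : (\int[mu]_x `|(g x)%:E| = \int[mu]_x (g x)%:E)%E.
      by apply: eq_integral => x _; rewrite gee0_abs// lee_fin.
    have /integrable_fin_num/fineK <- := bounded_supp_integrable bg => //.
    by rewrite -[fine _]/(integ g) ig.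
  have mg : measurable_fun setT (fun x => (g x)%:E) by apply/measurable_EFinP; case: bg.
  move=> /(ae_eq_integral_abs mu measurableT mg) [N [mN N0 HN]]; exists N; split => //.
  by move=> x /= gx; apply: HN => /= /(_ I) [] /gx.
have mh : measurable_fun setT h by case: bh.
have mpos : measurable [set x | 0 < h x].
  have -> : [set x | 0 < h x] = h @^-1` `]0, +oo[%classic.
    by apply/seteqP; split => x /=; rewrite in_itv/= andbT.
  by rewrite -[X in measurable X]setTI; exact: mh.
have mneg : measurable [set x | h x < 0].
  have -> : [set x | h x < 0] = h @^-1` `]-oo, 0[%classic.
    by apply/seteqP; split => x /=; rewrite in_itv.
  by rewrite -[X in measurable X]setTI; exact: mh.
have bI (B : set E) : measurable B -> bounded_supp (fun x => \1_B x * h x).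
  by move=> mB; apply: bounded_suppM => //; exists 1 => x; exact: indic_bound.
have mI (B : set E) : measurable B -> measurable (B `&` open_box a b).
  by move=> mB; exact: measurableI.
have P := nonneg _ (bI _ (mI _ mpos)) _ (Z _ mpos).
have N1 := nonneg _ (bounded_suppZ (-1) (bI _ (mI _ mneg))) _ _.
have : mu.-negligible ([set x | \1_([set x | 0 < h x] `&` open_box a b) x * h x <> 0] `|`
   [set x | -1 * (\1_([set x | h x < 0] `&` open_box a b) x * h x) <> 0]).
  apply: negligibleU.
    apply: P => x; rewrite indicE in_setI; have [h0|h0] := ltP 0 (h x).
      by rewrite mulr_ge0// ltW.
    by rewrite memNset ?mul0r//= => /(le_lt_trans h0); rewrite ltxx.
  apply: N1; last by rewrite integZ ?Z ?mulr0//; exact: bI (mI _ mneg).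
  move=> x; rewrite indicE in_setI; have [h0|h0] := ltP (h x) 0.
    by rewrite mulN1r -mulrN mulr_ge0// oppr_ge0 ltW.
  by rewrite memNset ?mul0r ?mulr0//= => /(le_lt_trans h0); rewrite ltxx.
apply: negligibleS => x [[_ /= hx] Qx].
have [h0|h0|//] := ltgtP (h x) 0; [right|left] => /=.
  by rewrite indicE mem_set// mul1r mulN1r; apply/eqP; rewrite oppr_eq0 lt_eqF.
by rewrite indicE mem_set// mul1r; apply/eqP; rewrite gt_eqF.
Qed.

End fundamental_lemma.

(** * Fourier integrals and series *)

Section trig.
Variables (R : realType) (n : nat).
Local Notation E := 'rV[R]_n.
Local Notation mu := (@lebesgue_rV R n).
Implicit Types (xi eta x : E) (th al : R) (v : E -> R).

(* The real family [cos (<x, xi> + th)], with a phase [th], replaces [exp (i <x, xi>)]: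
   [th = 0] and [th = - pi / 2] give the cosine and the sine. *)
Definition trig xi th x : R := cos (dot x xi + th).

Lemma dotDr x xi eta : dot x (xi + eta) = dot x xi + dot x eta.
Proof. by rewrite -big_split; apply: eq_bigr => i _; rewrite mxE mulrDr. Qed.

Lemma dotNr x xi : dot x (- xi) = - dot x xi.
Proof. by rewrite -sumrN; apply: eq_bigr => i _; rewrite mxE mulrN. Qed.

Lemma trigM xi th eta al x : trig xi th x * trig eta al x =
  2^-1 * (trig (xi + eta) (th + al) x + trig (xi - eta) (th - al) x).
Proof.
rewrite /trig !dotDr dotNr.
have -> : dot x xi + dot x eta + (th + al) = (dot x xi + th) + (dot x eta + al) by ring.
have -> : dot x xi - dot x eta + (th - al) = (dot x xi + th) - (dot x eta + al) by ring.
by move: (dot x xi + th) (dot x eta + al) => a b; rewrite cosB cosD; field.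
Qed.

Lemma trig_bound xi th x : `|trig xi th x| <= 1.
Proof. by rewrite ler_norml cos_geN1 cos_le1. Qed.

Lemma trigN xi th x : trig (- xi) th x = trig xi (- th) x.
Proof. by rewrite /trig dotNr -cosN opprD opprK. Qed.

Lemma smooth_dot D xi : open D -> smooth_on D (fun x => dot x xi).
Proof.
move=> oD; apply: smooth_on_sum => // i _; apply: smooth_onM => //.
  exact: smooth_on_coord.
exact: smooth_on_cst.
Qed.

Lemma smooth_trig D xi th : open D -> smooth_on D (trig xi th).
Proof.
move=> oD; apply: smooth_on_cos => //; apply: smooth_onD => //.
  exact: smooth_dot.
exact: smooth_on_cst.
Qed.

Lemma partial_trig i xi th x :
  partial i (trig xi th) x = xi ord0 i * trig xi (th + pi / 2) x.
Proof.
have dd : is_derive x (delta_mx ord0 i : E) (fun x => dot x xi + th) (xi ord0 i).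
  have -> : (fun x : E => dot x xi + th) = (fun x => (\sum_(j < n) xi ord0 j *: (fun y : E => y ord0 j)) x + th).
    apply/funext => y; rewrite fct_sumE; congr (_ + _); apply: eq_bigr => j _.
    by rewrite mulrC.
  have H : is_derive x (delta_mx ord0 i : E) (\sum_(j < n) xi ord0 j *: (fun y : E => y ord0 j))
      (\sum_(j < n) xi ord0 j *: (delta_mx ord0 i : E) ord0 j).
    apply: is_derive_sum => j; apply: is_deriveZ; exact: is_derive_coord.
  have := is_deriveD H (is_derive_cst th x (delta_mx ord0 i : E)).
  move=> /is_derive_eq; apply; rewrite addr0 (bigD1 i)//= mxE !eqxx big1 ?addr0 => [|j ji].
    exact: mulr1.
  by rewrite mxE (negbTE ji); exact: mulr0.
have [d1 d2] := dd.
have := is_derive_comp_real d1 (is_derive_cos _) => -[_].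
rewrite /partial /trig d2 addrA => ->.
by rewrite cosDpihalf mulrC.
Qed.

Definition fint v xi th : R := integ (fun x => trig xi th x * v x).

Lemma measurable_trig xi th : measurable_fun setT (trig xi th).
Proof. by apply: smooth_measurable; apply: smooth_trig; exact: openT. Qed.

Lemma bounded_supp_trig v xi th : bounded_supp v ->
  bounded_supp (fun x => trig xi th x * v x).
Proof.
move=> bv; apply: bounded_suppM => //; first exact: measurable_trig.
by exists 1 => x; exact: trig_bound.
Qed.

Lemma fint_trig v eta al xi th : bounded_supp v ->
  fint (fun x => trig eta al x * v x) xi th =
  2^-1 * (fint v (xi + eta) (th + al) + fint v (xi - eta) (th - al)).
Proof.
move=> bv; rewrite -integD; [|exact: bounded_supp_trig..].
rewrite -integZ; last by apply: bounded_suppD; exact: bounded_supp_trig.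
by congr (integ _); apply/funext => x; rewrite mulrA trigM; ring.
Qed.

Lemma fintN v xi th : fint v (- xi) th = fint v xi (- th).
Proof. by congr (integ _); apply/funext => x; rewrite trigN. Qed.

Lemma fint_bound v : bounded_supp v -> forall xi th,
  `|fint v xi th| <= integ (fun x => `|v x|).
Proof.
move=> bv xi th; apply: le_trans (integ_abs _) _; first exact: bounded_supp_trig.
apply: le_integ; last first.
- by move=> x; rewrite normrM ler_piMl// trig_bound.
- exact: bounded_supp_abs.
- by apply: bounded_supp_abs; exact: bounded_supp_trig.
Qed.

(** Uniformity in the phase [th] means decay of the cosine and the sine integral at once, and makes
    the notion stable under phase shifts. *)
Definition rapid_on (G : set E) v := forall m : nat, exists B : R, forall xi th,
  G xi -> `|fint v xi th| * (1 + `|xi|) ^+ m <= B.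

(** Integration by parts; differentiating [trig] costs a frequency factor and a phase shift of
    [pi / 2]. *)
Lemma fint_partial i (chi : E -> R) (r : R) xi th : smooth_on setT chi ->
  (forall x, r <= `|x| -> chi x = 0) ->
  fint (partial i chi) xi th = - (xi ord0 i * fint chi xi (th + pi / 2)).
Proof.
move=> sc c0.
have st : smooth_on setT (trig xi th) by apply: smooth_trig; exact: openT.
have sp : smooth_on setT (fun x => trig xi th x * chi x).
  by apply: smooth_onM => //; exact: openT.
have [bp] := integ_partial i sp (r := r) (fun x rx => etrans (congr1 _ (c0 x rx)) (mulr0 _)).
have bc : bounded_supp chi.
  by apply: continuous_bounded_supp c0 => x; exact: smooth_on_continuous sc I.
have [bpc _] := integ_partial i sc c0.
have -> : partial i (fun x => trig xi th x * chi x) =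
   fun x => trig xi th x * partial i chi x + xi ord0 i * (trig xi (th + pi / 2) x * chi x).
  apply/funext => x; rewrite (partialM i openT st sc I) partial_trig.
  ring.
rewrite integD.
- by rewrite integZ => [/eqP|]; [rewrite addr_eq0 => /eqP|exact: bounded_supp_trig].
- exact: bounded_supp_trig.
- by apply: bounded_suppZ; exact: bounded_supp_trig.
Qed.

Lemma smooth_fint_power i (chi : E -> R) m (r : R) : smooth_on setT chi ->
  (forall x, r <= `|x| -> chi x = 0) ->
  exists B : R, forall xi th, `|xi ord0 i| ^+ m * `|fint chi xi th| <= B.
Proof.
elim: m chi r => [|m IH] chi r sc c0.
  exists (integ (fun x => `|chi x|)) => xi th; rewrite mul1r; apply: fint_bound.
  by apply: continuous_bounded_supp c0 => x; exact: smooth_on_continuous sc I.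
have r1 : r < r + 1 by rewrite ltrDl.
have [B HB] := IH (partial i chi) (r + 1) (smooth_on_partial i sc)
  (fun x rx => partial_eq0 i c0 (lt_le_trans r1 rx)).
exists B => xi th; apply: le_trans (HB xi (th - pi / 2)).
rewrite (fint_partial i _ _ sc c0) subrK normrN normrM.
by rewrite exprSr -mulrA.
Qed.

Lemma norm_coordE (x : E) : x != 0 -> exists i, `|x| = `|x ord0 i|.
Proof.
move=> x0; have : mx_norm x != 0 by rewrite -[mx_norm x]/(`|x|) normr_eq0.
by move=> /mx_norm_neq0[[j i]] /= xE; exists i; rewrite (ord1 j) in xE.
Qed.

(** The sup norm of [xi] is attained at a coordinate, whose powers are controlled by
    [smooth_fint_power]. For [|xi| > 1] one has [1 + |xi| <= 2 * |xi|], and for smaller [xi] the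
    trivial bound suffices. *)
Lemma smooth_rapid (chi : E -> R) (r : R) : smooth_on setT chi ->
  (forall x, r <= `|x| -> chi x = 0) -> rapid_on setT chi.
Proof.
move=> sc c0 m.
have bc : bounded_supp chi.
  by apply: continuous_bounded_supp c0 => x; exact: smooth_on_continuous sc I.
have /choice[B HB] : forall i, exists B : R, forall xi th,
    `|xi ord0 i| ^+ m * `|fint chi xi th| <= B.
  by move=> i; exact: smooth_fint_power sc c0.
pose A := integ (fun x => `|chi x|).
have A0 : 0 <= A by exact: le_trans (fint_bound bc 0 0).
exists (2 ^+ m * (A + \sum_i `|B i|)) => xi th _.
have S0 : 0 <= \sum_i `|B i| by exact: sumr_ge0.
have := fint_bound bc xi th; rewrite -/A => fA.
have [x1|x1] := leP `|xi| 1.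
  apply: (@le_trans _ _ (A * 2 ^+ m)).
    apply: ler_pM => //.
    by apply: lerXn2r; rewrite ?nnegrE ?addr_ge0//; lra.
  by rewrite mulrC ler_wpM2l ?exprn_ge0// lerDl.
have [i xiE] : exists i, `|xi| = `|xi ord0 i|.
  by apply: norm_coordE; rewrite -normr_gt0; exact: lt_trans x1.
apply: (@le_trans _ _ (`|fint chi xi th| * (2 * `|xi|) ^+ m)).
  rewrite ler_wpM2l// lerXn2r// ?nnegrE ?addr_ge0 ?mulr_ge0//; lra.
rewrite exprMn mulrCA ler_wpM2l ?exprn_ge0// mulrC {1}xiE.
apply: le_trans (HB i xi th) _; apply: le_trans (ler_norm _) _.
by rewrite (bigD1 i)//= addrCA lerDl addr_ge0// sumr_ge0.
Qed.

Lemma iter_partial_trig s xi th x : iter_partial s (trig xi th) x =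
  (\prod_(i <- s) xi ord0 i) * trig xi (th + (size s)%:R * (pi / 2)) x.
Proof.
elim: s x => [|i s IH] x; first by rewrite big_nil mul1r mul0r addr0.
have -> : iter_partial (i :: s) (trig xi th) x = partial i (iter_partial s (trig xi th)) x by [].
have -> : iter_partial s (trig xi th) =
    (fun x => (\prod_(i <- s) xi ord0 i) * trig xi (th + (size s)%:R * (pi / 2)) x).
  by apply/funext.
rewrite (partialM i openT (smooth_on_cst _) (smooth_trig _ _ openT) I).
rewrite partial_trig big_cons {1}/partial derive_cst /= -[(size s).+1%:R]natr1.
by rewrite [in RHS]mulrDl mul1r addrA; ring.
Qed.

End trig.

(** * Sums over the integer lattice *)

Section lattice.
Variables (R : realType) (n : nat).
Local Notation E := 'rV[R]_n.
Local Notation K := {ffun 'I_n -> int}.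

Definition lattice_vec (k : K) : E := \row_i (k i)%:~R.
Local Notation kv := lattice_vec.

(** The lattice points with coordinates of absolute value at most [N], listed as shifted finite
    functions so that sums of products factor over the coordinates. *)
Definition lattice_box (N : nat) : seq K :=
  [seq [ffun i => (f i : nat)%:Z - N%:Z] | f : {ffun 'I_n -> 'I_(N.*2.+1)}].

Lemma lattice_box_uniq N : uniq (lattice_box N).
Proof.
rewrite map_inj_uniq ?enum_uniq// => f g /ffunP fg; apply/ffunP => i; apply/val_inj => /=.
by have := fg i; rewrite !ffunE => /addIr [].
Qed.

Lemma mem_lattice_box N k : (k \in lattice_box N) = [forall i, (`|k i| <= N)%N].
Proof.
apply/mapP/forallP => [[f _ ->] i|H].
  by rewrite ffunE; case: (f i) => j jN /=; lia.
have kN i : (absz (k i + N%:Z)%R < N.*2.+1)%N by have := H i; lia.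
exists [ffun i => Ordinal (kN i)]; first by rewrite mem_enum.
by apply/ffunP => i; rewrite !ffunE /=; move: (H i); move: (k i : int) => z; lia.
Qed.

Lemma lattice_box_sub N M k : (N <= M)%N -> k \in lattice_box N -> k \in lattice_box M.
Proof.
rewrite !mem_lattice_box => NM /forallP H; apply/forallP => i.
exact: leq_trans NM.
Qed.

Lemma lattice_box_filter N M : (N <= M)%N ->
  perm_eq [seq k <- lattice_box M | k \in lattice_box N] (lattice_box N).
Proof.
move=> NM; apply: uniq_perm; rewrite ?filter_uniq ?lattice_box_uniq// => k.
rewrite mem_filter; case: (boolP (k \in lattice_box N)) => //= kN.
exact: lattice_box_sub kN.
Qed.

(** The bound 2 is sharpened by [1 / N.+1] so that the induction closes, by
    [(x + 1) ^- 2 <= x^-1 - (x + 1)^-1]. *)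
Lemma sum_inv_sqr N : \sum_(j < N.+1) (1 + j%:R) ^- 2 <= 2 - N.+1%:R^-1 :> R.
Proof.
elim: N => [|N IH]; first by rewrite big_ord_recr big_ord0/= addr0 expr1n invr1; lra.
rewrite big_ord_recr/=; apply: le_trans (lerD IH (lexx _)) _.
have H (x : R) : 0 < x -> 2 - x^-1 + (1 + x) ^- 2 <= 2 - (x + 1)^-1.
  move=> x0; have x1 : 0 < x + 1 by lra.
  rewrite -subr_ge0.
  have -> : 2 - (x + 1)^-1 - (2 - x^-1 + (1 + x) ^- 2) = (x * (x + 1) ^+ 2)^-1.
    by field; rewrite !gt_eqF// addrC.
  by rewrite invr_ge0 mulr_ge0 ?exprn_ge0// ltW.
by rewrite -[N.+2%:R]natr1; apply: H.
Qed.

Lemma sum_int_inv_sqr N :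
  \sum_(j < N.*2.+1) (1 + `|((j : nat)%:Z - N%:Z)%:~R|) ^- 2 <= 4 :> R.
Proof.
pose f (j : nat) : R := (1 + j%:R) ^- 2.
have f0 j : 0 <= f j by rewrite invr_ge0 exprn_ge0// addr_ge0.
rewrite -(big_mkord xpredT (fun j => (1 + `|(j%:Z - N%:Z)%:~R|) ^- 2)).
rewrite (@big_cat_nat _ _ _ N)//=; last by lia.
have S2 : \sum_(j < N.+1) f j <= 2.
  by apply: le_trans (sum_inv_sqr N) _; rewrite lerBlDr lerDl.
suff : \sum_(0 <= j < N) (1 + `|(j%:Z - N%:Z)%:~R|) ^- 2 <= 2 :> R /\
   \sum_(N <= j < N.*2.+1) (1 + `|(j%:Z - N%:Z)%:~R|) ^- 2 <= 2 :> R.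
  by move=> [h1 h2]; apply: le_trans (lerD h1 h2) _; lra.
split; apply: le_trans S2.
  rewrite big_nat_rev/= add0n big_ord_recl /= -[leLHS]add0r; apply: lerD => //.
  rewrite big_mkord; apply: ler_sum => i _; rewrite /f.
  rewrite (_ : `|((N - i.+1)%:Z - N%:Z)%:~R| = (lift ord0 i : nat)%:R :> R)//.
  by rewrite -intr_norm -natr_absz; congr (_%:R); rewrite /= /bump /=; have := ltn_ord i; lia.
rewrite -{1}[N]add0n big_addn (_ : (N.*2.+1 - N)%N = N.+1); last by lia.
rewrite big_mkord; apply: ler_sum => i _; rewrite /f.
by rewrite PoszD addrK normr_nat.
Qed.

(** The sup norm dominates each coordinate, so [(1 + |k|) ^- (2 n)] is at most the product of the
    [(1 + |k_i|) ^- 2]; the sum of products is a product of [n] one-dimensional sums, each at most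
    4. *)
Lemma lattice_sum N : \sum_(k <- lattice_box N) (1 + `|kv k|) ^- n.*2 <= 4 ^+ n :> R.
Proof.
rewrite big_map big_enum/=.
have pc (c : R) : c ^+ n = \prod_(i < n) c by rewrite prodr_const card_ord.
apply: (@le_trans _ _ (\sum_(f : {ffun 'I_n -> 'I_(N.*2.+1)})
   \prod_i (1 + `|((f i : nat)%:Z - N%:Z)%:~R|) ^- 2)).
  apply: ler_sum => f _; rewrite -[n.*2]mul2n exprM -exprVn pc.
  apply: ler_prod => i _; rewrite invr_ge0 exprn_ge0 ?addr_ge0//=.
  rewrite lef_pV2 ?posrE ?exprn_gt0// ?ltr_wpDr//.
  rewrite lerXn2r// ?nnegrE ?addr_ge0// lerD2l.
  by have := coord_le_norm (kv [ffun i => (f i : nat)%:Z - N%:Z]) i; rewrite mxE ffunE.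
rewrite -(bigA_distr_bigA (fun i (j : 'I_(N.*2.+1)) => (1 + `|((j : nat)%:Z - N%:Z)%:~R|) ^- 2)).
rewrite pc; apply: ler_prod => i _.
by rewrite sum_int_inv_sqr andbT sumr_ge0.
Qed.

Lemma lattice_sum_bound (a : K -> R) (C : R) N :
  (forall k, `|a k| * (1 + `|kv k|) ^+ n.*2 <= C) ->
  \sum_(k <- lattice_box N) `|a k| <= C * 4 ^+ n.
Proof.
move=> aC.
have C0 : 0 <= C.
  by apply: le_trans (aC [ffun=> 0]); rewrite mulr_ge0// exprn_ge0// addr_ge0.
apply: le_trans (ler_wpM2l C0 (lattice_sum N)); rewrite mulr_sumr.
apply: ler_sum => k _; by rewrite ler_pdivlMr// exprn_gt0// ltr_wpDr.
Qed.

(** Outside the box of size [N] some coordinate exceeds [N], so one power of [1 + |k|] beyond the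
    summable exponent [2 n] yields the factor [1 / N.+1]. *)
Lemma lattice_sum_tail (a : K -> R) (C : R) N M : (N <= M)%N ->
  (forall k, `|a k| * (1 + `|kv k|) ^+ n.*2.+1 <= C) ->
  `|\sum_(k <- lattice_box N) a k - \sum_(k <- lattice_box M) a k| <=
    C * 4 ^+ n / N.+1%:R.
Proof.
move=> NM aC.
rewrite (bigID (fun k => k \in lattice_box N) _ (fun k => a k) (r := lattice_box M))/=.
rewrite -[X in _ - (X + _)]big_filter (perm_big _ (lattice_box_filter NM))/=.
rewrite opprD addrA subrr sub0r normrN.
apply: le_trans (ler_norm_sum _ _ _) _; rewrite big_mkcond/=.
rewrite ler_pdivlMr ?ltr0n// mulr_suml.
pose b k := if k \notin lattice_box N then `|a k| * N.+1%:R else 0.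
have bE k : `|b k| = (if k \notin lattice_box N then `|a k| else 0) * N.+1%:R.
  by rewrite /b; case: ifP => _; rewrite ?mul0r ?normr0// ger0_norm// mulr_ge0.
under eq_bigr do rewrite -bE.
apply: lattice_sum_bound => k; rewrite bE; case: ifP => kN; last first.
  by rewrite !mul0r; apply: le_trans (aC k); rewrite mulr_ge0// exprn_ge0// addr_ge0.
apply: le_trans (aC k); rewrite exprS -mulrA ler_wpM2l// ler_wpM2r//.
have [i Nk] : exists i, (N < `|k i|)%N.
  apply: contrapT => H; move: kN; rewrite mem_lattice_box => /forallP; apply => i.
  by rewrite leqNgt; apply/negP => ki; apply: H; exists i.
apply: (@le_trans _ _ (1 + `|kv k ord0 i|)); last by rewrite lerD2l coord_le_norm.
rewrite mxE -intr_norm -natr_absz /= -natr1 addrC lerD2l ler_nat; exact: ltnW.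
Qed.

End lattice.

Section trig_series.
Variables (R : realType) (n : nat).
Local Notation E := 'rV[R]_n.
Local Notation mu := (@lebesgue_rV R n).
Local Notation K := {ffun 'I_n -> int}.
Local Notation kv := (@lattice_vec R n).

Lemma iter_partialD s (f g : E -> R) : smooth_on setT f -> smooth_on setT g ->
  iter_partial s (fun x => f x + g x) = fun x => iter_partial s f x + iter_partial s g x.
Proof.
move=> sf sg; elim: s => [//|i s IH]; apply/funext => x.
rewrite [LHS]/= IH.
exact: (partialD i openT (smooth_on_iter_partial s sf) (smooth_on_iter_partial s sg) I).
Qed.

Lemma iter_partialZ s (f : E -> R) c : smooth_on setT f ->
  iter_partial s (fun x => c * f x) = fun x => c * iter_partial s f x.
Proof.
move=> sf; elim: s => [//|i s IH]; apply/funext => x.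
rewrite [LHS]/= IH (partialM i openT (smooth_on_cst c) (smooth_on_iter_partial s sf) I).
by rewrite {2}/partial derive_cst mul0r addr0.
Qed.

Lemma iter_partial_sum s (I : Type) (r : seq I) (F : I -> E -> R) x :
  (forall i, smooth_on setT (F i)) ->
  iter_partial s (fun x => \sum_(i <- r) F i x) x = \sum_(i <- r) iter_partial s (F i) x.
Proof.
move=> sF; elim: r => [|i r IH].
  rewrite big_nil; have -> : (fun x => \sum_(i <- [::]) F i x) = fun x => 0 * (fun=> 0) x.
    by apply/funext => y; rewrite big_nil mul0r.
  by rewrite iter_partialZ ?mul0r//; exact: smooth_on_cst.
have -> : (fun x => \sum_(j <- i :: r) F j x) = fun x => F i x + \sum_(j <- r) F j x.
  by apply/funext => y; rewrite big_cons.
rewrite iter_partialD//; first by rewrite IH big_cons.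
by apply: smooth_on_sum => //; exact: openT.
Qed.

Definition rapid_seq (a : K -> R) := forall m : nat, exists C : R, forall k,
  `|a k| * (1 + `|kv k|) ^+ m <= C.

Definition trig_series (a b : K -> R) (N : nat) (x : E) : R :=
  \sum_(k <- lattice_box n N) (a k * trig (kv k) 0 x + b k * trig (kv k) (- (pi / 2)) x).

Let term a b k x : R := a k * trig (kv k) 0 x + b k * trig (kv k) (- (pi / 2)) x.

Let smooth_term a b k : smooth_on setT (term a b k).
Proof.
have sT th : smooth_on setT (trig (kv k) th : E -> R) by apply: smooth_trig; exact: openT.
apply: smooth_onD; first exact: openT.
all: by apply: smooth_onM; [exact: openT|exact: smooth_on_cst|exact: sT].
Qed.

Lemma smooth_trig_series a b N : smooth_on setT (trig_series a b N).
Proof. by apply: smooth_on_sum; [exact: openT|move=> k _; exact: smooth_term]. Qed.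

(** A derivative of order [size s] costs that many powers of [1 + |k|]; the [2 n + 1] further powers
    give summability and the rate. *)
Lemma trig_series_limit a b : rapid_seq a -> rapid_seq b ->
  exists2 g : E -> R, smooth_on setT g &
    exists C, forall N x, `|trig_series a b N x - g x| <= C / N.+1%:R.
Proof.
move=> ra rb; apply: smooth_limit => [N|s]; first exact: smooth_trig_series.
have [Ca HCa] := ra (size s + n.*2.+1)%N; have [Cb HCb] := rb (size s + n.*2.+1)%N.
exists ((Ca + Cb) * 4 ^+ n) => N M x NM.
rewrite !(iter_partial_sum s _ x (smooth_term a b)).
apply: lattice_sum_tail => // k.
have p1 : 1 <= 1 + `|kv k| by rewrite lerDl.
have p0 : 0 <= 1 + `|kv k| by rewrite addr_ge0.
have sT th : smooth_on setT (trig (kv k) th : E -> R) by apply: smooth_trig; exact: openT.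
have B (c th : R) : `|iter_partial s (fun x => c * trig (kv k) th x) x| <=
    `|c| * (1 + `|kv k|) ^+ size s.
  rewrite iter_partialZ// iter_partial_trig !normrM ler_wpM2l//.
  rewrite -[leRHS]mulr1 ler_pM ?trig_bound// normr_prod.
  elim: (s) => [|i l IH]; first by rewrite big_nil.
  rewrite big_cons exprS ler_pM ?prodr_ge0//.
  by apply: le_trans (coord_le_norm _ _) _; rewrite lerDr.
have -> : iter_partial s (term a b k) x = iter_partial s (fun x => a k * trig (kv k) 0 x) x +
   iter_partial s (fun x => b k * trig (kv k) (- (pi / 2)) x) x.
  rewrite iter_partialD//; apply: smooth_onM => //; try exact: openT; exact: smooth_on_cst.
apply: (@le_trans _ _ ((`|a k| * (1 + `|kv k|) ^+ size s + `|b k| * (1 + `|kv k|) ^+ size s) *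
   (1 + `|kv k|) ^+ n.*2.+1)).
  rewrite ler_wpM2r ?exprn_ge0//; apply: le_trans (ler_normD _ _) _; exact: lerD.
by rewrite mulrDl -!mulrA -exprD lerD.
Qed.

Lemma integ_close (w f g : E -> R) (c B : R) : bounded_supp w ->
  measurable_fun setT f -> measurable_fun setT g ->
  (forall x, `|f x| <= B) -> (forall x, `|g x| <= B) ->
  (forall x, w x != 0 -> `|f x - g x| <= c) ->
  `|integ (fun x => f x * w x) - integ (fun x => g x * w x)| <= c * integ (fun x => `|w x|).
Proof.
move=> bw mf mg fB gB fg.
have bf : bounded_supp (fun x => f x * w x) by apply: bounded_suppM => //; exists B.
have bg : bounded_supp (fun x => g x * w x) by apply: bounded_suppM => //; exists B.
rewrite -integB// -integZ; last exact: bounded_supp_abs.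
have bfg : bounded_supp (fun x => f x * w x - g x * w x).
  have := bounded_suppD bf (bounded_suppZ (-1) bg).
  by under eq_fun do rewrite mulN1r.
apply: le_trans (integ_abs bfg) _; apply: le_integ.
- exact: bounded_supp_abs.
- by apply: bounded_suppZ; exact: bounded_supp_abs.
move=> x; rewrite -mulrBl normrM; have [->|wx] := eqVneq (w x) 0.
  by rewrite normr0 !mulr0.
by rewrite ler_wpM2r// fg.
Qed.

Lemma lattice_vecD (k l : K) : kv (k + l) = kv k + kv l.
Proof. by apply/rowP => i; rewrite !mxE ffunE intrD. Qed.

Lemma lattice_vecN (k : K) : kv (- k) = - kv k.
Proof. by apply/rowP => i; rewrite !mxE ffunE intrN. Qed.

Lemma integ_indic (A : set E) : measurable A -> integ (\1_A) = fine (mu A).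
Proof.
move=> mA; rewrite /integ /Rintegral integral_indic ?setIT//.
Qed.

End trig_series.

(** * Orthogonality on a period box *)

Section period_box.
Variables (R : realType) (n : nat) (x0 : 'rV[R]_n).
Local Notation E := 'rV[R]_n.
Local Notation mu := (@lebesgue_rV R n).
Local Notation K := {ffun 'I_n -> int}.
Local Notation kv := (@lattice_vec R n).

Lemma sin_period (k : int) (t : R) : sin (t + k%:~R * (pi *+ 2)) = sin t.
Proof.
have P (m : nat) (s : R) : sin (s + m%:R * (pi *+ 2)) = sin s.
  by rewrite mulr_natl; exact: (periodicn (@sinD2pi R)).
case: k => m; first exact: P.
by rewrite NegzE -[RHS](P m.+1) rmorphN/= mulNr -[X in sin X = _]addr0 -{1}(P m.+1) addrAC subrK addr0.
Qed.

Lemma integral_cos_period (k : int) (c a : R) : k != 0 ->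
  \int[lebesgue_measure]_(t in `[a - pi, a + pi]) cos (k%:~R * t + c) = 0 :> R.
Proof.
move=> k0; have kR : (k%:~R : R) != 0 by rewrite intr_eq0.
pose F (t : R) : R := (k%:~R)^-1 * sin (k%:~R * t + c).
have dl (t : R) : is_derive t 1 (fun t : R => k%:~R * t + c) (k%:~R : R).
  have dt : is_derive t 1 (fun t : R => t) (1 : R) by exact: is_derive_id.
  have := is_deriveD (is_deriveZ k%:~R dt) (is_derive_cst c t 1).
  by move=> /is_derive_eq; apply; rewrite addr0 [_ *: _]mulr1.
have dF (t : R) : is_derive t 1 F (cos (k%:~R * t + c)).
  have := is_deriveZ (k%:~R^-1) (@is_derive1_comp R (@sin R) (fun t : R => k%:~R * t + c) t _ _ (is_derive_sin (k%:~R * t + c)) (dl t)).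
  by move=> /is_derive_eq; apply; rewrite [_ *: _]mulrCA mulVf ?mulr1.
have cF : continuous F.
  by move=> t; apply: differentiable_continuous; apply/derivable1_diffP; have [] := dF t.
have cf : continuous (fun t : R => cos (k%:~R * t + c)).
  move=> t; apply: (@continuous_comp _ _ _ (fun t : R => k%:~R * t + c) (@cos R)).
    by apply: differentiable_continuous; apply/derivable1_diffP; have [] := dl t.
  exact: continuous_cos.
rewrite /Rintegral (@continuous_FTC2 _ _ F).
- rewrite /F -EFinB -mulrBr /=.
  have -> : k%:~R * (a + pi) + c = k%:~R * (a - pi) + c + k%:~R * (pi *+ 2) :> R by ring.
  by rewrite sin_period subrr mulr0.
- by have := pi_gt0 R; lra.
- exact: continuous_subspaceT.
- split.
  + by move=> t _; have [] := dF t.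
  + by apply: cvg_at_right_filter; exact: cF.
  + by apply: cvg_at_left_filter; exact: cF.
by move=> t _; rewrite derive1E; have [_] := dF t.
Qed.

Definition period_box : set E :=
  prod_set (fun i => `[x0 ord0 i - pi, x0 ord0 i + pi]%classic).

Lemma measurable_period_box : measurable period_box.
Proof. exact: measurable_prod_set. Qed.

Lemma period_box_volume : mu period_box = ((pi *+ 2) ^+ n)%:E.
Proof.
rewrite (lebesgue_prod_set (b := fun=> pi *+ 2)) ?prodr_const ?card_ord// => i.
rewrite lebesgue_measure_itv/= lte_fin ifT; first by rewrite -EFinB; congr EFin; ring.
by have := pi_gt0 R; lra.
Qed.

Lemma bounded_supp_period_box (f : E -> R) (B : R) : measurable_fun setT f ->
  (forall x, `|f x| <= B) -> bounded_supp (fun x => \1_period_box x * f x).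
Proof.
move=> mf fB; split.
  by apply: measurable_funM => //; exact: measurable_indic measurable_period_box.
exists (`|x0| + pi + 1), B => x; split.
  by rewrite normrM; apply: le_trans (fB x); rewrite ler_piMl// indic_bound.
move=> xr; rewrite indicE memNset ?mul0r// => Qx.
have : `|x| <= `|x0| + pi.
  apply: norm_le_coord => [|i]; first by rewrite addr_ge0// pi_ge0.
  have := Qx i; rewrite /= in_itv/= -ler_distl => h.
  rewrite -[x ord0 i](subrK (x0 ord0 i)) addrC; apply: le_trans (ler_normD _ _) _.
  by apply: lerD => //; exact: coord_le_norm.
lra.
Qed.

Lemma bounded_supp_period_trig xi th :
  bounded_supp (fun x => \1_period_box x * trig xi th x).
Proof.
apply: (@bounded_supp_period_box _ 1); first exact: measurable_trig.
by move=> x; exact: trig_bound.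
Qed.

(** If [k] has a nonzero coordinate [i], the integral over a full period already vanishes on every
    line in direction [i]. *)
Lemma trig_orthogonal (k : K) (th : R) :
  integ (fun x => \1_period_box x * trig (kv k) th x) =
  if k == 0 then (pi *+ 2) ^+ n * cos th else 0.
Proof.
case: eqP => [->|/eqP k0].
  have -> : (fun x => \1_period_box x * trig (kv 0) th x) =
      fun x => cos th * \1_period_box x.
    apply/funext => x; rewrite mulrC /trig; congr (cos _ * _).
    by rewrite /dot big1 ?add0r// => i _; rewrite !mxE ffunE mulr0.
  rewrite integZ; last first.
    have := @bounded_supp_period_box (cst 1) 1 (measurable_cst _).
    by under eq_fun do rewrite mulr1; apply => x; rewrite normr1.
  rewrite [RHS]mulrC; congr (_ * _).
  have -> : integ (\1_period_box) = fine (mu period_box).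
    by apply: integ_indic; exact: measurable_period_box.
  by rewrite period_box_volume.
have [i ki] : exists i, k i != 0.
  apply: contrapT => H; move/eqP: k0; apply; apply/ffunP => i; rewrite ffunE.
  by apply/eqP; apply: contrapT => /negP ki; apply: H; exists i.
apply: (integ_slice0 (i := i)); first exact: bounded_supp_period_trig.
move=> x.
have [Qx|Qx] := pselect (forall j, j != i -> `[x0 ord0 j - pi, x0 ord0 j + pi]%classic (x ord0 j)).
  rewrite -[RHS](@integral_cos_period (k i) (dot (upd x i 0) (kv k) + th) (x0 ord0 i) ki).
  rewrite [RHS]Rintegral_mkcond; apply: eq_Rintegral => t _; rewrite patchE.
  have -> : (t \in `[x0 ord0 i - pi, x0 ord0 i + pi]%classic) = (upd x i t \in period_box).
    apply/idP/idP => /set_mem H; apply/mem_set.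
      by move=> j; rewrite updE; case: eqP => [->//|/eqP ji]; exact: Qx.
    by have := H i; rewrite updE eqxx.
  rewrite indicE; case: ifP => _; rewrite ?mul0r// mul1r /trig; congr cos.
  rewrite /dot addrA; congr (_ + _); rewrite (bigD1 i)//= [in RHS](bigD1 i)//=.
  rewrite !updE !mxE eqxx mul0r add0r mulrC; congr (_ + _); apply: eq_bigr => j ji.
  by rewrite !updE (negbTE ji).
transitivity (\int[@lebesgue_measure R]_(t in setT) (0 : R)); last first.
  by rewrite Rintegral_cst ?mul0r.
apply: eq_Rintegral => t _.
rewrite indicE memNset ?mul0r// => H; apply: Qx => j ji.
by have := H j; rewrite updE (negbTE ji).
Qed.

(** In the real family the frequencies [k] and [- k] are not independent, so two coincidences
    contribute, [k = - l] and [k = l], each with weight one half; for zero frequency both occur. *)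
Lemma trig_orthogonal2 (k l : K) (th al : R) :
  integ (fun x => \1_period_box x * (trig (kv l) th x * trig (kv k) al x)) =
  2^-1 * (pi *+ 2) ^+ n *
  ((if k == - l then cos (th + al) else 0) + (if k == l then cos (th - al) else 0)).
Proof.
have -> : (fun x => \1_period_box x * (trig (kv l) th x * trig (kv k) al x)) =
  (fun x => 2^-1 * (\1_period_box x * trig (kv (l + k)) (th + al) x +
       \1_period_box x * trig (kv (l - k)) (th - al) x)).
  by apply/funext => x; rewrite trigM lattice_vecD lattice_vecD lattice_vecN; ring.
rewrite integZ; last by apply: bounded_suppD; exact: bounded_supp_period_trig.
rewrite integD; [|exact: bounded_supp_period_trig..].
rewrite !trig_orthogonal -mulrA; congr (_ * _).
rewrite subr_eq0 addr_eq0 [l == k]eq_sym -[l == - k]eqr_opp opprK [- l == k]eq_sym mulrDr.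
by congr (_ + _); case: ifP; rewrite ?mulr0.
Qed.

End period_box.

Lemma continuous_gt_ball (R : realType) n (f : 'rV[R]_n -> R) (x : 'rV[R]_n) (c : R) :
  {for x, continuous f} -> c < f x ->
  exists2 e : R, 0 < e & ball x e `<=` [set y | c < f y].
Proof.
move=> cf cx; have /nbhs_ballP[e /= e0 eP] : nbhs x [set y | c < f y].
  exact: (@cvgr_gt _ _ (nbhs x) _ f (f x) cf).
by exists e.
Qed.

(** * Completeness of the trigonometric system *)

Section completeness.
Variables (R : realType) (n : nat) (x0 : 'rV[R]_n).
Local Notation E := 'rV[R]_n.
Local Notation mu := (@lebesgue_rV R n).
Local Notation K := {ffun 'I_n -> int}.
Local Notation kv := (@lattice_vec R n).
Local Notation Q := (period_box x0).

(* [trig_free h f] says that [h * f] is orthogonal to all trigonometric monomials on the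
   period box; it is stable under multiplication of [f] by trigonometric polynomials, so that
   if it holds for [f = 1] one may test [h] against the peak kernels
   [(c * prod_i ((1 + cos (x_i - x1_i)) / 2)) ^+ N], which concentrate at [x1]. *)
Let trig_free (h f : E -> R) := [/\ continuous f, exists B : R, forall x, `|f x| <= B &
  forall k th, integ (fun x => \1_Q x * (trig (kv k) th x * f x * h x)) = 0].

Section orthogonal.
Variables (h : E -> R) (B : R).
Hypotheses (ch : forall x : E, {for x, continuous h}) (hB : forall x : E, `|h x| <= B).

Let bsupp k th (f : E -> R) C : continuous f -> (forall x, `|f x| <= C) ->
  bounded_supp (fun x => \1_Q x * (trig (kv k) th x * f x * h x)).
Proof.
move=> cf fC; apply: (@bounded_supp_period_box _ _ _ _ (1 * C * B)).
  apply: measurable_funM; last by apply: continuous_measurable_rV => [|x _]; [exact: openT|exact: ch].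
  apply: measurable_funM; first exact: measurable_trig.
  by apply: continuous_measurable_rV => [|x _]; [exact: openT|exact: cf].
by move=> x; rewrite !normrM; apply: ler_pM; rewrite ?mulr_ge0//; apply: ler_pM; rewrite ?trig_bound.
Qed.

(** The cosine factor is itself a monomial, of frequency [d], and the product formula for [trig]
    replaces [k] by [k + d] and [k - d]. *)
Lemma trig_freeM f (x1 : E) i : trig_free h f ->
  trig_free h (fun x => (1 + cos (x ord0 i - x1 ord0 i)) * f x).
Proof.
move=> [cf [C fC] f0].
pose d : K := [ffun j => (j == i)%:Z].
have cE (x : E) : cos (x ord0 i - x1 ord0 i) = trig (kv d) (- x1 ord0 i) x.
  rewrite /trig /dot (bigD1 i)//= !mxE ffunE eqxx mulr1 big1 ?addr0// => j ji.
  by rewrite !mxE ffunE (negbTE ji) mulr0.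
split.
- have -> : (fun x : E => (1 + cos (x ord0 i - x1 ord0 i)) * f x) =
      (fun x => (1 + trig (kv d) (- x1 ord0 i) x) * f x).
    by apply/funext => x; rewrite cE.
  have ct : continuous (trig (kv d) (- x1 ord0 i)).
    by move=> x; apply: smooth_on_continuous I; apply: smooth_trig; exact: openT.
  by move=> x; exact: (cvgM (cvgD (cvg_cst (1 : R)) (ct x)) (cf x)).
- exists (2 * C) => x; rewrite normrM; apply: ler_pM => //.
  by apply: le_trans (ler_normD _ _) _; rewrite normr1 lerD2l cE trig_bound.
move=> k th.
have -> : (fun x => \1_Q x * (trig (kv k) th x * ((1 + cos (x ord0 i - x1 ord0 i)) * f x) * h x)) =
   fun x => \1_Q x * (trig (kv k) th x * f x * h x) + 2^-1 *
     (\1_Q x * (trig (kv (k + d)) (th - x1 ord0 i) x * f x * h x) +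
      \1_Q x * (trig (kv (k - d)) (th + x1 ord0 i) x * f x * h x)).
  apply/funext => x; rewrite cE.
  have := trigM (kv k) th (kv d) (- x1 ord0 i) x.
  rewrite !lattice_vecD lattice_vecN opprK => H.
  transitivity (\1_Q x * (trig (kv k) th x * f x * h x) +
     \1_Q x * ((trig (kv k) th x * trig (kv d) (- x1 ord0 i) x) * f x * h x)); first by ring.
  by rewrite H; ring.
rewrite integD; last 2 first.
- exact: bsupp fC.
- by apply: bounded_suppZ; apply: bounded_suppD; exact: bsupp fC.
rewrite f0 add0r integZ; last by apply: bounded_suppD; exact: bsupp fC.
by rewrite integD ?f0 ?addr0 ?mulr0//; exact: bsupp fC.
Qed.

Lemma trig_freeZ f c : trig_free h f -> trig_free h (fun x => c * f x).
Proof.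
move=> [cf [C fC] f0]; split.
- by move=> x; exact: (cvgM (cvg_cst (c : R)) (cf x)).
- by exists (`|c| * C) => x; rewrite normrM ler_wpM2l.
move=> k th.
have -> : (fun x => \1_Q x * (trig (kv k) th x * (c * f x) * h x)) =
   fun x => c * (\1_Q x * (trig (kv k) th x * f x * h x)) by apply/funext => x; ring.
by rewrite integZ ?f0 ?mulr0//; exact: bsupp fC.
Qed.

Lemma trig_free_peak (x1 : E) (c : R) N : trig_free h (fun=> 1) ->
  trig_free h (fun x => (c * \prod_(i < n) ((1 + cos (x ord0 i - x1 ord0 i)) / 2)) ^+ N).
Proof.
move=> h1; elim: N => [//|N IH].
have P (s : seq 'I_n) f : trig_free h f ->
    trig_free h (fun x => \prod_(i <- s) ((1 + cos (x ord0 i - x1 ord0 i)) / 2) * f x).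
  move=> hf; elim: s => [|i s IHs].
    by under eq_fun do rewrite big_nil mul1r.
  have := trig_freeZ 2^-1 (trig_freeM x1 i IHs); congr trig_free.
  by apply/funext => x; rewrite big_cons; ring.
have := trig_freeZ c (P (index_enum 'I_n) _ IH); congr trig_free.
by apply/funext => x; rewrite exprS; ring.
Qed.

Lemma bernoulli_le (a : R) N : 0 <= a -> 1 + N%:R * a <= (1 + a) ^+ N.
Proof.
move=> a0; elim: N => [|N IH]; first by rewrite mul0r addr0 expr0.
rewrite exprS -natr1; apply: (@le_trans _ _ ((1 + a) * (1 + N%:R * a))); last first.
  by rewrite ler_wpM2l// addr_ge0.
have : 0 <= a * (N%:R * a) by rewrite !mulr_ge0.
lra.
Qed.

(** The cosine decreases up to [pi], and from [pi] to [3 * pi / 2] it is nonpositive, hence below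
    [cos r]. The limit [3 * (pi / 2)] is the largest coordinate distance between a point of the
    period box and one within [pi / 2] of its centre. *)
Lemma cos_le_far (r t : R) : 0 < r -> r <= pi / 2 -> r <= `|t| -> `|t| <= 3 * (pi / 2) ->
  cos t <= cos r.
Proof.
have p0 := pi_gt0 R.
rewrite -(cos_norm t); move: `|t| => s r0 rp rs s3.
have [sp|sp] := leP s pi.
  have [->//|rs'] := eqVneq r s.
  have rs2 : r < s by rewrite lt_neqAle rs'.
  apply: ltW; rewrite ltr_cos ?in_itv//=; apply/andP; split; lra.
have c0 : 0 <= cos r by apply: cos_ge0_pihalf; apply/andP; split; lra.
apply: le_trans c0.
have -> : s = s - pi + pi by ring.
rewrite cosDpi oppr_le0; apply: cos_ge0_pihalf; apply/andP; split; lra.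
Qed.

(** Suppose [h x1 > 0]. Near [x1] the kernel [q ^+ N] is at least [(1 + a) ^+ N]; wherever [h] might
    be negative, [q] is at most 1. The vanishing integral of [q ^+ N * h] then bounds a growing
    quantity by a constant, against Bernoulli's inequality. *)
Lemma trig_free_le0 (x1 : E) : trig_free h (fun=> 1) -> ball x0 (pi / 2) x1 -> h x1 <= 0.
Proof.
have p0 := pi_gt0 R; have ph : 0 < pi / 2 :> R by lra.
move=> h1 /(ballP_coord _ _ ph) bx1; rewrite leNgt; apply/negP => hx1.
pose eta := h x1 / 2; have eta0 : 0 < eta by rewrite /eta; lra.
have B0 : 0 <= B by exact: le_trans (hB x1).
have [r [r0 rp rh]] : exists r : R, [/\ 0 < r, r <= pi / 2 & ball x1 r `<=` [set x | eta < h x]].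
  have [e e0 eh] : exists2 e : R, 0 < e & ball x1 e `<=` [set x | eta < h x].
    have ec : eta < h x1 by rewrite /eta; lra.
    exact: (continuous_gt_ball (@ch x1)).
  exists (Num.min e (pi / 2)); split; rewrite ?lt_min ?e0 ?ge_min ?lexx ?orbT//.
  by apply: subset_trans eh; apply: le_ball; rewrite ge_min lexx.
(* The bound for one factor of the kernel once that coordinate is at distance at least [r] from
   [x1]. *)
pose rho : R := (1 + cos r) / 2.
have rho1 : rho < 1.
  have : cos r < 1 by rewrite -cos0 ltr_cos ?in_itv//=; apply/andP; split; lra.
  by rewrite /rho; lra.
have rho0 : 0 <= rho by rewrite /rho; have := cos_geN1 r; lra.
pose w (x : E) i : R := (1 + cos (x ord0 i - x1 ord0 i)) / 2.
have w01 x i : 0 <= w x i <= 1.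
  have := cos_geN1 (x ord0 i - x1 ord0 i); have := cos_le1 (x ord0 i - x1 ord0 i).
  by rewrite /w => *; apply/andP; split; lra.
(* The normalisation [2 - rho] exceeds 1, so that [q] is large at [x1], while [(2 - rho) * rho <= 1]
   keeps [q] at most 1 far from [x1]. With [a] below, [q x1 = 1 + 2 * a], leaving room for [1 + a]
   on a neighbourhood. *)
pose q (x : E) : R := (2 - rho) * \prod_i w x i.
have q0 x : 0 <= q x.
  by rewrite mulr_ge0 ?prodr_ge0//; [lra|move=> i _; have /andP[] := w01 x i].
have qx1 : q x1 = 2 - rho.
  rewrite /q big1 ?mulr1// => i _; rewrite /w subrr cos0; lra.
have PN N := @trig_free_peak x1 (2 - rho) N h1.
have cq : continuous q by have [] := PN 1%N.
pose a := (1 - rho) / 2; have a0 : 0 < a by rewrite /a; lra.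
have [r' [r'0 r'r r'q]] : exists r' : R, [/\ 0 < r', r' <= r & ball x1 r' `<=` [set x | 1 + a < q x]].
  have [e e0 eh] : exists2 e : R, 0 < e & ball x1 e `<=` [set x | 1 + a < q x].
    by apply: (continuous_gt_ball (cq x1)); rewrite qx1 /a; lra.
  exists (Num.min e r); split; rewrite ?lt_min ?e0 ?ge_min ?lexx ?orbT//.
  by apply: subset_trans eh; apply: le_ball; rewrite ge_min lexx.
have Qball x : ball x1 r' x -> Q x.
  move=> /(ballP_coord _ _ r'0) H i /=; rewrite in_itv/= -ler_distl.
  have := H i; have := bx1 i; rewrite !ltr_norml ler_norml => /andP[h2 h3] /andP[h4 h5].
  apply/andP; split; lra.
have qfar x : Q x -> ~ ball x1 r x -> q x <= 1.
  move=> Qx /(ballP_coord _ _ r0)/existsNP[i /negP]; rewrite -leNgt => ri.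
  have wi : w x i <= rho.
    rewrite /w /rho ler_pM2r ?invr_gt0// lerD2l; apply: cos_le_far r0 rp _ _.
      by rewrite distrC.
    have := Qx i; rewrite /= in_itv/= -ler_distl => h2.
    have := bx1 i => h3; rewrite distrC in h3.
    have := ler_distD (x0 ord0 i) (x ord0 i) (x1 ord0 i).
    rewrite [`|x0 ord0 i - x1 ord0 i|]distrC; lra.
  apply: (@le_trans _ _ ((2 - rho) * rho)); last by nra.
  rewrite ler_wpM2l//; first by lra.
  rewrite (bigD1 i)//= -[leRHS]mulr1; apply: ler_pM => //.
  - by have /andP[] := w01 x i.
  - by apply: prodr_ge0 => j _; have /andP[] := w01 x j.
  - have H : \prod_(j < n | j != i) w x j <= \prod_(j < n | j != i) (1 : R).
      by apply: ler_prod => j _; exact: w01.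
    by apply: le_trans H _; rewrite big1.
have mb : measurable (ball x1 r') by exact: measurable_coord_ball.
have bbl : bounded_supp (\1_(ball x1 r') : E -> R).
  have := @bounded_supp_period_box _ _ x0 (\1_(ball x1 r') : E -> R) 1 (measurable_indic_rV mb)
     (indic_bound _).
  congr bounded_supp; apply/funext => x; rewrite !indicE.
  have [bx|bx] := pselect (ball x1 r' x); last by rewrite (memNset bx) mulr0.
  by rewrite (mem_set bx) (mem_set (Qball _ bx)) mulr1.
have bQ : bounded_supp (\1_Q : E -> R).
  have := @bounded_supp_period_box _ _ x0 (cst 1) 1 (measurable_cst _).
  by under eq_fun do rewrite mulr1; apply => x; rewrite normr1.
have V0 : 0 < (2 * r') ^+ n by rewrite exprn_gt0// mulr_gt0.
have main N : eta * (1 + a) ^+ N * (2 * r') ^+ n <= B * (pi *+ 2) ^+ n.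
  have [cf [C fC] /(_ 0 0) f0] := PN N.
  rewrite -subr_le0 -[X in _ <= X]f0.
  have -> : eta * (1 + a) ^+ N * (2 * r') ^+ n - B * (pi *+ 2) ^+ n =
     integ (fun x => eta * (1 + a) ^+ N * \1_(ball x1 r') x - B * \1_Q x).
    rewrite integB; [|exact: bounded_suppZ..].
    rewrite !integZ// !integ_indic//; last exact: measurable_period_box.
    by rewrite lebesgue_ball// period_box_volume.
  apply: le_integ.
  - have := bounded_suppD (bounded_suppZ (eta * (1 + a) ^+ N) bbl) (bounded_suppZ (- B) bQ).
    by under eq_fun do rewrite mulNr.
  - exact: bsupp fC.
  move=> x; rewrite -/(q x).
  have -> : trig (kv 0) 0 x = 1.
    by rewrite /trig /dot big1 ?addr0 ?cos0// => i _; rewrite !mxE ffunE mulr0.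
  rewrite mul1r !indicE.
  have [bx|bx] := pselect (ball x1 r' x).
    rewrite (mem_set bx) (mem_set (Qball _ bx)) !mulr1 mul1r.
    apply: (@le_trans _ _ (eta * (1 + a) ^+ N)); first by rewrite lerBlDr lerDl.
    rewrite mulrC; apply: ler_pM; rewrite ?exprn_ge0//; [lra|exact: ltW| |].
      by apply: lerXn2r; rewrite ?nnegrE//; [lra|apply/ltW/r'q].
    by apply: ltW; apply: rh; exact: le_ball bx.
  rewrite (memNset bx) mulr0 sub0r; have [Qx|Qx] := pselect (Q x); last first.
    by rewrite (memNset Qx) mulr0 mul0r oppr0.
  rewrite (mem_set Qx) mulr1 mul1r.
  have [brx|brx] := pselect (ball x1 r x).
    apply: (@le_trans _ _ 0); first by rewrite oppr_le0.
    by rewrite mulr_ge0 ?exprn_ge0// ltW// (lt_trans eta0)//; exact: rh.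
  have : `|q x ^+ N * h x| <= B.
    rewrite normrM -[leRHS]mul1r; apply: ler_pM => //.
    by rewrite ger0_norm ?exprn_ge0// exprn_ile1// qfar.
  by rewrite ler_norml => /andP[].
have : a * (eta * (2 * r') ^+ n) <= 0.
  apply: (@le_archi _ _ _ (B * (pi *+ 2) ^+ n)) => N.
  rewrite add0r ler_pdivlMr ?ltr0n//; apply: le_trans (main N.+1).
  have H : N.+1%:R * a <= (1 + a) ^+ N.+1.
    by apply: le_trans (bernoulli_le N.+1 (ltW a0)); rewrite lerDr.
  have eV : 0 <= eta * (2 * r') ^+ n by rewrite mulr_ge0 ?ltW.
  have := ler_wpM2l eV H; move: (N.+1%:R : R) ((1 + a) ^+ N.+1) ((2 * r') ^+ n) => m X V.
  have -> : eta * V * (m * a) = a * (eta * V) * m by ring.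
  by have -> : eta * V * X = eta * X * V by ring.
by apply/negP; rewrite -ltNge; exact: mulr_gt0 a0 (mulr_gt0 eta0 V0).
Qed.

End orthogonal.

(** Coefficients of the real part of the exponential series. The series runs over both [k] and
    [- k], so no factor 2 appears in the normalisation. *)
Definition fourier_cos (v : E -> R) (k : K) : R :=
  ((pi *+ 2) ^+ n)^-1 * fint v (kv k) 0.
Definition fourier_sin (v : E -> R) (k : K) : R :=
  ((pi *+ 2) ^+ n)^-1 * fint v (kv k) (- (pi / 2)).

Lemma rapid_fourier (v : E -> R) : rapid_on setT v ->
  rapid_seq (fourier_cos v) /\ rapid_seq (fourier_sin v).
Proof.
have V0 : 0 <= ((pi *+ 2 : R) ^+ n)^-1.
  by rewrite invr_ge0 exprn_ge0// mulrn_wge0// pi_ge0.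
move=> rv; split=> m; have [B HB] := rv m; exists (((pi *+ 2) ^+ n)^-1 * B) => k.
all: by rewrite normrM (ger0_norm V0) -mulrA ler_wpM2l// HB.
Qed.

Lemma fint_cos_sin (v : E -> R) xi th : bounded_supp v ->
  fint v xi th = cos th * fint v xi 0 - sin th * fint v xi (- (pi / 2)).
Proof.
move=> bv; rewrite -!integZ; [|exact: bounded_supp_trig..].
rewrite -integB; [|by apply: bounded_suppZ; exact: bounded_supp_trig..].
congr integ; apply/funext => x; rewrite /trig addr0 cosBpihalf cosD; ring.
Qed.

(** By orthogonality only [k = l] and [k = - l] survive; each gives one half of the integral,
    because the cosine coefficients are even in [k] and the sine coefficients odd. *)
Lemma integ_trig_series (v : E -> R) (l : K) th N : bounded_supp v ->
  l \in lattice_box n N ->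
  integ (fun x => \1_Q x * (trig (kv l) th x * trig_series (fourier_cos v) (fourier_sin v) N x)) =
  fint v (kv l) th.
Proof.
move=> bv lN.
have V0 : ((pi *+ 2 : R) ^+ n) != 0.
  by rewrite expf_neq0// mulrn_eq0/= gt_eqF// pi_gt0.
have bt k al : bounded_supp (fun x : E => \1_Q x * (trig (kv l) th x * trig (kv k) al x)).
  apply: (@bounded_supp_period_box _ _ _ _ (1 * 1)).
    by apply: measurable_funM; exact: measurable_trig.
  by move=> x; rewrite normrM; apply: ler_pM => //; exact: trig_bound.
have -> : (fun x => \1_Q x * (trig (kv l) th x *
     trig_series (fourier_cos v) (fourier_sin v) N x)) =
   fun x => \sum_(k <- lattice_box n N)
     (fourier_cos v k * (\1_Q x * (trig (kv l) th x * trig (kv k) 0 x)) +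
      fourier_sin v k * (\1_Q x * (trig (kv l) th x * trig (kv k) (- (pi / 2)) x))).
  by apply/funext => x; rewrite /trig_series !mulr_sumr; apply: eq_bigr => k _; ring.
rewrite integ_sum; last by move=> k _; apply: bounded_suppD; exact: bounded_suppZ.
have lN' : - l \in lattice_box n N.
  move: lN; rewrite !mem_lattice_box => /forallP H; apply/forallP => i.
  by rewrite ffunE abszN.
have pick (F : K -> R) (m : K) : m \in lattice_box n N ->
    \sum_(k <- lattice_box n N) (if k == m then F k else 0) = F m.
  move=> mN; rewrite (bigD1_seq m)//= ?lattice_box_uniq// eqxx big1 ?addr0// => k km.
  by rewrite (negbTE km).
transitivity (\sum_(k <- lattice_box n N)
   ((if k == - l then 2^-1 * (pi *+ 2) ^+ n * (fourier_cos v k * cos th + fourier_sin v k * sin th) else 0) +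
    (if k == l then 2^-1 * (pi *+ 2) ^+ n * (fourier_cos v k * cos th - fourier_sin v k * sin th) else 0))).
  apply: eq_bigr => k _; rewrite integD; [|exact: bounded_suppZ..].
  rewrite !integZ// !trig_orthogonal2 subr0 addr0 opprK cosBpihalf cosDpihalf.
  by case: ifP => _; case: ifP => _; ring.
rewrite big_split/= !pick// /fourier_cos /fourier_sin lattice_vecN !fintN oppr0 opprK.
rewrite (fint_cos_sin _ th bv) (fint_cos_sin _ (pi / 2) bv) cos_pihalf sin_pihalf.
by field; move: V0; rewrite mulr2n.
Qed.

Lemma ball_supp_norm (chi : E -> R) (r : R) : (forall x, ~ ball x0 r x -> chi x = 0) ->
  forall x, `|x0| + r <= `|x| -> chi x = 0.
Proof.
move=> c0 x xr; apply: c0; rewrite -ball_normE /= => bx.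
have := ler_normD (x - x0) x0; rewrite subrK distrC; lra.
Qed.

Lemma trig_series_bound (a b : K -> R) N : exists B : R, forall x : E,
  `|trig_series a b N x| <= B.
Proof.
exists (\sum_(k <- lattice_box n N) (`|a k| + `|b k|)) => x.
apply: le_trans (ler_norm_sum _ _ _) _; apply: ler_sum => k _.
apply: le_trans (ler_normD _ _) _; rewrite !normrM.
by apply: lerD; rewrite -[leRHS]mulr1 ler_wpM2l// trig_bound.
Qed.

Lemma trig_series_limit_bound (a b : K -> R) (g : E -> R) (C : R) :
  (forall N x, `|trig_series a b N x - g x| <= C / N.+1%:R) ->
  exists B : R, forall x, `|g x| <= B.
Proof.
move=> gC; have [B HB] := trig_series_bound a b 0%N; exists (B + C) => x.
have -> : g x = trig_series a b 0%N x - (trig_series a b 0%N x - g x) by ring.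
by apply: le_trans (ler_normB _ _) _; apply: lerD => //; have := gC 0%N x; rewrite divr1.
Qed.

(** The difference [h = g - chi] is orthogonal to every monomial on the period box, since partial
    sums have the right coefficients and converge uniformly. Applying [trig_free_le0] to [h] and to
    [- h] gives equality. *)
Lemma fourier_series_complete (chi g : E -> R) (C : R) : smooth_on setT chi ->
  (forall x, ~ ball x0 (pi / 2) x -> chi x = 0) -> smooth_on setT g ->
  (forall N x, `|trig_series (fourier_cos chi) (fourier_sin chi) N x - g x| <= C / N.+1%:R) ->
  forall x, ball x0 (pi / 2) x -> g x = chi x.
Proof.
move=> sc c0 sg gC.
have cc : continuous chi by move=> x; exact: smooth_on_continuous sc I.
have cg : continuous g by move=> x; exact: smooth_on_continuous sg I.
have bc : bounded_supp chi by exact: continuous_bounded_supp cc (ball_supp_norm c0).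
have [_ [r0 [B1 HB1]]] := bc.
have [B2 HB2] := trig_series_limit_bound gC.
have C0 : 0 <= C by have := gC 0%N x0; rewrite divr1; exact: le_trans.
pose h x := g x - chi x.
have ch : forall x : E, {for x, continuous h} by move=> x; exact: cvgB (cg x) (cc x).
have hB x : `|h x| <= B2 + B1.
  by apply: le_trans (ler_normB _ _) _; apply: lerD => //; have [] := HB1 x.
have p0 := pi_gt0 R.
have h1 : trig_free h (fun=> 1).
  split; [exact: cst_continuous|by exists 1 => x; rewrite normr1|move=> k th].
  have bt : bounded_supp (fun x => \1_Q x * trig (kv k) th x).
    exact: bounded_supp_period_trig.
  have mg : measurable_fun setT g by exact: smooth_measurable.
  have mc : measurable_fun setT chi by exact: smooth_measurable.
  have bg : bounded_supp (fun x => g x * (\1_Q x * trig (kv k) th x)).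
    by apply: bounded_suppM => //; exists B2.
  have bchi : bounded_supp (fun x => trig (kv k) th x * chi x) by exact: bounded_supp_trig.
  have -> : (fun x => \1_Q x * (trig (kv k) th x * 1 * h x)) =
      fun x => g x * (\1_Q x * trig (kv k) th x) - trig (kv k) th x * chi x.
    apply/funext => x; rewrite mulr1 /h mulrBr mulrBr; congr (_ - _); first by ring.
    rewrite indicE; have [bx|bx] := pselect (ball x0 (pi / 2) x); last by rewrite c0// !mulr0.
    rewrite mem_set ?mul1r// => i /=; rewrite in_itv/= -ler_distl.
    move/(ballP_coord _ _ (divr_gt0 p0 (ltr0n _ 2))) : bx => /(_ i).
    rewrite distrC; lra.
  rewrite integB// -[X in _ - X]/(fint chi (kv k) th).
  have [N0 kN0] : exists N0, k \in lattice_box n N0.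
    exists (\sum_i `|k i|)%N; rewrite mem_lattice_box; apply/forallP => i.
    by rewrite (bigD1 i)//= leq_addr.
  apply/eqP; rewrite -normr_le0; apply/ (@le_archi _ _ _
    (C * integ (fun x => `|\1_Q x * trig (kv k) th x|))) => N.
  (* The maximum makes the box contain [k] and still gives the error [C / N.+1]. *)
  have kN : k \in lattice_box n (maxn N N0) by apply: lattice_box_sub kN0; exact: leq_maxr.
  rewrite -(integ_trig_series th bc kN) distrC add0r.
  have -> : (fun x => \1_Q x * (trig (kv k) th x *
        trig_series (fourier_cos chi) (fourier_sin chi) (maxn N N0) x)) =
     fun x => trig_series (fourier_cos chi) (fourier_sin chi) (maxn N N0) x *
        (\1_Q x * trig (kv k) th x) by apply/funext => x; ring.
  have [B3 HB3] := trig_series_bound (fourier_cos chi) (fourier_sin chi) (maxn N N0).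
  have mS : measurable_fun setT (trig_series (fourier_cos chi) (fourier_sin chi) (maxn N N0) : E -> R).
    by apply: smooth_measurable; exact: smooth_trig_series.
  rewrite mulrAC.
  apply: (@integ_close _ _ _ _ _ _ (Num.max B2 B3) bt mS mg).
  - by move=> x; rewrite le_max HB3 orbT.
  - by move=> x; rewrite le_max HB2.
  move=> x _; apply: le_trans (gC _ _) _; rewrite ler_wpM2l// lef_pV2 ?posrE ?ltr0n// ler_nat ltnS.
  exact: leq_maxl.
have hN : trig_free (fun x => - h x) (fun=> 1).
  have [h2 h3 h4] := h1; split => // k th.
  have -> : (fun x => \1_Q x * (trig (kv k) th x * 1 * - h x)) =
     fun x => -1 * (\1_Q x * (trig (kv k) th x * 1 * h x)) by apply/funext => x; ring.
  rewrite integZ ?h4 ?mulr0//.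
  apply: (@bounded_supp_period_box _ _ _ _ (1 * 1 * (B2 + B1))).
    apply: measurable_funM; last by apply: continuous_measurable_rV => [|x _]; [exact: openT|exact: ch].
    by apply: measurable_funM => //; exact: measurable_trig.
  move=> x; rewrite !normrM; apply: ler_pM; rewrite ?mulr_ge0//.
  by apply: ler_pM; rewrite ?trig_bound ?normr1.
move=> x bx; have H1 := trig_free_le0 ch hB h1 bx.
have H2 : - h x <= 0.
  apply: (trig_free_le0 _ _ hN bx) => y; last by rewrite normrN; exact: hB.
  exact: cvgN (ch y).
by apply/eqP; rewrite -subr_eq0 -/(h x); apply/eqP; lra.
Qed.

End completeness.

(** * Rapid decay in every direction implies smoothness *)

Section elliptic.
Variables (R : realType) (n : nat) (x0 : 'rV[R]_n).
Local Notation E := 'rV[R]_n.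
Local Notation mu := (@lebesgue_rV R n).
Local Notation K := {ffun 'I_n -> int}.
Local Notation kv := (@lattice_vec R n).
Local Notation B0 := (ball x0 (pi / 2) : set E).

Lemma integ_trig_series_mul (a b : K -> R) (v : E -> R) N : bounded_supp v ->
  integ (fun x => trig_series a b N x * v x) =
  \sum_(k <- lattice_box n N) (a k * fint v (kv k) 0 + b k * fint v (kv k) (- (pi / 2))).
Proof.
move=> bv.
have -> : (fun x => trig_series a b N x * v x) = fun x => \sum_(k <- lattice_box n N)
   (a k * (trig (kv k) 0 x * v x) + b k * (trig (kv k) (- (pi / 2)) x * v x)).
  by apply/funext => x; rewrite mulr_suml; apply: eq_bigr => k _; ring.
rewrite integ_sum; last first.
  by move=> k _; apply: bounded_suppD; apply: bounded_suppZ; exact: bounded_supp_trig.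
apply: eq_bigr => k _; rewrite integD; [|by apply: bounded_suppZ; exact: bounded_supp_trig..].
by rewrite !integZ//; exact: bounded_supp_trig.
Qed.

Lemma smooth_fourier (chi : E -> R) : smooth_on setT chi ->
  (forall x, ~ B0 x -> chi x = 0) ->
  [/\ bounded_supp chi, rapid_seq (fourier_cos chi), rapid_seq (fourier_sin chi) &
   exists C, forall N x, B0 x ->
     `|trig_series (fourier_cos chi) (fourier_sin chi) N x - chi x| <= C / N.+1%:R].
Proof.
move=> sc c0.
have cc : continuous chi by move=> x; exact: smooth_on_continuous sc I.
have bc : bounded_supp chi by exact: continuous_bounded_supp cc (ball_supp_norm c0).
have [ra rb] := rapid_fourier (smooth_rapid sc (ball_supp_norm c0)).
have [g sg [C gC]] := trig_series_limit ra rb.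
split => //; exists C => N x bx.
by rewrite -(fourier_series_complete sc c0 sg gC bx).
Qed.

(** A Peetre-type inequality: moving the weight from [eta] to [xi] costs a power of
    [1 + |eta - xi|]. If [eta] is close to [xi], the decay in [G] applies and
    [1 + |xi| <= 2 * (1 + |eta|)]; otherwise [|xi|] itself is at most [|eta - xi| / d] and the
    trivial bound [A] is enough. *)
Lemma fint_shift (v : E -> R) (G : set E) (xi : E) (d A B : R) (m : nat) :
  0 < d -> d <= 2^-1 -> 0 <= A ->
  (forall eta th, `|fint v eta th| <= A) ->
  (forall eta th, G eta -> `|fint v eta th| * (1 + `|eta|) ^+ m <= B) ->
  (forall eta, `|eta - xi| <= d * `|xi| -> G eta) ->
  forall eta th, `|fint v eta th| * (1 + `|xi|) ^+ m <=
    (2 ^+ m * `|B| + A * d^-1 ^+ m) * (1 + `|eta - xi|) ^+ m.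
Proof.
move=> d0 d2 A0 vA vB GG eta th.
have p1 : 1 <= 1 + `|eta - xi| by rewrite lerDl.
have [near|far] := leP (`|eta - xi|) (d * `|xi|).
  have xE : 1 + `|xi| <= 2 * (1 + `|eta|).
    have := ler_normD (xi - eta) eta; rewrite subrK distrC.
    have := ler_wpM2r (normr_ge0 xi) d2; lra.
  apply: (@le_trans _ _ (`|fint v eta th| * (2 * (1 + `|eta|)) ^+ m)).
    by rewrite ler_wpM2l// lerXn2r// nnegrE ?mulr_ge0// addr_ge0.
  rewrite exprMn mulrCA; apply: (@le_trans _ _ (2 ^+ m * `|B|)).
    by rewrite ler_wpM2l ?exprn_ge0//; apply: le_trans (vB _ _ (GG _ near)) (ler_norm _).
  apply: (@le_trans _ _ (2 ^+ m * `|B| + A * d^-1 ^+ m)).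
    by rewrite lerDl mulr_ge0// exprn_ge0// invr_ge0 ltW.
  rewrite ler_peMr ?exprn_ege1// addr_ge0// mulr_ge0// exprn_ge0// invr_ge0 ltW//.
have xE : 1 + `|xi| <= d^-1 * (1 + `|eta - xi|).
  rewrite ler_pdivlMl//; lra.
apply: (@le_trans _ _ (A * (d^-1 * (1 + `|eta - xi|)) ^+ m)).
  apply: ler_pM => //; rewrite lerXn2r// nnegrE ?mulr_ge0// ?invr_ge0 ?addr_ge0//; exact: ltW.
rewrite exprMn mulrA ler_wpM2r ?exprn_ge0 ?addr_ge0// lerDr.
by rewrite mulr_ge0// exprn_ge0.
Qed.

(* The Fourier integrals of [chi * v] are a lattice sum of those of [v], translated by the
   frequencies of [chi]: frequencies small compared to [xi] keep the translate in [G], and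
   the others are damped by the decay of the coefficients of [chi]. *)
Lemma rapid_mul (v chi : E -> R) (G G' : set E) (d : R) : bounded_supp v ->
  (forall x, ~ B0 x -> v x = 0) -> smooth_on setT chi ->
  (forall x, ~ B0 x -> chi x = 0) -> 0 < d -> d <= 2^-1 ->
  (forall xi eta, G' xi -> `|eta - xi| <= d * `|xi| -> G eta) ->
  rapid_on G v -> rapid_on G' (fun x => chi x * v x).
Proof.
move=> bv v0 sc c0 d0 d2 GG' rv m.
have [bc ra rb [C HC]] := smooth_fourier sc c0.
have [B HB] := rv m.
pose A := integ (fun x => `|v x|).
have vA := fint_bound bv; have A0 : 0 <= A := le_trans (normr_ge0 _) (vA 0 0).
pose D := 2 ^+ m * `|B| + A * d^-1 ^+ m.
have D0 : 0 <= D.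
  by rewrite addr_ge0 ?mulr_ge0 ?exprn_ge0// invr_ge0 ltW.
have [Ca HCa] := ra (m + n.*2)%N; have [Cb HCb] := rb (m + n.*2)%N.
exists ((D * (Ca + Cb)) * 4 ^+ n) => xi th Gxi.
pose S N := integ (fun x => trig_series (fourier_cos chi) (fourier_sin chi) N x * (trig xi th x * v x)).
have bt : bounded_supp (fun x => trig xi th x * v x) by exact: bounded_supp_trig.
have SB N : `|S N| * (1 + `|xi|) ^+ m <= (D * (Ca + Cb)) * 4 ^+ n.
  have p0 : 0 <= (1 + `|xi|) ^+ m by rewrite exprn_ge0// addr_ge0.
  rewrite /S integ_trig_series_mul// -{1}(ger0_norm p0) -normrM mulr_suml.
  apply: le_trans (ler_norm_sum _ _ _) _.
  apply: lattice_sum_bound => k.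
  have q0 : 0 <= (1 + `|kv k|) by rewrite addr_ge0.
  (* The product formula produces the frequencies [k + xi] and [k - xi]; the second is minus
     [- k + xi], and both [k + xi] and [- k + xi] are at distance [|k|] from [xi]. *)
  have T (be : R) : `|fint (fun x => trig xi th x * v x) (kv k) be| * (1 + `|xi|) ^+ m <=
      D * (1 + `|kv k|) ^+ m.
    rewrite fint_trig// normrM ger0_norm ?invr_ge0//.
    have e1 := fint_shift d0 d2 A0 vA HB (fun eta => GG' xi eta Gxi) (kv k + xi) (be + th).
    have e2 := fint_shift d0 d2 A0 vA HB (fun eta => GG' xi eta Gxi) (- kv k + xi) (- (be - th)).
    rewrite addrK in e1; rewrite addrK normrN in e2.
    have -> : kv k - xi = - (- kv k + xi) by rewrite opprD opprK.
    rewrite fintN -/D in e1 e2 *.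
    have := ler_normD (fint v (kv k + xi) (be + th)) (fint v (- kv k + xi) (- (be - th))).
    move=> /(ler_wpM2r p0); move: e1 e2; rewrite -/D.
    move: (D * (1 + `|kv k|) ^+ m) ((1 + `|xi|) ^+ m) => X s; lra.
  rewrite normrM (ger0_norm p0).
  apply: (@le_trans _ _ ((`|fourier_cos chi k| + `|fourier_sin chi k|) * (D * (1 + `|kv k|) ^+ m) *
      (1 + `|kv k|) ^+ n.*2)).
    rewrite ler_wpM2r ?exprn_ge0//; apply: (@le_trans _ _ ((`|fourier_cos chi k| *
      `|fint (fun x => trig xi th x * v x) (kv k) 0| + `|fourier_sin chi k| *
      `|fint (fun x => trig xi th x * v x) (kv k) (- (pi / 2))|) * (1 + `|xi|) ^+ m)).
      rewrite ler_wpM2r//; apply: le_trans (ler_normD _ _) _; by rewrite !normrM.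
    by rewrite [leRHS]mulrDl [leLHS]mulrDl -!mulrA; apply: lerD; rewrite ler_wpM2l// T.
  have -> : (`|fourier_cos chi k| + `|fourier_sin chi k|) * (D * (1 + `|kv k|) ^+ m) *
      (1 + `|kv k|) ^+ n.*2 = D * (`|fourier_cos chi k| * (1 + `|kv k|) ^+ (m + n.*2) +
       `|fourier_sin chi k| * (1 + `|kv k|) ^+ (m + n.*2)).
    by rewrite exprD; move: ((1 + `|kv k|) ^+ m) ((1 + `|kv k|) ^+ n.*2) => x y; ring.
  by rewrite ler_wpM2l// lerD.
(* The bound on [S N] is uniform in [N], so it passes to the limit at fixed [xi]. *)
apply: (@le_archi _ _ _ (C * integ (fun x => `|trig xi th x * v x|) * (1 + `|xi|) ^+ m)) => N.
have [_ [r1 [B1 HB1]]] := bc.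
have [B3 HB3] := trig_series_bound (fourier_cos chi) (fourier_sin chi) N.
have close : `|S N - fint (fun x => chi x * v x) xi th| <=
    C / N.+1%:R * integ (fun x => `|trig xi th x * v x|).
  have -> : fint (fun x => chi x * v x) xi th = integ (fun x => chi x * (trig xi th x * v x)).
    by congr integ; apply/funext => x; ring.
  apply: (@integ_close _ _ _ _ _ _ (Num.max B1 B3) bt).
  - by apply: smooth_measurable; exact: smooth_trig_series.
  - exact: smooth_measurable.
  - by move=> x; rewrite le_max HB3 orbT.
  - by move=> x; rewrite le_max; have [-> _] := HB1 x.
  move=> x; rewrite mulf_eq0 negb_or => /andP[_ vx]; apply: HC.
  by apply: contrapT => /v0 vx0; rewrite vx0 eqxx in vx.
have : `|fint (fun x => chi x * v x) xi th| <= `|S N| +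
    C / N.+1%:R * integ (fun x => `|trig xi th x * v x|).
  have -> : fint (fun x => chi x * v x) xi th = S N - (S N - fint (fun x => chi x * v x) xi th).
    by ring.
  by apply: le_trans (ler_normB _ _) _; rewrite lerD2l.
have p0 : 0 <= (1 + `|xi|) ^+ m by rewrite exprn_ge0// addr_ge0.
move=> /(ler_wpM2r p0) /le_trans; apply; rewrite mulrDl; apply: lerD; first exact: SB.
move: (N.+1%:R^-1 : R) => iN; rewrite le_eqVlt; apply/orP; left; apply/eqP; ring.
Qed.

(** The series of [w] has a smooth sum [g], but [w] is only measurable, so [g = w] is obtained by
    duality: the partial sums of [w] paired with a test function equal the partial sums of the test
    function paired with [w], and the latter converge because the test function is smooth. *)
Lemma smooth_of_rapid (w : E -> R) : bounded_supp w -> (forall x, ~ B0 x -> w x = 0) ->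
  rapid_on setT w ->
  exists2 g : E -> R, smooth_on setT g & mu.-negligible (B0 `&` [set x | w x <> g x]).
Proof.
move=> bw w0 rw.
have p0 := pi_gt0 R; have ph : 0 < pi / 2 :> R by lra.
have [ra rb] := rapid_fourier rw.
have [g sg [C gC]] := trig_series_limit ra rb; exists g => //.
have [B2 HB2] := trig_series_limit_bound gC.
have mg : measurable_fun setT g by exact: smooth_measurable.
have BQ x : B0 x -> period_box x0 x.
  move=> /(ballP_coord _ _ ph) bx i /=; rewrite in_itv/= -ler_distl distrC.
  by have := bx i; lra.
(* Cutting [g] to the period box gives [h] bounded support and changes nothing on [B0]. *)
pose h x := w x - \1_(period_box x0) x * g x.
have bh : bounded_supp h.
  have := bounded_suppD bw (bounded_suppZ (-1) (bounded_supp_period_box x0 mg HB2)).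
  by under eq_fun do rewrite mulN1r.
have oB : open (B0 : set E) by exact: ball_open.
have := fundamental_lemma oB bh; move=> F.
apply: negligibleS (F _) => [x [Bx wg]|phi [sphi [Kc [cK KB phi0]]]].
  by split => //= hx; apply: wg; move: hx; rewrite /h indicE mem_set ?mul1r; [lra|exact: BQ].
have phiB x : ~ B0 x -> phi x = 0 by move=> Bx; apply: phi0 => /KB.
have [bphi _ _ [C1 HC1]] := smooth_fourier sphi phiB.
have [_ [r1 [B1 HB1]]] := bphi.
have -> : (fun x => phi x * h x) = fun x => phi x * w x - g x * phi x.
  apply/funext => x; rewrite /h indicE; have [Bx|Bx] := pselect (B0 x).
    by rewrite (mem_set (BQ _ Bx)) mul1r; ring.
  by rewrite phiB// !mul0r mulr0 subrr.
have bpw : bounded_supp (fun x => phi x * w x).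
  apply: bounded_suppM => //; first exact: smooth_measurable.
  by exists B1 => x; have [] := HB1 x.
have bgp : bounded_supp (fun x => g x * phi x) by apply: bounded_suppM => //; exists B2.
rewrite integB//; apply/eqP; rewrite -normr_le0.
apply: (@le_archi _ _ _ (C1 * integ (fun x => `|w x|) + C * integ (fun x => `|phi x|))) => N.
have e1 : `|integ (fun x => trig_series (fourier_cos phi) (fourier_sin phi) N x * w x) -
    integ (fun x => phi x * w x)| <= C1 / N.+1%:R * integ (fun x => `|w x|).
  have [B3 HB3] := trig_series_bound (fourier_cos phi) (fourier_sin phi) N.
  apply: (@integ_close _ _ _ _ _ _ (Num.max B1 B3) bw).
  - by apply: smooth_measurable; exact: smooth_trig_series.
  - exact: smooth_measurable.
  - by move=> x; rewrite le_max HB3 orbT.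
  - by move=> x; rewrite le_max; have [-> _] := HB1 x.
  by move=> x wx; apply: HC1; apply: contrapT => /w0 wx0; rewrite wx0 eqxx in wx.
have e2 : `|integ (fun x => trig_series (fourier_cos w) (fourier_sin w) N x * phi x) -
    integ (fun x => g x * phi x)| <= C / N.+1%:R * integ (fun x => `|phi x|).
  have [B3 HB3] := trig_series_bound (fourier_cos w) (fourier_sin w) N.
  apply: (@integ_close _ _ _ _ _ _ (Num.max B2 B3) bphi) => //.
  - by apply: smooth_measurable; exact: smooth_trig_series.
  - by move=> x; rewrite le_max HB3 orbT.
  - by move=> x; rewrite le_max HB2.
(* Both sides are the same bilinear sum in the coefficients of [w] and [phi]. *)
have e3 : integ (fun x => trig_series (fourier_cos w) (fourier_sin w) N x * phi x) =
    integ (fun x => trig_series (fourier_cos phi) (fourier_sin phi) N x * w x).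
  rewrite !integ_trig_series_mul//; apply: eq_bigr => k _.
  by rewrite /fourier_cos /fourier_sin; ring.
rewrite e3 in e2; move: e1 e2; rewrite add0r.
move: (integ (fun x => trig_series _ _ N x * w x)) => I3.
rewrite mulrDl mulrAC [C * _ * _]mulrAC.
move: (integ (fun x => phi x * w x)) (integ (fun x => g x * phi x)) => I1 I2 e1 e2.
have -> : I1 - I2 = (I3 - I2) - (I3 - I1) by ring.
by apply: le_trans (ler_normB _ _) _; rewrite [leLHS]addrC; exact: lerD.
Qed.

(** The cutoffs depend on the direction. Finitely many cones cover the sphere, and the product of
    their cutoffs works in all of them: by [rapid_mul], multiplication by the other factors
    preserves decay on a slightly smaller cone. The product is nonzero at [x0] and can be divided
    out. *)
Lemma elliptic_smooth (D : set E) (u : E -> R) : open D -> D `<=` B0 -> D x0 ->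
  bounded_supp u ->
  (forall xi : E, xi != 0 -> exists (phi : E -> R) (G : set E),
    [/\ test_function D phi, phi x0 != 0, open G /\ G xi,
      forall (t : R) (eta : E), 0 < t -> G eta -> G (t *: eta) &
      rapid_on G (fun x => phi x * u x)]) ->
  exists (D' : set E) (g : E -> R), [/\ open D', D' x0, D' `<=` D, smooth_on D' g &
    mu.-negligible (D' `&` [set x | u x <> g x])].
Proof.
move=> oD DB Dx0 bu H.
have /nbhs_ballP[e /= e0 eD] : nbhs x0 D by exact: open_nbhs_nbhs.
pose psi : E -> R := box_bump (\row_i (x0 ord0 i - e / 2)) (\row_i (x0 ord0 i + e / 2)).
have spsi : smooth_on setT psi by exact: smooth_box_bump.
have psi0 x : ~ B0 x -> psi x = 0.
  move=> Bx; apply: box_bump_eq0 => xb; apply: Bx; apply: DB; apply: eD.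
  apply/ballP_coord => // i; have := xb i; rewrite !mxE ltr_norml => /andP[h1 h2].
  by apply/andP; split; lra.
have psix0 : psi x0 != 0.
  rewrite gt_eqF//; apply: box_bump_gt0 => i; rewrite !mxE; apply/andP; split; lra.
pose good (xi : E) (p : (E -> R) * set E * R) := xi != 0 ->
  [/\ test_function D p.1.1, p.1.1 x0 != 0, 0 < p.2 /\ p.2 <= 2^-1,
     forall eta zeta : E, eta != 0 -> ball xi p.2 (`|eta|^-1 *: eta) ->
       `|zeta - eta| <= p.2 * `|eta| -> p.1.2 zeta &
     rapid_on p.1.2 (fun x => p.1.1 x * u x)].
have /choice[P HP] : forall xi, exists p, good xi p.
  move=> xi; have [xi0|xi0] := eqVneq xi 0.
    by exists (fun=> 0, set0, 0); rewrite /good xi0 eqxx.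
  have [phi [G [tp px [oG Gxi] cG rG]]] := H xi xi0.
  have /nbhs_ballP[e1 /= e10 e1G] : nbhs xi G by exact: open_nbhs_nbhs.
  (* One half of [e1] is for the direction of [eta], the other for the displacement from [eta] to
     [zeta]; the bound one half is required by [rapid_mul]. *)
  pose d := Num.min (e1 / 2) (2^-1).
  exists (phi, G, d) => _; split => //=.
    by rewrite lt_min divr_gt0//= invr_gt0 ltr0n ge_min lexx orbT.
  move=> eta zeta eta0; rewrite -ball_normE /= => h1 h2.
  have n0 : 0 < `|eta| by rewrite normr_gt0.
  have -> : zeta = `|eta| *: (`|eta|^-1 *: zeta) by rewrite scalerA mulfV ?scale1r// gt_eqF.
  apply: cG => //; apply: e1G; rewrite -ball_normE /=.
  have de : d <= e1 / 2 by rewrite ge_min lexx.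
  have h3 : `| `|eta|^-1 *: eta - `|eta|^-1 *: zeta| <= d.
    by rewrite -scalerBr normrZ gtr0_norm ?invr_gt0// ler_pdivrMl// mulrC distrC.
  have := ler_normD (xi - `|eta|^-1 *: eta) (`|eta|^-1 *: eta - `|eta|^-1 *: zeta).
  rewrite addrA subrK; lra.
pose Sph : set E := [set xi | `|xi| = 1].
have cS : compact Sph.
  apply: bounded_closed_compact.
    by exists 1; split; [exact: num_real|move=> M M1 x /= ->; exact: ltW].
  apply: (@preimage_closed _ _ (fun x : E => `|x|) [set t : R | t = 1]).
    by move=> x _; exact: norm_continuous.
  exact: closed_eq.
have S0 xi : Sph xi -> xi != 0 by move=> /= x1; rewrite -normr_gt0 x1.
have [F FS cF] : finite_subset_cover Sph (fun xi : E => ball xi (P xi).2) Sph.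
  move: cS; rewrite compact_cover; apply.
    by move=> xi _; exact: ball_open.
  move=> xi Sxi; exists xi => //; apply: ballxx.
  by have [_ _ []] := HP xi (S0 _ Sxi).
pose s : seq E := finmap.enum_fset F.
have sS xi : xi \in s -> Sph xi by move=> /FS /set_mem.
have sC xi : Sph xi -> exists2 z, z \in s & ball z (P z).2 xi.
  by move=> /cF [z /= zF bz]; exists z.
(* The factor [psi] keeps the product supported in [B0] for every list, in particular when one
   cutoff has been removed to be paired with [u]. *)
pose prodf (l : seq E) (x : E) : R := psi x * \prod_(z <- l) (P z).1.1 x.
have sprodf l : {subset l <= s} -> smooth_on setT (prodf l).
  move=> ls; apply: (smooth_onM openT spsi).
  elim: l ls => [_|z l IH ls].
    by apply: (smooth_on_congr openT _ (smooth_on_cst 1)) => y _; rewrite big_nil.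
  have [[sz _] _ _ _ _] := HP z (S0 _ (sS _ (ls _ (mem_head _ _)))).
  apply: (smooth_on_congr openT _ (smooth_onM openT sz (IH _))).
    by move=> y _; rewrite big_cons.
  by move=> y yl; apply: ls; rewrite inE yl orbT.
pose w x := prodf s x * u x.
have ss : smooth_on setT (prodf s) by exact: sprodf.
have prodf0 l x : ~ B0 x -> prodf l x = 0 by move=> /psi0; rewrite /prodf => ->; rewrite mul0r.
have bprod : bounded_supp (prodf s).
  have cc : continuous (prodf s) by move=> x; exact: smooth_on_continuous ss I.
  by apply: (continuous_bounded_supp cc (ball_supp_norm _)) => x /prodf0.
have bw : bounded_supp w.
  have [mp [r1 [B1 HB1]]] := bprod.
  by apply: bounded_suppM => //; exists B1 => x; have [] := HB1 x.
have w0 x : ~ B0 x -> w x = 0 by move=> /prodf0; rewrite /w => ->; rewrite mul0r.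
have rw : rapid_on setT w.
  move=> m.
  have /choice[B HB] : forall z, exists B : R, z \in s -> forall xi th, xi != 0 ->
      ball z (P z).2 (`|xi|^-1 *: xi) -> `|fint w xi th| * (1 + `|xi|) ^+ m <= B.
    move=> z; have [zs|zs] := boolP (z \in s); last by exists 0.
    have [[sz [Kz [_ KzD Kz0]]] _ [d0 d2] cG rG] := HP z (S0 _ (sS _ zs)).
    have subs : {subset rem z s <= s} by exact: mem_rem.
    have wE : w = fun x => prodf (rem z s) x * ((P z).1.1 x * u x).
      by apply/funext => x; rewrite /w /prodf (big_rem z zs)/=; ring.
    have bz : bounded_supp (fun x => (P z).1.1 x * u x).
      have z0 x : ~ B0 x -> (P z).1.1 x = 0 by move=> Bx; apply: Kz0 => /KzD /DB.
      have [[mz [r1 [B1 HB1]]] _ _ _] := smooth_fourier sz z0.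
      by apply: bounded_suppM => //; exists B1 => x; have [] := HB1 x.
    have [|B HB] := @rapid_mul _ (prodf (rem z s)) _
      [set xi | xi != 0 /\ ball z (P z).2 (`|xi|^-1 *: xi)] _ bz _ (sprodf _ subs)
      (fun x => @prodf0 _ x) d0 d2 (fun xi eta G1 => cG xi eta G1.1 G1.2) rG m.
      by move=> x Bx; rewrite (Kz0 x) ?mul0r// => /KzD /DB.
    by exists B => _ xi th xi0 bxi; rewrite wE; exact: HB.
  exists (\sum_(z <- s) `|B z| + integ (fun x => `|w x|)) => xi th _.
  have Bs0 : 0 <= \sum_(z <- s) `|B z| by exact: sumr_ge0.
  have fw := fint_bound bw xi th.
  have [xi0|xi0] := eqVneq xi 0.
    by rewrite xi0 normr0 addr0 expr1n mulr1 -xi0; apply: le_trans fw _; rewrite lerDr.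
  have n0 : 0 < `|xi| by rewrite normr_gt0.
  have [z zs bz] : exists2 z, z \in s & ball z (P z).2 (`|xi|^-1 *: xi).
    by apply: sC; rewrite /Sph/= normrZ gtr0_norm ?invr_gt0// mulVf// gt_eqF.
  apply: le_trans (HB z zs xi th xi0 bz) _; apply: le_trans (ler_norm _) _.
  rewrite (big_rem z zs)/= -addrA lerDl addr_ge0 ?sumr_ge0//.
  exact: le_trans fw.
have [g sg ng] := smooth_of_rapid bw w0 rw.
have px0 : prodf s x0 != 0.
  rewrite mulf_neq0//; rewrite prodf_seq_neq0; apply/allP => z zs.
  by have [_ -> _ _ _] := HP z (S0 _ (sS _ zs)).
exists (D `&` [set x | prodf s x != 0]), (fun x => g x * (prodf s x)^-1).
have oD' : open (D `&` [set x | prodf s x != 0]).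
  apply: openI => //; apply: (@open_comp _ _ (prodf s) [set t | t != 0]).
    by move=> x _; exact: smooth_on_continuous ss I.
  exact: open_neq.
split => //.
- apply: smooth_onM => //; first exact: smooth_on_sub sg.
  by apply: smooth_onV => //; [exact: smooth_on_sub ss|move=> x []].
apply: negligibleS ng => x [[Dx px] /= ux]; split; first exact: DB.
move=> /= wg; apply: ux; rewrite -wg /w mulrC mulrA mulVf ?mul1r//.
Qed.

End elliptic.

(** * Dividing by monomials *)

Section hadamard.
Variables (R : realType) (n : nat) (x0 : 'rV[R]_n) (j : 'I_n) (r : R).
Hypotheses (r0 : 0 < r) (x0j : x0 ord0 j = 0).
Local Notation E := 'rV[R]_n.
Local Notation mu := (@lebesgue_rV R n).
Local Notation D := (ball x0 r : set E).

Lemma smooth_bounded (D1 : set E) (h : E -> R) (s : R) : ball x0 r `<=` D1 ->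
  s < r -> 0 < s -> smooth_on D1 h -> exists B : R, forall x, ball x0 s x -> `|h x| <= B.
Proof.
move=> rD sr s0 sh.
pose K := closed_box (\row_i (x0 ord0 i - s)) (\row_i (x0 ord0 i + s)).
have KD : K `<=` D1.
  move=> x Kx; apply: rD; apply/ballP_coord => // i; have := Kx i; rewrite !mxE ltr_norml.
  by move=> /andP[h1 h2]; apply/andP; split; lra.
have /compact_bounded[M [_ MP]] : compact (h @` K).
  apply: continuous_compact; last exact: closed_box_compact.
  by apply: continuous_in_subspaceT => x /set_mem /KD Dx; exact: smooth_on_continuous sh Dx.
exists (M + 1) => x /(ballP_coord _ _ s0) bx; apply: (MP (M + 1)); first by rewrite ltrDl.
exists x => // i; have := bx i; rewrite !mxE ltr_norml => /andP[h1 h2].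
by apply/andP; split; lra.
Qed.

Definition shrink (x : E) (t : R) : E := upd x j (t * x ord0 j).

Lemma shrink1 (x : E) : shrink x 1 = x.
Proof. by apply/rowP => i; rewrite updE; case: eqP => [->|//]; rewrite mul1r. Qed.

Lemma shrink_ball (s : R) (x : E) (t : R) : 0 < s -> ball x0 s x -> `|t| <= 1 ->
  ball x0 s (shrink x t).
Proof.
move=> s0 /(ballP_coord _ _ s0) bx t1; apply/ballP_coord => // i.
rewrite updE; case: eqP => [->|_]; last exact: bx.
have := bx j; rewrite x0j !sub0r !normrN normrM.
by apply: le_lt_trans; rewrite ler_piMl.
Qed.

Lemma is_derive_shrink (h : E -> R) (x : E) (t : R) :
  derivable h (shrink x t) (delta_mx ord0 j) ->
  is_derive t 1 (fun t => h (shrink x t)) (x ord0 j * partial j h (shrink x t)).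
Proof.
move=> dh.
have E1 : shrink x t = (t * x ord0 j) *: delta_mx ord0 j + upd x j 0 by exact: upd_line.
have dl : is_derive t 1 (fun t : R => t * x ord0 j) (x ord0 j : R).
  have dt : is_derive t 1 (fun t : R => t) (1 : R) by exact: is_derive_id.
  have := is_deriveZ (x ord0 j) dt; rewrite [_ *: 1]mulr1.
  by congr is_derive; apply/funext => u; exact: mulrC.
rewrite E1 in dh.
have := @is_derive1_comp R (fun u => h (u *: delta_mx ord0 j + upd x j 0))
  (fun t => t * x ord0 j) t _ _ (is_derive_line dh) dl.
rewrite -E1 mulrC; congr is_derive; apply/funext => u /=.
by rewrite /shrink (upd_line x j (u * x ord0 j)).
Qed.

Lemma is_derive_shrink_line (h : E -> R) (x : E) (t s : R) i :
  derivable h (shrink (s *: delta_mx ord0 i + x) t) (delta_mx ord0 i) ->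
  is_derive s 1 (fun s => h (shrink (s *: delta_mx ord0 i + x) t))
    ((if i == j then t else 1) * partial i h (shrink (s *: delta_mx ord0 i + x) t)).
Proof.
pose c := if i == j then t else 1.
have E1 u : shrink (u *: delta_mx ord0 i + x) t = (u * c) *: delta_mx ord0 i + shrink x t.
  apply/rowP => k; rewrite /shrink !mxE eqxx /= mulrDr.
  have [->|kj] := eqVneq k j; rewrite /c.
    rewrite eq_sym; case: eqP => _; last by rewrite !mulr0.
    by congr (_ + _); ring.
  rewrite eq_sym; have [->|ik] := eqVneq i k; last by rewrite !mulr0.
  by rewrite (negbTE kj) !mulr1.
move=> dh.
have dl : is_derive s 1 (fun t : R => t * c) (c : R).
  have dt : is_derive s 1 (fun t : R => t) (1 : R) by exact: is_derive_id.
  have := is_deriveZ c dt; rewrite [_ *: 1]mulr1.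
  by congr is_derive; apply/funext => u; exact: mulrC.
rewrite E1 in dh *.
have := @is_derive1_comp R (fun u => h (u *: delta_mx ord0 i + shrink x t))
  (fun t => t * c) s _ _ (is_derive_line dh) dl.
rewrite mulrC; congr is_derive; apply/funext => u /=.
by rewrite E1.
Qed.

(* The remainder in [f x = x_j * \int_0^1 (partial j f) (x with x_j replaced by t x_j) dt];
   the weight [t ^+ a] makes the family stable under differentiation. *)
Definition hadamard (a : nat) (h : E -> R) (x : E) : R :=
  \int[lebesgue_measure]_(t in `[0, 1]) (t ^+ a * h (shrink x t)).

Lemma hadamard_integrable a (h : E -> R) x : smooth_on D h -> D x ->
  (@lebesgue_measure R).-integrable `[0, 1] (EFin \o (fun t => t ^+ a * h (shrink x t))).
Proof.
move=> sh Dx; apply: continuous_compact_integrable; first exact: segment_compact.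
apply: continuous_in_subspaceT => t /set_mem /=; rewrite in_itv/= => /andP[t0 t1].
have ct : {for t, continuous (fun t => h (shrink x t))}.
  apply: differentiable_continuous; apply/derivable1_diffP.
  have : D (shrink x t) by apply: shrink_ball => //; rewrite ger0_norm.
  move=> /(sh [::] _) [_ /(_ j)] /is_derive_shrink [+ _]; exact.
exact: (cvgM (@exprn_continuous _ a t) ct).
Qed.

Lemma hadamard_bound a (h : E -> R) x (B : R) : smooth_on D h -> D x ->
  (forall y, D y -> `|h y| <= B) -> `|hadamard a h x| <= B.
Proof.
move=> sh Dx hB; rewrite /hadamard.
apply: le_trans (le_normr_Rintegral _ (hadamard_integrable a sh Dx)) _; first by [].
have -> : B = \int[lebesgue_measure]_(t in `[0 : R, 1]) B.
  by rewrite Rintegral_cst//= lebesgue_measure_itv/= lte_fin ltr01 /= oppr0 addr0 mulr1.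
apply: le_Rintegral => //.
- by have := hadamard_integrable a sh Dx => /integrable_abse.
- by apply: continuous_compact_integrable; [exact: segment_compact|move=> t; exact: cvg_cst].
move=> t /=; rewrite in_itv/= => /andP[t0 t1]; rewrite normrM -[leRHS]mul1r; apply: ler_pM => //.
  by rewrite ger0_norm ?exprn_ge0// exprn_ile1.
by apply: hB; apply: shrink_ball => //; rewrite ger0_norm.
Qed.

(** Differentiation under the integral sign; [shrink] multiplies coordinate [j] by [t], so only the
    derivative in direction [j] brings out one more power of [t]. *)
Lemma is_derive_hadamard a (h : E -> R) x i (B : R) : smooth_on D h -> D x ->
  (forall y, D y -> `|partial i h y| <= B) ->
  derivable (hadamard a h) x (delta_mx ord0 i) /\
  partial i (hadamard a h) x = hadamard (a + (i == j)) (partial i h) x.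
Proof.
move=> sh Dx hB.
have /nbhs_ballP[d /= d0 dD] : nbhs x D by apply: open_nbhs_nbhs; split => //; exact: ball_open.
have sD (s : R) : s \in `]-d, d[ -> D (s *: delta_mx ord0 i + x).
  rewrite in_itv/= => /andP[s1 s2]; apply: dD; apply/ballP_coord => // k.
  rewrite !mxE opprD addrCA subrr addr0 normrN eqxx /=; case: eqP => _.
    by rewrite mulr1 ltr_norml s1.
  by rewrite mulr0 normr0.
pose f (s t : R) : R := t ^+ a * h (shrink (s *: delta_mx ord0 i + x) t).
have df (s t : R) : s \in `]-d, d[ -> t \in `[0, 1] -> is_derive s 1 (f ^~ t)
    (t ^+ a * ((if i == j then t else 1) * partial i h (shrink (s *: delta_mx ord0 i + x) t))).
  move=> sd; rewrite in_itv/= => /andP[t0 t1].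
  have H := is_derive_shrink_line (h := h) (x := x) (t := t) (s := s) (i := i).
  apply: is_deriveZ; apply: H.
  have : D (shrink (s *: delta_mx ord0 i + x) t).
    by apply: shrink_ball; rewrite ?ger0_norm//; exact: sD.
  by move=> /(sh [::] _) [_]; exact.
have d1f (s t : R) : s \in `]-d, d[ -> t \in `[0, 1] -> partial1of2 f s t =
    t ^+ (a + (i == j)) * partial i h (shrink (s *: delta_mx ord0 i + x) t).
  move=> sd t01; rewrite partial1of2E; have [_ ->] := df s t sd t01.
  by case: eqP => _; rewrite ?addn1 ?addn0 ?exprSr ?mul1r ?mulrA.
have B0 : 0 <= B by exact: le_trans (hB _ Dx).
have zd : (0 : R) \in `]-d, d[ by rewrite in_itv/= oppr_lt0 d0.
have := @cvg_differentiation_under_integral R _ (measurableTypeR R) (@lebesgue_measure R) f `[0, 1]%classic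
  (measurable_itv _) 0 (-d) d zd.
move=> /(_ _ _ (cst B) (fun=> B0)) H.
have {}H : h0^-1 *: (hadamard a h (h0 *: delta_mx ord0 i + x) - hadamard a h x) @[h0 --> 0^'] -->
    hadamard (a + (i == j)) (partial i h) x.
  have -> : hadamard (a + (i == j)) (partial i h) x =
      \int[lebesgue_measure]_(y in `[0, 1]) partial1of2 f 0 y.
    by apply: eq_Rintegral => t /set_mem t01; rewrite d1f// scale0r add0r.
  have E0 : hadamard a h x = \int[lebesgue_measure]_(y in `[0, 1]) f 0 y.
    by apply: eq_Rintegral => t _; rewrite /f scale0r add0r.
  rewrite E0; under eq_fun do rewrite -[X in (X *: delta_mx _ _)]addr0.
  apply: H.
  - by move=> s sd; apply: hadamard_integrable => //; exact: sD.
  - by move=> s t sd t01; have [] := df s t sd t01.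
  - by apply: continuous_compact_integrable; [exact: segment_compact|move=> t; exact: cvg_cst].
  move=> s t sd t01; rewrite d1f//; move: t01; rewrite /= in_itv/= => /andP[t0 t1].
  rewrite normrM -[leRHS]mul1r; apply: ler_pM => //.
    by rewrite ger0_norm ?exprn_ge0// exprn_ile1.
  by apply: hB; apply: shrink_ball; rewrite ?ger0_norm//; exact: sD.
by split; [apply/cvg_ex; eexists; exact: H|exact: cvg_lim H].
Qed.

(** All derivatives are again of the form [hadamard b g] with bounded integrand, so it suffices that
    such functions are continuous; they are Lipschitz because their partials are bounded. *)
Lemma hadamard_smooth a (h : E -> R) : smooth_on D h ->
  (forall s, exists B, forall y, D y -> `|iter_partial s h y| <= B) ->
  smooth_on D (hadamard a h).
Proof.
move=> sh hB; apply/smooth_onP => k.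
have oD : open D by exact: ball_open.
have cont b (g : E -> R) : smooth_on D g ->
    (forall s, exists B, forall y, D y -> `|iter_partial s g y| <= B) ->
    forall x, D x -> {for x, continuous (hadamard b g)}.
  move=> sg gB x Dx.
  have /choice[B HB] : forall i, exists B, forall y, D y -> `|partial i g y| <= B.
    by move=> i; exact: (gB [:: i]).
  have /nbhs_ballP[d /= d0 dD] : nbhs x D by exact: open_nbhs_nbhs.
  pose C := \sum_i `|B i|.
  have C0 : 0 <= C by exact: sumr_ge0.
  have L := @partial_lipschitz _ _ (hadamard b g) x d C d0 C0.
  have {}L y : ball x d y -> `|hadamard b g y - hadamard b g x| <= n%:R * C * `|y - x|.
    move=> by_; apply: L => //; last exact: ballxx.
    move=> w i /dD Dw; have [d1 ->] := is_derive_hadamard b sg Dw (HB i); split => //.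
    apply: (@le_trans _ _ (B i)); first exact: hadamard_bound (smooth_on_partial i sg) Dw (HB i).
    by rewrite /C (bigD1 i)//=; apply: le_trans (ler_norm _) _; rewrite lerDl sumr_ge0.
  apply/(@cvgrPdist_lt _ _ _ (nbhs x)) => e e0.
  have nC : 0 < n%:R * C + 1 by rewrite ltr_wpDl// mulr_ge0.
  near=> y; rewrite distrC; apply: le_lt_trans (L y _) _.
    by near: y; exact: nbhsx_ballx.
  have : ball x (e / (n%:R * C + 1)) y by near: y; apply: nbhsx_ballx; rewrite divr_gt0.
  rewrite -ball_normE /= distrC.
  rewrite ltr_pdivlMr// => h1; apply: le_lt_trans h1.
  by rewrite mulrC ler_wpM2l// lerDl.
elim: k a h sh hB => [|k IH] a h sh hB /=; first exact: cont.
split; first exact: cont.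
move=> i; have [B HB] := hB [:: i]; split.
  by move=> x Dx; have [] := is_derive_hadamard a sh Dx HB.
apply: (Ck_congr oD _ (IH (a + (i == j))%N (partial i h) (smooth_on_partial i sh) _)).
  by move=> x Dx; have [_ ->] := is_derive_hadamard a sh Dx HB.
by move=> s; have := hB (rcons s i); rewrite /iter_partial foldr_rcons.
Unshelve. all: by end_near. Qed.

(** The fundamental theorem of calculus for [f (shrink x t)] between [t = 0], a point of the
    hyperplane, and [t = 1]. *)
Lemma hadamardE (f : E -> R) : smooth_on D f ->
  (forall x, D x -> x ord0 j = 0 -> f x = 0) ->
  forall x, D x -> f x = x ord0 j * hadamard 0 (partial j f) x.
Proof.
move=> sf f0 x Dx.
have dF (t : R) : 0 <= t -> t <= 1 -> is_derive t 1 (fun t => f (shrink x t))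
    (x ord0 j * partial j f (shrink x t)).
  move=> t0 t1; apply: is_derive_shrink.
  have : D (shrink x t) by apply: shrink_ball; rewrite ?ger0_norm.
  by move=> /(sf [::] _) [_]; exact.
have cF (t : R) : 0 <= t -> t <= 1 -> {for t, continuous (fun t => f (shrink x t))}.
  by move=> t0 t1; apply: differentiable_continuous; apply/derivable1_diffP; have [] := dF t t0 t1.
have cg (t : R) : 0 <= t -> t <= 1 ->
    {for t, continuous (fun t => x ord0 j * partial j f (shrink x t))}.
  move=> t0 t1.
  have ct : {for t, continuous (fun t => partial j f (shrink x t))}.
    apply: differentiable_continuous; apply/derivable1_diffP.
    have : D (shrink x t) by apply: shrink_ball; rewrite ?ger0_norm.
    have sp := smooth_on_partial j sf.
    move=> /(sp [::] _) [_ /(_ j)] /is_derive_shrink [+ _]; exact.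
  exact: (cvgM (cvg_cst (x ord0 j : R)) ct).
have -> : x ord0 j * hadamard 0 (partial j f) x =
    \int[lebesgue_measure]_(t in `[0, 1]) (x ord0 j * partial j f (shrink x t)).
  rewrite /hadamard -RintegralZl//.
    by apply: eq_Rintegral => t _; rewrite expr0 mul1r.
  exact: (hadamard_integrable 0 (smooth_on_partial j sf) Dx).
rewrite /Rintegral (@continuous_FTC2 _ _ (fun t => f (shrink x t))).
- rewrite shrink1 /= [X in _ - X]f0 ?subr0//; last by rewrite /shrink updE eqxx mul0r.
  by apply: shrink_ball; rewrite ?normr0.
- by [].
- by apply: continuous_in_subspaceT => t /set_mem /=; rewrite in_itv/= => /andP[]; exact: cg.
- split.
  + by move=> t; rewrite in_itv/= => /andP[t0 t1]; have [] := dF t (ltW t0) (ltW t1).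
  + by apply: cvg_at_right_filter; exact: cF.
  + by apply: cvg_at_left_filter; exact: cF.
by move=> t; rewrite in_itv/= => /andP[t0 t1]; rewrite derive1E; have [_] := dF t (ltW t0) (ltW t1).
Qed.

End hadamard.

Section division.
Variables (R : realType) (n : nat) (x0 : 'rV[R]_n).
Local Notation E := 'rV[R]_n.
Local Notation mu := (@lebesgue_rV R n).

(* Boundedness of [u] enters here: [|f| <= B |x_j|] almost everywhere, hence everywhere. *)
Lemma vanish_on_hyperplane (j : 'I_n) (D : set E) (u f : E -> R) (B : R) : open D ->
  (forall x, D x -> `|u x| <= B) -> (forall x, D x -> {for x, continuous f}) ->
  mu.-negligible (D `&` [set x : E | x ord0 j * u x <> f x]) ->
  forall x, D x -> x ord0 j = 0 -> f x = 0.
Proof.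
move=> oD uB cf H x Dx xj; apply: contrapT => /eqP fx.
pose k (y : E) : R := `|f y| - B * `|y ord0 j|.
have ck : {for x, continuous k}.
  have c1 : {for x, continuous (fun y => `|f y|)} by exact: (cvg_norm (cf x Dx)).
  have c2 : {for x, continuous (fun y : E => `|y ord0 j|)}.
    have cc : {for x, continuous (fun y : E => y ord0 j)} by exact: coord_cvg.
    exact: (cvg_norm cc).
  exact: (cvgB c1 (cvgM (cvg_cst (B : R)) c2)).
have k0 : 0 < k x by rewrite /k xj normr0 mulr0 subr0 normr_gt0.
have [e e0 ek] := continuous_gt_ball ck k0.
have oG : open (D `&` ball x e) by apply: openI => //; exact: ball_open.
have [|y [[Dy ye]]] := null_set_codense H oG (x := x); first by split => //; exact: ballxx.
apply; split => //= fy; have := ek y ye; rewrite /k /= -fy normrM subr_gt0 mulrC.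
by rewrite ltNge ler_wpM2l// uB.
Qed.

(** If the coordinate is nonzero at [x0] it can be inverted nearby. Otherwise [f] vanishes on the
    hyperplane and the Hadamard quotient is the candidate; half the radius ensures bounded
    derivatives, and the hyperplane, where nothing is known about [u], is a null set. *)
Lemma divide_coord (j : 'I_n) (D : set E) (u f : E -> R) (B : R) : open D -> D x0 ->
  (forall x, D x -> `|u x| <= B) -> smooth_on D f ->
  mu.-negligible (D `&` [set x : E | x ord0 j * u x <> f x]) ->
  exists (D' : set E) (g : E -> R), [/\ open D', D' x0, D' `<=` D, smooth_on D' g &
    mu.-negligible (D' `&` [set x | u x <> g x])].
Proof.
move=> oD Dx0 uB sf H; have [x0j|x0j] := eqVneq (x0 ord0 j) 0; last first.
  exists (D `&` [set x | x ord0 j != 0]), (fun x => f x * (x ord0 j)^-1).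
  have oD' : open (D `&` [set x | x ord0 j != 0]).
    apply: openI => //; apply: (@open_comp _ _ (fun x : E => x ord0 j) [set t | t != 0]).
      by move=> x _; exact: coord_cvg.
    exact: open_neq.
  split => //.
    apply: smooth_onM => //; first exact: smooth_on_sub sf.
    by apply: smooth_onV => //; [exact: smooth_on_coord|move=> x []].
  apply: negligibleS H => x [[Dx xj] /= ux]; split => //= E1; apply: ux.
  by rewrite -E1 mulrAC mulfV ?mul1r.
have fv := vanish_on_hyperplane oD uB (fun x Dx => smooth_on_continuous sf Dx) H.
have /nbhs_ballP[r /= r0 rD] : nbhs x0 D by exact: open_nbhs_nbhs.
have r2 : 0 < r / 2 by rewrite divr_gt0.
have r2r : r / 2 < r by lra.
have sD : ball x0 (r / 2) `<=` D.
  by apply: subset_trans rD; apply: le_ball; exact: ltW.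
have sf' : smooth_on (ball x0 (r / 2)) f by exact: smooth_on_sub sf.
exists (ball x0 (r / 2)), (hadamard j 0 (partial j f)); split.
- exact: ball_open.
- exact: ballxx.
- exact: sD.
- apply: (hadamard_smooth r2 x0j 0 (smooth_on_partial j sf')) => s; apply: (smooth_bounded r0 rD r2r r2).
  by apply: smooth_on_iter_partial; exact: smooth_on_partial.
have : mu.-negligible (D `&` [set x : E | x ord0 j * u x <> f x] `|` [set x : E | x ord0 j = 0]).
  by apply: negligibleU => //; exact: hyperplane_null.
apply: negligibleS => x [bx /= ux]; have [xj|xj] := eqVneq (x ord0 j) 0; [by right|left].
split; first exact: sD.
move=> /= E1; apply: ux; apply: (mulfI xj); rewrite E1.
by rewrite -(hadamardE r2 x0j sf')// => y by_; apply: fv; exact: sD.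
Qed.

(** Quantifying over all [u] and [f] lets divisors be composed: one divides by a coordinate with
    [m * u] in the role of [u], then by [m]. *)
Definition divisible_by (m : E -> R) := forall (D : set E) (u f : E -> R) (B : R),
  open D -> D x0 -> (forall x, D x -> `|u x| <= B) -> smooth_on D f ->
  mu.-negligible (D `&` [set x | m x * u x <> f x]) ->
  exists (D' : set E) (g : E -> R), [/\ open D', D' x0, D' `<=` D, smooth_on D' g &
    mu.-negligible (D' `&` [set x | u x <> g x])].

Lemma divisible_by1 : divisible_by (fun=> 1).
Proof.
move=> D u f B oD Dx0 uB sf H; exists D, f; split => //.
by apply: negligibleS H => x [Dx /= ux]; split => //=; rewrite mul1r.
Qed.

Lemma divisible_byM j (m : E -> R) : continuous m -> divisible_by m ->
  divisible_by (fun x => x ord0 j * m x).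
Proof.
move=> cm dm D u f B oD Dx0 uB sf H.
(* The negated absolute value turns the lower bound of [continuous_gt_ball] into the upper bound on
   [|m|] that keeps [m * u] bounded. *)
have cN : {for x0, continuous (fun x => - `|m x|)} by exact: (cvgN (cvg_norm (cm x0))).
have [|e e0 em] := continuous_gt_ball (c := - (`|m x0| + 1)) cN.
  by rewrite ltrN2 ltrDl.
have B0 : 0 <= B by exact: le_trans (uB _ Dx0).
have oD1 : open (D `&` ball x0 e) by apply: openI => //; exact: ball_open.
have D1x0 : (D `&` ball x0 e) x0 by split => //; exact: ballxx.
have [|||D2 [g [oD2 D2x0 D21 sg ng]]] := @divide_coord j _ (fun x => m x * u x) f
    ((`|m x0| + 1) * B) oD1 D1x0.
- move=> x [Dx /em /=]; rewrite ltrN2 => mx; rewrite normrM.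
  by apply: ler_pM => //; [exact: ltW|exact: uB].
- by apply: smooth_on_sub sf => x [].
- by apply: negligibleS H => x [[Dx _] /= ux]; split => //=; rewrite -mulrA.
have [|D3 [g3 [oD3 D3x0 D32 sg3 ng3]]] := dm D2 u g B oD2 D2x0 _ sg ng.
  by move=> x /D21[Dx _]; exact: uB.
by exists D3, g3; split => //; apply: subset_trans D32 _ => x /D21[].
Qed.

Lemma divisible_by_monomial (al : 'I_n -> nat) :
  divisible_by (fun x => \prod_(j < n) x ord0 j ^+ al j).
Proof.
have cont (s : seq 'I_n) : continuous (fun x : E => \prod_(j <- s) x ord0 j ^+ al j).
  move=> x; apply: (@smooth_on_continuous _ _ setT) => //.
  apply: smooth_on_prod => [|j _]; first exact: openT.
  elim: (al j) => [|a IH]; first by under eq_fun do rewrite expr0; exact: smooth_on_cst.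
  under eq_fun do rewrite exprS; exact: (smooth_onM openT (smooth_on_coord j) IH).
elim: (index_enum 'I_n) => [|j s IH].
  by under eq_fun do rewrite big_nil; exact: divisible_by1.
under eq_fun do rewrite big_cons.
suff H a : divisible_by (fun x : E => x ord0 j ^+ a * \prod_(j0 <- s) x ord0 j0 ^+ al j0).
  exact: H.
elim: a => [|a IHa].
  have -> : (fun x : E => x ord0 j ^+ 0 * \prod_(j0 <- s) x ord0 j0 ^+ al j0) =
     (fun x => \prod_(j0 <- s) x ord0 j0 ^+ al j0) by apply/funext => x; rewrite mul1r.
  exact: IH.
have -> : (fun x : E => x ord0 j ^+ a.+1 * \prod_(j0 <- s) x ord0 j0 ^+ al j0) =
     (fun x => x ord0 j * (x ord0 j ^+ a * \prod_(j0 <- s) x ord0 j0 ^+ al j0)).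
  by apply/funext => x; rewrite exprS mulrA.
apply: divisible_byM IHa => x.
have cx : {for x, continuous (fun x : E => x ord0 j)} by exact: coord_cvg.
have ca : {for x, continuous (fun x : E => x ord0 j ^+ a)}.
  exact: (continuous_comp cx (@exprn_continuous _ a _)).
exact: (cvgM ca (cont s x)).
Qed.

Lemma smooth_det (D : set E) m (B : 'I_m -> 'I_m -> E -> R) : open D ->
  (forall i j, smooth_on D (B i j)) ->
  smooth_on D (fun x => \det (\matrix_(i, j) B i j x)).
Proof.
move=> oD sB; apply: smooth_on_sum => // s _; apply: smooth_onM => //.
  exact: smooth_on_cst.
apply: smooth_on_prod => // i _.
by under eq_fun do rewrite mxE; exact: sB.
Qed.

(** Cramer's rule: the matrix is the identity at [x0], so its determinant is positive nearby, and
    the adjugate has smooth entries. *)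
Lemma invert_smooth (D : set E) (B : 'I_n -> 'I_n -> E -> R) (v h : 'I_n -> E -> R) :
  open D -> D x0 -> (forall i j, smooth_on D (B i j)) -> (forall i, smooth_on D (h i)) ->
  (forall i j, B i j x0 = (i == j)%:R) ->
  mu.-negligible (D `&` [set x | ~ forall i, \sum_j B i j x * v j x = h i x]) ->
  exists (D' : set E) (g : 'I_n -> E -> R), [/\ open D', D' x0, D' `<=` D,
    forall j, smooth_on D' (g j) &
    mu.-negligible (D' `&` [set x | ~ forall j, v j x = g j x])].
Proof.
move=> oD Dx0 sB sh B0 H.
pose M (x : E) : 'M[R]_n := \matrix_(i, j) B i j x.
have sdet : smooth_on D (fun x => \det (M x)) by exact: smooth_det.
have M0 : M x0 = 1%:M by apply/matrixP => i j; rewrite !mxE B0.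
pose D' := D `&` [set x | 0 < \det (M x)].
have oD' : open D'.
  rewrite openE => x [Dx Mx]; apply: filterI; first exact: near_open.
  have := continuous_gt_ball (smooth_on_continuous sdet Dx) Mx => -[e e0 eM].
  by apply/nbhs_ballP; exists e.
have sadj i j : smooth_on D (fun x => (\adj (M x)) i j).
  have -> : (fun x => (\adj (M x)) i j) = fun x => (-1) ^+ (j + i) *
      \det (\matrix_(k, l) B (lift j k) (lift i l) x).
    apply/funext => x; rewrite mxE /cofactor; congr (_ * \det _).
    by apply/matrixP => k l; rewrite !mxE.
  exact: (smooth_onM oD (smooth_on_cst _) (smooth_det oD (fun k l => sB _ _))).
exists D', (fun j x => (\sum_i (\adj (M x)) j i * h i x) * (\det (M x))^-1); split => //.
- by split => //=; rewrite M0 det1.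
- by move=> x [].
- move=> j; apply: smooth_onM => //.
    apply: smooth_on_sum => // i _; apply: smooth_onM => //.
      by apply: smooth_on_sub (sadj j i) => x [].
    by apply: smooth_on_sub (sh i) => x [].
  apply: smooth_onV => //; first by apply: smooth_on_sub sdet => x [].
  by move=> x [_ /= /gt_eqF ->].
apply: negligibleS H => x [[Dx Mx] /= ux]; split => //= E1; apply: ux => j.
have det0 : \det (M x) != 0 by rewrite gt_eqF.
apply: (mulIf det0); rewrite -[RHS]mulrA mulVf// mulr1.
pose vc : 'cV[R]_n := \col_j v j x.
have -> : \sum_i (\adj (M x)) j i * h i x = (\adj (M x) *m (M x *m vc)) j ord0.
  have Mv i : (M x *m vc) i ord0 = h i x.
    by rewrite mxE -E1; apply: eq_bigr => k _; rewrite !mxE.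
  by rewrite [RHS]mxE; apply: eq_bigr => i _; rewrite Mv.
by rewrite mulmxA mul_adj_mx mul_scalar_mx !mxE mulrC.
Qed.

End division.

(** * Smoothness in charts *)

Section complex_parts.
Variable R : realType.
Local Notation C := R[i].
Local Notation Re := complex.Re.
Local Notation Im := complex.Im.
Implicit Types x y : C.

Lemma cReM x y : Re (x * y) = Re x * Re y - Im x * Im y.
Proof. by case: x; case: y. Qed.

Lemma cImM x y : Im (x * y) = Re x * Im y + Im x * Re y.
Proof. by case: x; case: y. Qed.

Lemma cReD x y : Re (x + y) = Re x + Re y.
Proof. by case: x; case: y. Qed.

Lemma cImD x y : Im (x + y) = Im x + Im y.
Proof. by case: x; case: y. Qed.

Lemma Re_sum (I : Type) (r : seq I) (P : pred I) (F : I -> C) :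
  Re (\sum_(i <- r | P i) F i) = \sum_(i <- r | P i) Re (F i).
Proof. by apply: (big_morph _ cReD). Qed.

Lemma Im_sum (I : Type) (r : seq I) (P : pred I) (F : I -> C) :
  Im (\sum_(i <- r | P i) F i) = \sum_(i <- r | P i) Im (F i).
Proof. by apply: (big_morph _ cImD). Qed.

Lemma complex_eq x y : Re x = Re y -> Im x = Im y -> x = y.
Proof. by case: x; case: y => a b c d /= -> ->. Qed.

End complex_parts.

Section csmooth.
Variables (R : realType) (n : nat).
Local Notation E := 'rV[R]_n.
Local Notation C := R[i].
Implicit Types (D : set E) (f g : E -> C).

Lemma csmooth_onD D f g : open D -> csmooth_on D f -> csmooth_on D g ->
  csmooth_on D (fun x => f x + g x).
Proof.
move=> oD [f1 f2] [g1 g2]; split.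
  by apply: (smooth_on_congr oD _ (smooth_onD oD f1 g1)) => x _; rewrite cReD.
by apply: (smooth_on_congr oD _ (smooth_onD oD f2 g2)) => x _; rewrite cImD.
Qed.

Lemma csmooth_onM D f g : open D -> csmooth_on D f -> csmooth_on D g ->
  csmooth_on D (fun x => f x * g x).
Proof.
move=> oD [f1 f2] [g1 g2]; split.
  apply: (smooth_on_congr oD _ (smooth_onB oD (smooth_onM oD f1 g1) (smooth_onM oD f2 g2))) => x _.
  by rewrite cReM.
apply: (smooth_on_congr oD _ (smooth_onD oD (smooth_onM oD f1 g2) (smooth_onM oD f2 g1))) => x _.
by rewrite cImM.
Qed.

Lemma csmooth_on_sum D (I : Type) (r : seq I) (F : I -> E -> C) : open D ->
  (forall i, csmooth_on D (F i)) -> csmooth_on D (fun x => \sum_(i <- r) F i x).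
Proof.
move=> oD sF; split.
  have H : smooth_on D (fun x => \sum_(i <- r) complex.Re (F i x)).
    by apply: smooth_on_sum => // i _; have [] := sF i.
  by apply: (smooth_on_congr oD _ H) => x _; rewrite Re_sum.
have H : smooth_on D (fun x => \sum_(i <- r) complex.Im (F i x)).
  by apply: smooth_on_sum => // i _; have [] := sF i.
by apply: (smooth_on_congr oD _ H) => x _; rewrite Im_sum.
Qed.

Lemma csmooth_on_sub D D' f : D' `<=` D -> csmooth_on D f -> csmooth_on D' f.
Proof. by move=> DD [f1 f2]; split; exact: smooth_on_sub DD _. Qed.

Lemma csmooth_on_congr D f g : open D -> (forall x, D x -> f x = g x) ->
  csmooth_on D f -> csmooth_on D g.
Proof.
move=> oD fg [f1 f2]; split.
  by apply: (smooth_on_congr oD _ f1) => x Dx; rewrite fg.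
by apply: (smooth_on_congr oD _ f2) => x Dx; rewrite fg.
Qed.

Lemma csmooth_on_real D (f : E -> R) : smooth_on D f ->
  csmooth_on D (fun x => real_complex R (f x)).
Proof. by move=> sf; split; [exact: sf|exact: smooth_on_cst]. Qed.

End csmooth.

Section charts.
Variables (R : realType) (n : nat) (M : smooth_manifold R n).
Local Notation E := 'rV[R]_n.
Local Notation C := R[i].
Local Notation mu := (@lebesgue_rV R n).
Implicit Types (c d e : chart R n M) (W : set M).

Lemma coord_imageP c W x : coord_image c W x <->
  [/\ (c @` chart_dom c) x, W (chart_inv c x) & c (chart_inv c x) = x].
Proof.
split=> [[q [Wq cq] <-]|[[q cq <-]]]; first by rewrite chart_mapK//; split => //; exists q.
by rewrite chart_mapK// => Wq _; exists q.
Qed.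

Lemma coord_image_open c W : open W -> open (coord_image c W).
Proof.
move=> oW; rewrite openE => _ [q [Wq cq] <-].
have : \forall x \near c q, (c @` chart_dom c) x.
  by apply: open_nbhs_nbhs; split; [exact: chart_cod_open|exists q].
have : \forall x \near c q, W (chart_inv c x).
  have := @chart_inv_cont _ _ _ c q cq; apply; rewrite chart_mapK//.
  exact: open_nbhs_nbhs.
apply: filterS2 => x Wx [r cr rx]; rewrite -rx; exists r => //; split => //.
by move: Wx; rewrite -rx chart_mapK.
Qed.

Lemma coord_image_sub c W W' : W `<=` W' -> coord_image c W `<=` coord_image c W'.
Proof. by move=> WW _ [q [Wq cq] <-]; exists q => //; split => //; exact: WW. Qed.

Definition chart_preimage c (G : set E) : set M := chart_dom c `&` [set q | G (c q)].

Lemma chart_preimage_open c G : open G -> open (chart_preimage c G).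
Proof.
move=> oG; rewrite openE => q [cq Gq]; apply: filterI.
  by apply: open_nbhs_nbhs; split => //; exact: chart_dom_open.
by apply: (chart_map_cont cq); exact: open_nbhs_nbhs.
Qed.

Lemma coord_image_preimage c G : G `<=` c @` chart_dom c ->
  coord_image c (chart_preimage c G) = G.
Proof.
move=> Gc; apply/seteqP; split=> x.
  by move=> [q [[_ Gq] _] <-].
by move=> Gx; have [q cq qx] := Gc x Gx; exists q; rewrite // /chart_preimage /= qx.
Qed.

Lemma smooth_chart_at (q : M) : smooth_chart (chart_at q).
Proof. by move=> r; exact: chart_at_compatible. Qed.

(** A smooth chart is compatible with the preferred charts only, so the transition from [c] to [d]
    is factored near [q] through [chart_at q]. *)
Lemma transition_smooth c d j : smooth_chart c -> smooth_chart d ->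
  smooth_on (c @` (chart_dom c `&` chart_dom d)) (fun x => transition c d x ord0 j).
Proof.
move=> sc sd; apply: smooth_on_local => _ [q [cq dq] <-].
pose e := chart_at q; have eq0 := chart_at_dom q.
pose W : set M := chart_dom c `&` chart_dom d `&` chart_dom e.
have oW : open W by do !apply: openI; exact: chart_dom_open.
have s1 k : smooth_on (coord_image c W) (fun x => transition c e x ord0 k).
  have [_] := sc q k; apply: smooth_on_sub => _ [r [[[cr dr] er] _] <-].
  by exists r.
have s2 : smooth_on (coord_image e W) (fun x => transition e d x ord0 j).
  have [+ _] := sd q j; apply: smooth_on_sub => _ [r [[[cr dr] er] _] <-].
  by exists r.
exists (coord_image c W); first by exists q.
have := smooth_on_comp (coord_image_open (c := c) oW) (coord_image_open (c := e) oW) s2 s1.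
move=> H; apply: (smooth_on_congr (coord_image_open (c := c) oW) _ (H _)) => _ [r [[[cr dr] er] _] <-].
  by rewrite /transition chart_mapK// chart_mapK// chart_mapK.
by rewrite /transition chart_mapK//; exists r.
Qed.

Lemma transition_smooth_image c d W j : smooth_chart c -> smooth_chart d ->
  W `<=` chart_dom d ->
  smooth_on (coord_image c W) (fun x => transition c d x ord0 j).
Proof.
move=> sc sd Wd; apply: smooth_on_sub (transition_smooth j sc sd) => _ [q [Wq cq] <-].
by exists q => //; split => //; exact: Wd.
Qed.

Lemma csmooth_transport c d W (f : M -> C) : open W -> smooth_chart c -> smooth_chart d ->
  W `<=` chart_dom c -> csmooth_on (coord_image c W) (fun x => f (chart_inv c x)) ->
  csmooth_on (coord_image d W) (fun x => f (chart_inv d x)).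
Proof.
move=> oW sc sd Wc [s1 s2].
have T j := transition_smooth_image j sd sc Wc.
have H (g : E -> R) : smooth_on (coord_image c W) g ->
    smooth_on (coord_image d W) (fun x => g (transition d c x)).
  move=> sg; apply: (smooth_on_comp (coord_image_open (c := d) oW) (coord_image_open (c := c) oW) sg T).
  by move=> _ [q [Wq dq] <-]; rewrite /transition chart_mapK//; exists q => //; split => //; exact: Wc.
split.
  apply: (smooth_on_congr (coord_image_open (c := d) oW) _ (H _ s1)) => _ [q [Wq dq] <-].
  by rewrite /transition !chart_mapK//; exact: Wc.
apply: (smooth_on_congr (coord_image_open (c := d) oW) _ (H _ s2)) => _ [q [Wq dq] <-].
by rewrite /transition !chart_mapK//; exact: Wc.
Qed.

Lemma smooth_fun_chart c W (f : M -> C) : open W -> smooth_chart c -> W `<=` chart_dom c ->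
  csmooth_on (coord_image c W) (fun x => f (chart_inv c x)) -> smooth_fun W f.
Proof. by move=> oW sc Wc sf d sd; exact: csmooth_transport sf. Qed.

(** Transitions are smooth and map null sets to null sets, so one chart suffices. *)
Lemma ae_on_chart c W (P : M -> Prop) : open W -> smooth_chart c -> W `<=` chart_dom c ->
  mu.-negligible (coord_image c (W `&` [set q | ~ P q])) -> ae_on W P.
Proof.
move=> oW sc Wc H d sd.
pose W' := W `&` chart_dom d.
have oW' : open W' by apply: openI => //; exact: chart_dom_open.
have T j : smooth_on (coord_image c W') (fun x => transition c d x ord0 j).
  by apply: transition_smooth_image => // q [].
have := @smooth_null_image _ _ (coord_image c W') (transition c d)
  (coord_image c (W' `&` [set q | ~ P q])) (coord_image_open (c := c) oW') T.
move=> /(_ (coord_image_sub (@subIsetl _ _ _))) HH.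
apply: negligibleS (HH _).
  move=> _ [q [[Wq Pq] dq] <-]; exists (c q).
    by exists q => //; split; [|exact: Wc].
  by rewrite /transition chart_mapK//; exact: Wc.
by apply: negligibleS H; apply: coord_image_sub => q [[]].
Qed.

Lemma ae_on_sub W W' (P : M -> Prop) : W' `<=` W -> ae_on W P -> ae_on W' P.
Proof.
move=> WW H c sc; apply: negligibleS (H c sc); apply: coord_image_sub => q [/WW ? ?].
by split.
Qed.

Lemma ae_on2 W (P Q S : M -> Prop) : (forall q, W q -> P q -> Q q -> S q) ->
  ae_on W P -> ae_on W Q -> ae_on W S.
Proof.
move=> PQS HP HQ c sc; have := negligibleU (HP c sc) (HQ c sc).
apply: negligibleS => _ [q [[Wq Sq] cq] <-].
have [Pq|Pq] := pselect (P q); last by left; exists q.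
by right; exists q => //; split => //; split => // Qq; apply: Sq; exact: PQS.
Qed.

Lemma smooth_fun_sub W W' (f : M -> C) : W' `<=` W -> smooth_fun W f -> smooth_fun W' f.
Proof. by move=> WW sf c sc; apply: csmooth_on_sub (sf c sc); exact: coord_image_sub. Qed.

(** Formulated at a point, through some neighbourhood, so that restriction and gluing are immediate
    for the sheaf it cuts out. *)
Definition ae_smooth_at (u : M -> C) (q : M) : Prop := exists (W : set M) (g : M -> C),
  [/\ open W, W q, smooth_fun W g & ae_on W (fun r => u r = g r)].

Lemma ae_smooth_congr W (u v : M -> C) q : open W -> W q -> (forall r, W r -> u r = v r) ->
  ae_smooth_at u q -> ae_smooth_at v q.
Proof.
move=> oW Wq uv [W' [g [oW' W'q sg ug]]]; exists (W `&` W'), g; split => //.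
- exact: openI.
- by apply: smooth_fun_sub sg => r [].
have := ae_on_sub (@subIsetr _ W W') ug; move=> H.
by apply: (ae_on2 _ H H) => r [Wr _] <- _; rewrite uv.
Qed.

Lemma ae_smoothD (u v : M -> C) q : ae_smooth_at u q -> ae_smooth_at v q ->
  ae_smooth_at (fun r => u r + v r) q.
Proof.
move=> [W [g [oW Wq sg ug]]] [W' [g' [oW' W'q sg' ug']]].
exists (W `&` W'), (fun r => g r + g' r); have oI := openI oW oW'; split => //.
- move=> c sc; apply: csmooth_onD; first exact: coord_image_open.
    by apply: csmooth_on_sub (sg c sc); apply: coord_image_sub => r [].
  by apply: csmooth_on_sub (sg' c sc); apply: coord_image_sub => r [].
- by apply: ae_on2 (ae_on_sub (@subIsetl _ W W') ug) (ae_on_sub (@subIsetr _ W W') ug') => r _ -> ->.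
Qed.

Lemma ae_smoothM W f (v : M -> C) q : open W -> W q -> smooth_fun W f -> ae_smooth_at v q ->
  ae_smooth_at (fun r => f r * v r) q.
Proof.
move=> oW Wq sf [W' [g' [oW' W'q sg' ug']]].
exists (W `&` W'), (fun r => f r * g' r); have oI := openI oW oW'; split => //.
- move=> c sc; apply: csmooth_onM; first exact: coord_image_open.
    by apply: csmooth_on_sub (sf c sc); apply: coord_image_sub => r [].
  by apply: csmooth_on_sub (sg' c sc); apply: coord_image_sub => r [].
- have H := ae_on_sub (@subIsetr _ W W') ug'.
  by apply: (ae_on2 _ H H) => r _ -> _.
Qed.

Lemma ae_smooth_chart c q (G : set E) (u : M -> C) (gr gi : E -> R) :
  smooth_chart c -> chart_dom c q -> open G -> G (c q) -> G `<=` c @` chart_dom c ->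
  smooth_on G gr -> smooth_on G gi ->
  mu.-negligible (G `&` [set x | complex.Re (u (chart_inv c x)) <> gr x]) ->
  mu.-negligible (G `&` [set x | complex.Im (u (chart_inv c x)) <> gi x]) ->
  ae_smooth_at u q.
Proof.
move=> sc cq oG Gq Gc sr si nr ni.
have oW := chart_preimage_open c oG.
exists (chart_preimage c G), (fun r => Complex (gr (c r)) (gi (c r))); split => //.
  apply: (smooth_fun_chart oW sc); first by move=> r [].
  rewrite (coord_image_preimage Gc).
  split => /=.
    apply: (smooth_on_congr oG _ sr) => x Gx; have [r cr <-] := Gc x Gx.
    by rewrite chart_mapK.
  apply: (smooth_on_congr oG _ si) => x Gx; have [r cr <-] := Gc x Gx.
  by rewrite chart_mapK.
apply: (ae_on_chart oW sc); first by move=> r [].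
apply: negligibleS (negligibleU nr ni) => _ [r [[[cr Gr] ur] _] <-].
have [e1|e1] := pselect (complex.Re (u r) = gr (c r)); last first.
  by left; split => //=; rewrite chart_mapK.
right; split => //= e2; apply: ur; apply: complex_eq => //=.
by move: e2; rewrite chart_mapK.
Qed.

End charts.

Section jacobians.
Variables (R : realType) (n : nat) (M : smooth_manifold R n).
Local Notation E := 'rV[R]_n.
Local Notation C := R[i].
Local Notation mu := (@lebesgue_rV R n).
Implicit Types (c d e : chart R n M) (W : set M).

Lemma coord_jacobianE c d r i j : smooth_chart c -> smooth_chart d ->
  chart_dom c r -> chart_dom d r ->
  coord_jacobian c d r i j = partial i (fun y => transition c d y ord0 j) (c r).
Proof.
move=> sc sd cr dr.
have oW : open (chart_dom c `&` chart_dom d) by apply: openI; exact: chart_dom_open.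
have oD := coord_image_open (c := c) oW.
have T k : smooth_on (coord_image c (chart_dom c `&` chart_dom d))
    (fun x => transition c d x ord0 k).
  by apply: transition_smooth_image => // q [].
have [_] := @smooth_on_map_differentiable _ _ _ _ _ (c r) oD T (ex_intro2 _ _ r (conj (conj cr dr) cr) erefl).
by rewrite /coord_jacobian => ->; rewrite mxE.
Qed.

Lemma coord_jacobian_chain c d e r : smooth_chart c -> smooth_chart d -> smooth_chart e ->
  chart_dom c r -> chart_dom d r -> chart_dom e r ->
  coord_jacobian c d r *m coord_jacobian d e r = coord_jacobian c e r.
Proof.
move=> sc sd se cr dr er; apply/matrixP => i j; rewrite mxE.
pose W := chart_dom c `&` chart_dom d `&` chart_dom e.
have oW : open W by do !apply: openI; exact: chart_dom_open.
have Wr : W r by [].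
have oD := coord_image_open (c := c) oW; have oD' := coord_image_open (c := d) oW.
have T k : smooth_on (coord_image c W) (fun x => transition c d x ord0 k).
  by apply: transition_smooth_image => // q [[]].
have T' : smooth_on (coord_image d W) (fun x => transition d e x ord0 j).
  by apply: transition_smooth_image => // q [[]].
have Dr : coord_image c W (c r) by exists r.
apply: etrans (esym (coord_jacobianE i j sc se cr er)).
have E0 x : coord_image c W x -> transition c e x = transition d e (transition c d x).
  by move=> [q [[[cq dq] eq] _] <-]; rewrite /transition !chart_mapK.
rewrite (@partial_congr _ _ _ _ (fun x => transition d e (transition c d x) ord0 j) _ _ oD _ Dr); last first.
  by move=> y Dy; rewrite E0.
have Tr : transition c d (c r) = d r by rewrite /transition chart_mapK.
have Dr' : coord_image d W (transition c d (c r)) by rewrite Tr; exists r.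
have [df dfE] := smooth_on_differentiable oD' T' Dr'.
have dT k : derivable (fun y => transition c d y ord0 k) (c r) (delta_mx ord0 i).
  by have [_] := T k [::] (c r) Dr; exact.
have [[_ H1] H2] := chain_rule df dT.
rewrite [RHS]H1 dfE; apply: eq_bigr => k _.
rewrite H2 Tr.
exact: (congr2 *%R (coord_jacobianE i k sc sd cr dr) (coord_jacobianE k j sd se dr er)).
Qed.

Lemma coord_jacobian_id c r : smooth_chart c -> chart_dom c r -> coord_jacobian c c r = 1%:M.
Proof.
move=> sc cr; apply/matrixP => i j; rewrite coord_jacobianE// mxE.
have oW : open (chart_dom c) by exact: chart_dom_open.
have oD := coord_image_open (c := c) oW.
have Dr : coord_image c (chart_dom c) (c r) by exists r.
rewrite (@partial_congr _ _ _ _ (fun x => x ord0 j) _ _ oD _ Dr); last first.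
  by move=> _ [q [cq _] <-]; rewrite /transition chart_mapK.
rewrite /partial; have [_ ->] := is_derive_coord (c r) j (delta_mx ord0 i).
by rewrite mxE eqxx eq_sym.
Qed.

(** Vectors and covectors transform by Jacobians in opposite directions, and these cancel by the
    chain rule. *)
Lemma pairing_coord c (w X : M -> 'rV[C]_n) r : smooth_chart c -> chart_dom c r ->
  pairing (w r) (X r) = \sum_(j < n) form_coord c w r ord0 j * vfield_coord c X r ord0 j.
Proof.
move=> sc cr.
have pE (a b : 'rV[C]_n) : \sum_(i < n) a ord0 i * b ord0 i = (a *m b^T) ord0 ord0.
  by rewrite mxE; apply: eq_bigr => i _; rewrite mxE.
rewrite /pairing !pE /form_coord /vfield_coord trmx_mul mulmxA -[w r *m _ *m _]mulmxA -trmx_mul.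
rewrite -map_mxM (coord_jacobian_chain (smooth_chart_at r) sc (smooth_chart_at r)
  (chart_at_dom r) cr (chart_at_dom r)).
rewrite (coord_jacobian_id (smooth_chart_at r) (chart_at_dom r)).
by rewrite map_mx1 trmx1 mulmx1.
Qed.

Lemma vfield_coord_real c (X : M -> 'rV[R]_n) r :
  vfield_coord c (real_vfield X) r = cplx (X r *m coord_jacobian (chart_at r) c r).
Proof. by rewrite /vfield_coord /real_vfield /cplx map_mxM. Qed.

Definition real_coord c (X : M -> 'rV[R]_n) (j : 'I_n) (x : E) : R :=
  complex.Re (vfield_coord c (real_vfield X) (chart_inv c x) ord0 j).

Lemma pairing_real_coord c (w : M -> 'rV[C]_n) (X : M -> 'rV[R]_n) r :
  smooth_chart c -> chart_dom c r ->
  pairing (w r) (real_vfield X r) =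
  \sum_(j < n) form_coord c w r ord0 j * real_complex R (real_coord c X j (c r)).
Proof.
move=> sc cr; rewrite (pairing_coord _ _ sc cr); apply: eq_bigr => j _; congr (_ * _).
by rewrite /real_coord chart_mapK// vfield_coord_real /cplx mxE.
Qed.

End jacobians.

(** * Characteristic forms *)

Section local_data.
Variables (R : realType) (n : nat) (M : smooth_manifold R n).
Local Notation E := 'rV[R]_n.
Local Notation C := R[i].
Local Notation mu := (@lebesgue_rV R n).
Local Notation Re := complex.Re.
Local Notation Im := complex.Im.

Lemma negligible_exists (I : countType) (A : I -> set E) :
  (forall i, mu.-negligible (A i)) -> mu.-negligible [set x | exists i, A i x].
Proof.
move=> H; pose F k : set E := if unpickle k is Some i then A i else set0.
have FE i : F (pickle i) = A i by rewrite /F pickleK.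
have : mu.-negligible (\bigcup_k F k).
  by apply: negligible_bigcup => k; rewrite /F; case: unpickle => [i|] //; exact: negligible_set0.
by move: F FE => F FE; apply: negligibleS => x [i Ax]; exists (pickle i); rewrite ?FE.
Qed.

Variables (U : set M) (X : M -> 'rV[R]_n).
Hypotheses (oU : open U) (bX : locally_bounded_measurable U X).

(** Provides a ball on which the components of [X] are bounded and agree almost everywhere with
    Borel functions of bounded support. The radius is at most [pi / 2] so that the ball fits the
    Fourier argument. *)
Lemma local_vfield (c : chart R n M) q (G : set E) : smooth_chart c -> U q -> chart_dom c q ->
  open G -> G (c q) -> exists (r B : R) (Xb : 'I_n -> E -> R),
  [/\ 0 < r /\ r <= pi / 2, ball (c q) r `<=` G `&` coord_image c U,
     forall j x, ball (c q) r x -> `|real_coord c X j x| <= B,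
     forall j, bounded_supp (Xb j) &
     mu.-negligible (ball (c q) r `&` [set x | exists j, real_coord c X j x <> Xb j x])].
Proof.
move=> sc Uq cq oG Gq; have [mX /(_ q Uq cq) [W [B [oW Wq WB]]]] := bX sc.
pose G' := G `&` coord_image c (U `&` W).
have oG' : open G' by apply: openI => //; apply: coord_image_open; exact: openI.
have G'q : G' (c q) by split => //; exists q.
have /nbhs_ballP[r0 /= r00 r0G] : nbhs (c q) G' by exact: open_nbhs_nbhs.
have pi0 := pi_gt0 R.
pose r := Num.min r0 (pi / 2).
have r0' : 0 < r by rewrite lt_min r00 divr_gt0.
have rG : ball (c q) r `<=` G'.
  by apply: subset_trans r0G; apply: le_ball; rewrite ge_min lexx.
have XB j x : ball (c q) r x -> `|real_coord c X j x| <= B.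
  move=> /rG [_ /coord_imageP [[s cs <-]]]; rewrite chart_mapK// => -[Us Ws] _.
  by rewrite /real_coord chart_mapK//; exact: WB.
have B0 (j : 'I_n) : 0 <= B := le_trans (normr_ge0 _) (XB j (c q) (ballxx _ r0')).
have mU : measurable (coord_image c U).
  by apply: open_measurable_rV; exact: coord_image_open.
have mb : measurable (ball (c q) r) by exact: measurable_coord_ball.
have H j : exists (f : E -> R), bounded_supp f /\
    mu.-negligible (ball (c q) r `&` [set x | real_coord c X j x <> f x]).
  have [N [f0 [mN N0 mf0 f0E]]] := lebesgue_measurable_borel mU (mX j).
  exists (fun x => \1_(ball (c q) r) x * f0 x); split.
    split; first by apply: measurable_funM => //; exact: measurable_indic_rV.
    exists (`|c q| + r), B => x; split.
      rewrite indicE; have [bx|bx] := pselect (ball (c q) r x); last first.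
        by rewrite memNset// mul0r normr0; exact: B0 j.
      rewrite mem_set// mul1r f0E; case: ifP => _; last by rewrite normr0; exact: B0 j.
      exact: XB.
    apply: (@ball_supp_norm _ _ (c q) (fun x => \1_(ball (c q) r) x * f0 x) r) => y by_.
    by rewrite indicE memNset ?mul0r.
  have : mu.-negligible N by exists N; split.
  apply: negligibleS => x [bx /= fx]; apply: contrapT => Nx; apply: fx.
  rewrite indicE mem_set// mul1r f0E mem_set//; split => //.
  by have [_ ] := rG _ bx; apply: coord_image_sub => s [].
have /choice[Xb HXb] := H.
exists r, B, Xb; split => //.
- by rewrite r0' ge_min lexx orbT.
- by apply: subset_trans rG _ => x [Gx Ix]; split => //; apply: coord_image_sub Ix => s [].
- by move=> j; have [] := HXb j.
have : mu.-negligible [set x | exists j, (ball (c q) r `&` [set x | real_coord c X j x <> Xb j x]) x].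
  by apply: negligible_exists => j; have [] := HXb j.
by apply: negligibleS => x [bx [j xj]]; exists j.
Qed.

Lemma pairing_parts (c : chart R n M) (w : M -> 'rV[C]_n) r : smooth_chart c -> chart_dom c r ->
  Re (pairing (w r) (real_vfield X r)) =
    \sum_j Re (form_coord c w r ord0 j) * real_coord c X j (c r) /\
  Im (pairing (w r) (real_vfield X r)) =
    \sum_j Im (form_coord c w r ord0 j) * real_coord c X j (c r).
Proof.
move=> sc cr; rewrite (pairing_real_coord _ _ sc cr) Re_sum Im_sum; split; apply: eq_bigr => j _.
  by rewrite cReM /= mulr0 subr0.
by rewrite cImM /= mulr0 add0r.
Qed.

(** The components from [local_vfield] are multiplied by the coefficients of [w]; halving the radius
    puts the ball in a compact set where these smooth coefficients are bounded. *)
Lemma local_pairing (c : chart R n M) W (w : M -> 'rV[C]_n) q (G : set E) :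
  smooth_chart c -> open W -> W `<=` U -> smooth_form W w -> W q -> chart_dom c q ->
  open G -> G (c q) -> exists (r B : R) (ur ui : E -> R),
  let u x := pairing (w (chart_inv c x)) (real_vfield X (chart_inv c x)) in
  [/\ 0 < r /\ r <= pi / 2, ball (c q) r `<=` G `&` coord_image c W,
     forall x, ball (c q) r x -> `|Re (u x)| <= B /\ `|Im (u x)| <= B,
     bounded_supp ur /\ bounded_supp ui &
     mu.-negligible (ball (c q) r `&` [set x | Re (u x) <> ur x]) /\
     mu.-negligible (ball (c q) r `&` [set x | Im (u x) <> ui x])].
Proof.
move=> sc oW WU sw Wq cq oG Gq.
pose G' := G `&` coord_image c W.
have oG' : open G' by apply: openI => //; exact: coord_image_open.
have G'q : G' (c q) by split => //; exists q.
have [r1 [B [Xb [[r10 r1p] r1G XB bXb nXb]]]] := local_vfield sc (WU q Wq) cq oG' G'q.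
pose a (k : bool) j x : R := (if k then @complex.Re R else @complex.Im R) (form_coord c w (chart_inv c x) ord0 j).
have sa k j : smooth_on (coord_image c W) (a k j) by have [h1 h2] := sw c sc j; case: k; [exact: h1|exact: h2].
pose r := r1 / 2; have r0 : 0 < r by rewrite divr_gt0.
have rr1 : r < r1 by rewrite /r; lra.
have bW : ball (c q) r1 `<=` coord_image c W by move=> x /r1G [[]].
have br : ball (c q) r `<=` ball (c q) r1 by apply: le_ball; exact: ltW.
have /choice[A HA] : forall kj : bool * 'I_n, exists A : R, forall x, ball (c q) r x ->
    `|a kj.1 kj.2 x| <= A.
  by move=> [k j]; exact: (smooth_bounded r10 bW rr1 r0 (sa k j)).
have mb : measurable (ball (c q) r) by exact: measurable_coord_ball.
pose v k x : R := \sum_j ((a k j \_ (ball (c q) r)) x * Xb j x).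
have bv k : bounded_supp (v k).
  apply: bounded_supp_sum => j _; apply: bounded_suppM => //.
    apply/(measurable_restrictT _ mb); apply: continuous_measurable_rV; first exact: ball_open.
    by move=> x bx; apply: (smooth_on_continuous (sa k j)); exact/bW/br.
  exists `|A (k, j)| => x; rewrite patchE; case: ifPn => [/set_mem bx|_]; last by rewrite normr0.
  exact: le_trans (HA (k, j) x bx) (ler_norm _).
have uE x : ball (c q) r x ->
    Re (pairing (w (chart_inv c x)) (real_vfield X (chart_inv c x))) =
      \sum_j a true j x * real_coord c X j x /\
    Im (pairing (w (chart_inv c x)) (real_vfield X (chart_inv c x))) =
      \sum_j a false j x * real_coord c X j x.
  move=> /br /bW [s [Ws cs] <-].
  by rewrite chart_mapK//; have [-> ->] := pairing_parts w sc cs; rewrite /a chart_mapK.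
have nv k : mu.-negligible (ball (c q) r `&`
    [set x | \sum_j a k j x * real_coord c X j x <> v k x]).
  apply: negligibleS nXb => x [bx /= ux]; split; first exact: br.
  apply: contrapT => /forallNP H; apply: ux; apply: eq_bigr => j _.
  by rewrite patchE mem_set//; congr (_ * _); exact: contrapT (H j).
pose S k := \sum_j `|A (k, j)| * `|B|.
have S0 k : 0 <= S k by apply: sumr_ge0 => j _; rewrite mulr_ge0.
exists r, (S true + S false), (v true), (v false); split => //.
- by split => //; apply: le_trans (ltW rr1) r1p.
- by move=> x /br /r1G [[]].
- have SB k x : ball (c q) r x -> `|\sum_j a k j x * real_coord c X j x| <=
      S true + S false.
    move=> bx; apply: (@le_trans _ _ (S k)).
      apply: le_trans (ler_norm_sum _ _ _) _; apply: ler_sum => j _; rewrite normrM.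
      apply: ler_pM => //; first exact: le_trans (HA (k, j) x bx) (ler_norm _).
      exact: le_trans (XB j x (br x bx)) (ler_norm _).
    by case: k; rewrite ?lerDl ?lerDr S0.
  by move=> x bx; have [-> ->] := uE x bx; split; exact: SB.
split.
  by apply: negligibleS (nv true) => x [bx /= ux]; split => //=; have [<- _] := uE x bx.
by apply: negligibleS (nv false) => x [bx /= ux]; split => //=; have [_ <-] := uE x bx.
Qed.

End local_data.

Section characteristic_step.
Variables (R : realType) (n : nat).
Local Notation E := 'rV[R]_n.
Local Notation C := R[i].
Local Notation mu := (@lebesgue_rV R n).
Local Notation Re := complex.Re.
Local Notation Im := complex.Im.

Lemma Re_norm_ge (z : C) : `|Re z| <= Re `|z| /\ `|Im z| <= Re `|z|.
Proof.
rewrite normc_def /= -!sqrtr_sqr; split; rewrite ler_wsqrtr//.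
  by rewrite lerDl sqr_ge0.
by rewrite lerDr sqr_ge0.
Qed.

Lemma fint_pihalf (v : E -> R) xi th : bounded_supp v ->
  fint v xi th = cos th * fint v xi 0 + sin th * fint v xi (pi / 2).
Proof.
move=> bv; rewrite (fint_cos_sin xi th bv) (fint_cos_sin xi (pi / 2) bv).
by rewrite cos_pihalf sin_pihalf; ring.
Qed.

(** For real [u] the real and imaginary parts of the Fourier integral are [fint] at the phases 0 and
    [pi / 2], as [- sin] is the cosine shifted by [pi / 2]. Every other phase is a combination of
    these with coefficients [cos th] and [sin th], whence the factor 2. *)
Lemma microlocal_real (D : set E) (u : E -> C) (ur : E -> R) (x0 xi : E) : open D ->
  bounded_supp ur -> (forall x, D x -> Im (u x) = 0) ->
  mu.-negligible (D `&` [set x | Re (u x) <> ur x]) ->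
  microlocally_smooth D u x0 xi ->
  exists (phi : E -> R) (G : set E),
    [/\ test_function D phi, phi x0 != 0, open G /\ G xi,
      forall (t : R) (eta : E), 0 < t -> G eta -> G (t *: eta) &
      rapid_on G (fun x => phi x * ur x)].
Proof.
move=> oD bu u0 [N [mN N0 NN]] [phi [G [tphi phix oG cG H]]].
exists phi, G; split => // m; have [B HB] := H m.
have [sphi [K [cK KD phi0]]] := tphi.
have phiD x : ~ D x -> phi x = 0 by move=> Dx; apply: phi0 => /KD.
have bphi : exists A : R, forall x, `|phi x| <= A.
  have [[rK [_ HK]]] : bounded_set K /\ True by split => //; exact: compact_bounded.
  have cphi : continuous phi by move=> x; exact: smooth_on_continuous sphi I.
  have [_ [r [A HA]]] : bounded_supp phi.
    apply: (@continuous_bounded_supp _ _ phi (rK + 2) cphi) => x rx.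
    apply: phi0 => Kx; have := HK (rK + 1) _ x Kx; rewrite /= ltrDl ltr01 => /(_ isT); lra.
  by exists A => x; have [] := HA x.
have bv : bounded_supp (fun x => phi x * ur x).
  by apply: bounded_suppM => //; exact: smooth_measurable.
have restr (f : E -> R) th eta :
    (forall x, D x -> ~ N x -> f x = trig eta th x * (phi x * ur x)) ->
    \int[mu]_(x in D) f x = fint (fun x => phi x * ur x) eta th.
  move=> fE; rewrite (Rintegral_ae_eq mN N0 fE) Rintegral_mkcond /fint /integ.
  apply: eq_Rintegral => x _; rewrite patchE; case: ifPn => // /negP Dx.
  by rewrite phiD ?mul0r ?mulr0// => Dx'; apply: Dx; exact/mem_set.
have FE eta : Re (fourier D (fun y => real_complex R (phi y) * u y) eta) =
      fint (fun x => phi x * ur x) eta 0 /\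
    Im (fourier D (fun y => real_complex R (phi y) * u y) eta) =
      fint (fun x => phi x * ur x) eta (pi / 2).
  have uE x : D x -> ~ N x -> Re (u x) = ur x.
    by move=> Dx Nx; apply: contrapT => ux; apply: Nx; apply: NN.
  split; rewrite /fourier /cintegral /=; apply: restr => x Dx Nx.
    rewrite cReM cReM cImM /= !mul0r u0// mulr0 addr0 mulr0 !subr0 uE//.
    by rewrite /trig addr0.
  rewrite cImM cReM cImM /= !mul0r u0// mulr0 addr0 mulr0 !subr0 uE// add0r.
  by rewrite /trig cosDpihalf.
exists (2 * B) => eta th Geta.
rewrite (fint_pihalf eta th bv).
have [E1 E2] := FE eta.
have [] := Re_norm_ge (fourier D (fun y => real_complex R (phi y) * u y) eta).
rewrite E1 E2 => n1 n2.
apply: (@le_trans _ _ (2 * Re `|fourier D (fun y => real_complex R (phi y) * u y) eta| *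
   (1 + `|eta|) ^+ m)); last by rewrite -mulrA ler_wpM2l// HB.
rewrite ler_wpM2r ?exprn_ge0 ?addr_ge0//.
apply: le_trans (ler_normD _ _) _; rewrite !normrM.
have c1 := cos_max th; have c2 := sin_max th.
have := ler_pM (normr_ge0 _) (normr_ge0 _) c1 n1.
have := ler_pM (normr_ge0 _) (normr_ge0 _) c2 n2.
lra.
Qed.

Variables (M : smooth_manifold R n) (V : involutive_structure M).
Variables (U : set M) (X : M -> 'rV[R]_n).
Hypotheses (oU : open U) (bX : locally_bounded_measurable U X).

(** The midpoint of two opposite covectors is 0. *)
Lemma convex_cone_no_antipodal (G : set E) (xi : E) : G `<=` [set xi | xi != 0] ->
  convex_set (G : set (convex_lmodType E)) -> G xi -> G (- xi) -> False.
Proof.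
move=> G0 cG Gx Gnx.
have h0 : (0 : R) <= 2^-1 by rewrite invr_ge0.
have h1 : (2^-1 : R) <= 1 by lra.
have H : G (2^-1 *: xi + (1 - 2^-1) *: (- xi)).
  exact: set_mem (cG xi (- xi) (Itv01 h0 h1) (mem_set Gx) (mem_set Gnx)).
have := G0 _ H; rewrite /= scalerN -scalerBl.
have -> : (2^-1 : R) - (1 - 2^-1) = 0 by field.
by rewrite scale0r eqxx.
Qed.

(** For each [xi] one of [xi], [- xi] lies outside the cone, hence is a direction of rapid decay;
    since [w(X)] is real, decay at [- xi] is decay at [xi] with the opposite phase. This is the
    hypothesis of [elliptic_smooth]. *)
Lemma characteristic_smooth W w q : extends_microlocally V U X -> open W ->
  characteristic_section V W w -> W q -> U q ->
  ae_smooth_at (fun r => pairing (w r) (real_vfield X r)) q.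
Proof.
move=> eX oW [[sw aw] cw] Wq Uq.
pose c := chart_at q; have sc : smooth_chart c by exact: smooth_chart_at.
have cq : chart_dom c q by exact: chart_at_dom.
pose W' := W `&` U; have oW' : open W' by exact: openI.
have sw' : smooth_form W' w.
  by move=> d sd j; apply: csmooth_on_sub (sw d sd j); apply: coord_image_sub => r [].
have [r [B [ur [ui [[r0 rp] rW uB [bur bui] [nr ni]]]]]] :=
  local_pairing oU bX sc oW' (@subIsetr _ W U) sw' (conj Wq Uq) cq (@openT _) I.
pose D : set E := ball (c q) r.
have oD : open D by exact: ball_open.
have DW : D `<=` coord_image c W' by move=> x /rW [].
have Dc : D `<=` c @` chart_dom c by move=> x /DW [s [_ cs] <-]; exists s.
(* The wave front set is taken over a neighbourhood whose coordinate image is exactly the ball [D],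
   so the cutoffs it provides are test functions on [D]. *)
pose W1 := chart_preimage c D.
have oW1 : open W1 by exact: chart_preimage_open.
have W1W : W1 `<=` W'.
  by move=> s [cs /DW [t [Wt ct] ts]]; rewrite -(chart_mapK cs) -ts chart_mapK.
have uI s : W1 s -> Im (pairing (w s) (real_vfield X s)) = 0.
  move=> /W1W [Ws _]; have [xi _ ->] := cw s Ws.
  rewrite /pairing Im_sum big1// => i _.
  by rewrite /real_vfield /cplx !mxE cImM /= mulr0 mul0r addr0.
have DI x : D x -> Im (pairing (w (chart_inv c x)) (real_vfield X (chart_inv c x))) = 0.
  by move=> Dx; have [s cs sx] := Dc x Dx; rewrite -sx chart_mapK// uI//; split => //=; rewrite sx.
have [G [Gc cG coneG _ /(_ W1 w oW1)]] := eX q Uq.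
have W1q : W1 q by split => //; exact: ballxx.
move=> /(_ W1q (subset_trans W1W (@subIsetr _ W U))) HG.
have {}HG : wave_front W1 (fun r => pairing (w r) (real_vfield X r)) q `<=` G.
  apply: HG; split; last by move=> s /W1W [Ws _]; exact: aw.
  move=> d sd j; apply: csmooth_on_sub (sw d sd j).
  by apply: coord_image_sub => s /W1W [].
have micro (xi : E) : xi != 0 -> ~ G xi ->
    microlocally_smooth D (fun x => pairing (w (chart_inv c x)) (real_vfield X (chart_inv c x)))
      (c q) xi.
  move=> xi0 Gxi; apply: contrapT => Hm; apply: Gxi; apply: HG; split => //.
  by rewrite /W1 (coord_image_preimage Dc).
have [D' [g [oD' D'q D'D sg ng]]] : exists (D' : set E) (g : E -> R),
    [/\ open D', D' (c q), D' `<=` D, smooth_on D' g & mu.-negligible (D' `&` [set x | ur x <> g x])].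
  apply: (elliptic_smooth oD) => //.
  - by apply: le_ball.
  - exact: ballxx.
  move=> xi xi0; have [Gxi|Gxi] := pselect (G xi); last first.
    exact: microlocal_real oD bur DI nr (micro xi xi0 Gxi).
  have Gnxi : ~ G (- xi).
    by apply: (convex_cone_no_antipodal _ cG Gxi) => eta /Gc [].
  have nxi0 : - xi != 0 by rewrite oppr_eq0.
  have [phi [G1 [tphi phi0 [oG1 G1xi] cG1 rG1]]] :=
    microlocal_real oD bur DI nr (micro (- xi) nxi0 Gnxi).
  exists phi, [set eta | G1 (- eta)]; split => //.
  - split => //; apply: (@open_comp _ _ (fun eta : E => - eta) G1) => // eta _.
    exact: opp_continuous.
  - by move=> t eta t0 /=; rewrite -scalerN; exact: cG1.
  - move=> m; have [B1 HB1] := rG1 m; exists B1 => eta th /= Geta.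
    by have := HB1 (- eta) (- th) Geta; rewrite fintN opprK normrN.
apply: (ae_smooth_chart sc cq oD' D'q (subset_trans D'D Dc) sg (smooth_on_cst 0)).
- apply: negligibleS (negligibleU nr ng) => x [D'x /= ux].
  have [e1|e1] := pselect (ur x = g x); last by right.
  by left; split; [exact: D'D|rewrite /= e1].
apply: negligibleS (negligible_set0 _) => x [D'x /=]; rewrite DI//; exact: D'D.
Qed.

End characteristic_step.

(** * Lie derivatives of forms *)

Section weak_to_strong.
Variables (R : realType) (n : nat).
Local Notation E := 'rV[R]_n.
Local Notation mu := (@lebesgue_rV R n).

Lemma test_function_bounded_supp (D : set E) (phi : E -> R) : test_function D phi ->
  bounded_supp phi /\ exists r : R, forall x, r <= `|x| -> phi x = 0.
Proof.
move=> [sphi [K [cK KD phi0]]].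
have [rK [_ HK]] : bounded_set K by exact: compact_bounded.
have cphi : continuous phi by move=> x; exact: smooth_on_continuous sphi I.
have z x : rK + 2 <= `|x| -> phi x = 0.
  move=> rx; apply: phi0 => Kx; have := HK (rK + 1) _ x Kx.
  by rewrite /= ltrDl ltr01 => /(_ isT); lra.
by split; [exact: continuous_bounded_supp cphi z|exists (rK + 2)].
Qed.

(** The functions [a] and [b] are smooth on [D] only; every product that occurs contains a factor
    vanishing off the compact support of [phi] and so extends smoothly by 0. *)
Lemma integ_by_parts (D : set E) (a b phi : E -> R) i : open D ->
  smooth_on D a -> smooth_on D b -> test_function D phi ->
  [/\ bounded_supp ((fun x => a x * partial i (fun y => b y * phi y) x) \_ D),
    bounded_supp ((fun x => partial i a x * b x * phi x) \_ D) &
    integ ((fun x => a x * partial i (fun y => b y * phi y) x) \_ D) =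
    - integ ((fun x => partial i a x * b x * phi x) \_ D)].
Proof.
move=> oD sa sb tphi; have [_ [r rphi]] := test_function_bounded_supp tphi.
have [sphi [K [cK KD phi0]]] := tphi.
have clK : closed K by apply: compact_closed => //; exact: norm_hausdorff.
have sbp : smooth_on setT (fun y => b y * phi y).
  exact: smooth_on_extend sb sphi phi0.
have bp0 x : ~ K x -> b x * phi x = 0 by move=> /phi0 ->; rewrite mulr0.
have pbp0 x : ~ K x -> partial i (fun y => b y * phi y) x = 0.
  move=> Kx; rewrite (@partial_congr _ _ _ _ (fun=> 0) _ _ (closed_openC clK) _ Kx)//.
  by rewrite /partial derive_cst.
have s1 : smooth_on setT (fun x => a x * partial i (fun y => b y * phi y) x).
  exact: smooth_on_extend sa (smooth_on_partial i sbp) pbp0.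
have s2 : smooth_on setT (fun x => partial i a x * b x * phi x).
  exact: (smooth_on_extend oD clK KD (smooth_onM oD (smooth_on_partial i sa) sb) sphi phi0).
have s3 : smooth_on setT (fun x => a x * (b x * phi x)).
  exact: smooth_on_extend sa sbp bp0.
have supp (f : E -> R) : smooth_on setT f -> (forall x, ~ K x -> f x = 0) ->
    f \_ D = f /\ bounded_supp f.
  move=> sf f0; split.
    apply/funext => x; rewrite patchE; case: ifPn => // /negP Dx.
    by rewrite f0// => /KD Dx'; apply: Dx; exact/mem_set.
  have [rK [_ HK]] : bounded_set K by exact: compact_bounded.
  have cf : continuous f by move=> x; exact: smooth_on_continuous sf I.
  apply: (@continuous_bounded_supp _ _ f (rK + 2) cf) => x rx.
  apply: f0 => Kx; have := HK (rK + 1) _ x Kx.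
  by rewrite /= ltrDl ltr01 => /(_ isT); lra.
have [-> b1] := supp _ s1 (fun x Kx => etrans (congr1 _ (pbp0 x Kx)) (mulr0 _)).
have [-> b2] := supp _ s2 (fun x Kx => etrans (congr1 _ (phi0 x Kx)) (mulr0 _)).
split => //.
have z3 x : r <= `|x| -> a x * (b x * phi x) = 0 by move=> /rphi ->; rewrite !mulr0.
have [_ I3] := integ_partial i s3 z3.
apply/eqP; rewrite -addr_eq0 -integD//; apply/eqP; rewrite -[RHS]I3.
congr integ; apply/funext => x; have [Dx|Dx] := pselect (D x).
  have sbp' : smooth_on D (fun y => b y * phi y) by exact: smooth_on_sub sbp.
  by rewrite (partialM i oD sa sbp' Dx); ring.
have Kx : ~ K x by move=> /KD.
rewrite pbp0// phi0// !mulr0 addr0.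
rewrite (@partial_congr _ _ _ _ (fun=> 0) _ _ (closed_openC clK) _ Kx).
  by rewrite /partial derive_cst.
by move=> y Ky; rewrite bp0// mulr0.
Qed.

(** For smooth [a1] and [a2] the weak equation may be integrated by parts, and the fundamental lemma
    identifies [v] with the pointwise derivative [g]. Two pairs of a function and a field occur
    because the real or imaginary part of a complex derivative combines two real ones. *)
Lemma weak_to_strong (D : set E) (a1 a2 v : E -> R) (l1 l2 : 'I_n -> E -> R) (B : R) :
  let g x := \sum_i (partial i a1 x * l1 i x + partial i a2 x * l2 i x) in
  open D -> smooth_on D a1 -> smooth_on D a2 -> (forall i, smooth_on D (l1 i)) ->
  (forall i, smooth_on D (l2 i)) -> bounded_supp v ->
  (forall x, D x -> `|g x| <= B) -> (exists r : R, forall x, D x -> `|x| < r) ->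
  (forall phi, test_function D phi ->
    - (\int[mu]_(x in D) (a1 x * (\sum_i partial i (fun y => l1 i y * phi y) x) +
        a2 x * (\sum_i partial i (fun y => l2 i y * phi y) x))) =
    \int[mu]_(x in D) (v x * phi x)) ->
  smooth_on D g /\ mu.-negligible (D `&` [set x | v x <> g x]).
Proof.
move=> g oD s1 s2 sl1 sl2 bv gB [r Dr] H.
have sg : smooth_on D g.
  pose G i (x : E) := partial i a1 x * l1 i x + partial i a2 x * l2 i x.
  have sG i : xpredT i -> smooth_on D (G i).
    move=> _; exact: (smooth_onD oD (smooth_onM oD (smooth_on_partial i s1) (sl1 i))
      (smooth_onM oD (smooth_on_partial i s2) (sl2 i))).
  exact: (smooth_on_sum (index_enum 'I_n) oD sG).
split; first exact: sg.
have mD : measurable D by exact: open_measurable_rV.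
have bg : bounded_supp (g \_ D).
  split.
    apply/(measurable_restrictT _ mD); apply: continuous_measurable_rV => // x Dx.
    exact: smooth_on_continuous sg Dx.
  exists r, `|B| => x; rewrite patchE; split.
    case: ifPn => [/set_mem Dx|_]; last by rewrite normr0.
    exact: le_trans (gB x Dx) (ler_norm _).
  by case: ifPn => // /set_mem /Dr; rewrite ltNge => /negP.
have bvD : bounded_supp (v \_ D).
  have -> : v \_ D = fun x => \1_D x * v x.
    by apply/funext => x; rewrite patchE indicE; case: (x \in D); rewrite ?mul1r ?mul0r.
  by apply: bounded_suppM => //; exists 1 => x; exact: indic_bound.
pose h x := (v \_ D) x - (g \_ D) x.
have bh : bounded_supp h.
  have := bounded_suppD bvD (bounded_suppZ (-1) bg).
  by under eq_fun do rewrite mulN1r.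
apply: negligibleS (fundamental_lemma oD bh _).
  move=> x [Dx /= vg]; split => //=; rewrite /h !patchE mem_set//.
  by move=> /eqP; rewrite subr_eq0 => /eqP.
move=> phi tphi; have [bphi _] := test_function_bounded_supp tphi.
have [_ [rA [A HA]]] := bphi.
have mphi : measurable_fun setT phi by have [] := bphi.
have bp f : bounded_supp f -> bounded_supp (fun x => phi x * f x).
  by move=> bf; apply: bounded_suppM => //; exists A => x; have [] := HA x.
have -> : (fun x => phi x * h x) = fun x => phi x * (v \_ D) x - phi x * (g \_ D) x.
  by apply/funext => x; rewrite mulrBr.
rewrite integB; [|exact: bp..]; apply/eqP; rewrite subr_eq0; apply/eqP.
have -> : integ (fun x => phi x * (v \_ D) x) = \int[mu]_(x in D) (v x * phi x).
  rewrite Rintegral_mkcond; apply: eq_Rintegral => x _.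
  by rewrite !patchE; case: ifP; rewrite ?mulr0// mulrC.
rewrite -(H phi tphi) Rintegral_mkcond.
have P1 i := integ_by_parts i oD s1 (sl1 i) tphi.
have P2 i := integ_by_parts i oD s2 (sl2 i) tphi.
pose F (a : E -> R) (l : 'I_n -> E -> R) i := (fun x => a x * partial i (fun y => l i y * phi y) x) \_ D.
pose F' (a : E -> R) (l : 'I_n -> E -> R) i := (fun x => partial i a x * l i x * phi x) \_ D.
have -> : \int[mu]_x ((fun x => a1 x * (\sum_i partial i (fun y => l1 i y * phi y) x) +
        a2 x * (\sum_i partial i (fun y => l2 i y * phi y) x)) \_ D) x =
    integ (fun x => \sum_i (F a1 l1 i x + F a2 l2 i x)).
  apply: eq_Rintegral => x _; rewrite /F patchE; case: ifP => Dx.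
    by rewrite !mulr_sumr -big_split; apply: eq_bigr => i _; rewrite !patchE Dx.
  by rewrite big1// => i _; rewrite !patchE Dx addr0.
have -> : (fun x => phi x * (g \_ D) x) = (fun x => \sum_i (F' a1 l1 i x + F' a2 l2 i x)).
  apply/funext => x; rewrite /F' patchE; case: ifP => Dx.
    by rewrite mulr_sumr; apply: eq_bigr => i _; rewrite !patchE Dx; ring.
  by rewrite mulr0 big1// => i _; rewrite !patchE Dx addr0.
rewrite !integ_sum; last 2 first.
- by move=> i _; apply: bounded_suppD; [have [_ + _] := P1 i|have [_ + _] := P2 i].
- by move=> i _; apply: bounded_suppD; [have [+ _ _] := P1 i|have [+ _ _] := P2 i].
rewrite -sumrN; apply: eq_bigr => i _.
have [b1 b2 e1] := P1 i; have [b3 b4 e2] := P2 i.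
by rewrite !integD// e1 e2; ring.
Qed.

End weak_to_strong.

Section lie_step.
Variables (R : realType) (n : nat) (M : smooth_manifold R n) (V : involutive_structure M).
Local Notation E := 'rV[R]_n.
Local Notation C := R[i].
Local Notation mu := (@lebesgue_rV R n).
Local Notation Re := complex.Re.
Local Notation Im := complex.Im.
Variables (U : set M) (X : M -> 'rV[R]_n).
Hypotheses (oU : open U) (bX : locally_bounded_measurable U X).

Lemma bundle_section_sub W W' L : W' `<=` W -> bundle_section V W L -> bundle_section V W' L.
Proof.
move=> WW [sL VL]; split; last by move=> r /WW; exact: VL.
by move=> d sd j; apply: csmooth_on_sub (sL d sd j); exact: coord_image_sub.
Qed.

Lemma form_section_sub W W' w : W' `<=` W -> form_section V W w -> form_section V W' w.
Proof.
move=> WW [sw aw]; split; last by move=> r /WW; exact: aw.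
by move=> d sd j; apply: csmooth_on_sub (sw d sd j); exact: coord_image_sub.
Qed.

(** In the weak equation [w(X)] is replaced by the smooth function it equals almost everywhere,
    after which [weak_to_strong] applies to each part. That [lie_deriv L w] is a smooth section
    makes its pairing with [X] locally bounded and measurable up to null sets. *)
Lemma lie_smooth W w L q : infinitesimal_automorphism V U X -> open W ->
  form_section V W w -> bundle_section V W L -> form_section V W (lie_deriv L w) ->
  W q -> U q -> ae_smooth_at (fun r => pairing (w r) (real_vfield X r)) q ->
  ae_smooth_at (fun r => pairing (lie_deriv L w r) (real_vfield X r)) q.
Proof.
move=> iX oW sw sL sv Wq Uq [W2 [g [oW2 W2q sg ug]]].
pose c := chart_at q; have sc : smooth_chart c by exact: smooth_chart_at.
have cq : chart_dom c q by exact: chart_at_dom.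
pose W' := W `&` U `&` W2; have oW' : open W' by do !apply: openI.
have W'W : W' `<=` W by move=> r [[]].
have W'U : W' `<=` U by move=> r [[]].
have W'2 : W' `<=` W2 by move=> r [].
have [sv' _] := form_section_sub W'W sv.
have W'q : W' q by [].
have [r1 [B [vr [vi [[r10 r1p] rW vB [bvr bvi] [nr ni]]]]]] :=
  local_pairing oU bX sc oW' W'U sv' W'q cq (@openT _) I.
pose D1 : set E := ball (c q) r1.
(* On the smaller ball the derivative of the smooth representative is bounded. *)
pose r := r1 / 2; have r0 : 0 < r by rewrite divr_gt0.
have rr1 : r < r1 by rewrite /r; lra.
pose D : set E := ball (c q) r.
have oD : open D by exact: ball_open.
have DD1 : D `<=` D1 by apply: le_ball; exact: ltW.
have D1W : D1 `<=` coord_image c W' by move=> x /rW [].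
have DW : D `<=` coord_image c W' by exact: subset_trans DD1 D1W.
have Dc : D `<=` c @` chart_dom c by move=> x /DW [s [_ cs] <-]; exists s.
pose W1 := chart_preimage c D.
have oW1 : open W1 by exact: chart_preimage_open.
have IW1 : coord_image c W1 = D by exact: coord_image_preimage.
have W1W : W1 `<=` W'.
  by move=> s [cs /DW [t [Wt ct] ts]]; rewrite -(chart_mapK cs) -ts chart_mapK.
have := iX W1 w L oW1 (subset_trans W1W W'U) (form_section_sub (subset_trans W1W W'W) sw)
  (bundle_section_sub (subset_trans W1W W'W) sL).
move=> /(_ c sc); rewrite IW1 => weak.
pose u x := pairing (w (chart_inv c x)) (real_vfield X (chart_inv c x)).
pose v x := pairing (lie_deriv L w (chart_inv c x)) (real_vfield X (chart_inv c x)).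
pose gr x := Re (g (chart_inv c x)); pose gi x := Im (g (chart_inv c x)).
pose lr i x := Re (vfield_coord c L (chart_inv c x) ord0 i).
pose li i x := Im (vfield_coord c L (chart_inv c x) ord0 i).
have [sgr sgi] : smooth_on D1 gr /\ smooth_on D1 gi.
  by apply: csmooth_on_sub (sg c sc); apply: subset_trans D1W _; exact: coord_image_sub.
have sl i : smooth_on D1 (lr i) /\ smooth_on D1 (li i).
  have [sL1 _] := bundle_section_sub W'W sL.
  exact: csmooth_on_sub D1W (sL1 c sc i).
have [N [mN N0 NN]] := ug c sc.
have NE x : D x -> ~ N x -> Re (u x) = gr x /\ Im (u x) = gi x.
  move=> Dx Nx; have [s [Ws cs] sx] := DW x Dx.
  have us : pairing (w s) (real_vfield X s) = g s.
    apply: contrapT => us; apply: Nx; apply: NN; exists s => //; split => //.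
    by split => //; exact: W'2.
  by rewrite /u /gr /gi -sx chart_mapK// us.
have cpE i phi x : cpartial i (fun y => vfield_coord c L (chart_inv c y) ord0 i *
     real_complex R (phi y)) x =
   Complex (partial i (fun y => lr i y * phi y) x) (partial i (fun y => li i y * phi y) x).
  rewrite /cpartial; congr Complex; congr (partial i _ x); apply/funext => y.
    by rewrite cReM /= mulr0 subr0.
  by rewrite cImM /= mulr0 add0r.
have Re_part phi : test_function D phi ->
    - (\int[mu]_(x in D) (gr x * (\sum_i partial i (fun y => lr i y * phi y) x) +
        - gi x * (\sum_i partial i (fun y => li i y * phi y) x))) =
    \int[mu]_(x in D) (vr x * phi x).
  move=> tphi; have := congr1 (@complex.Re R) (weak phi tphi); rewrite /cintegral /= => E1.
  have [N1 [mN1 N10 NN1]] := nr.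
  have -> : \int[mu]_(x in D) (vr x * phi x) = \int[mu]_(x in D)
      Re (v x * real_complex R (phi x)).
    apply: (Rintegral_ae_eq mN1 N10) => x Dx Nx; rewrite cReM /= mulr0 subr0.
    congr (_ * _); apply/esym; apply: contrapT => vx; apply: Nx; apply: NN1; split => //.
    exact: DD1.
  rewrite -E1; congr (- _); apply: (Rintegral_ae_eq mN N0) => x Dx Nx.
  have [e1 e2] := NE x Dx Nx.
  rewrite cReM -/(u x) e1 e2 Re_sum Im_sum mulNr; congr (_ * _ - _ * _).
    by apply: eq_bigr => i _; rewrite cpE.
  by apply: eq_bigr => i _; rewrite cpE.
have Im_part phi : test_function D phi ->
    - (\int[mu]_(x in D) (gr x * (\sum_i partial i (fun y => li i y * phi y) x) +
        gi x * (\sum_i partial i (fun y => lr i y * phi y) x))) =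
    \int[mu]_(x in D) (vi x * phi x).
  move=> tphi; have := congr1 (@complex.Im R) (weak phi tphi); rewrite /cintegral /= => E1.
  have [N1 [mN1 N10 NN1]] := ni.
  have -> : \int[mu]_(x in D) (vi x * phi x) = \int[mu]_(x in D)
      Im (v x * real_complex R (phi x)).
    apply: (Rintegral_ae_eq mN1 N10) => x Dx Nx; rewrite cImM /= mulr0 add0r.
    congr (_ * _); apply/esym; apply: contrapT => vx; apply: Nx; apply: NN1; split => //.
    exact: DD1.
  rewrite -E1; congr (- _); apply: (Rintegral_ae_eq mN N0) => x Dx Nx.
  have [e1 e2] := NE x Dx Nx.
  rewrite cImM -/(u x) e1 e2 Re_sum Im_sum; congr (_ * _ + _ * _).
    by apply: eq_bigr => i _; rewrite cpE.
  by apply: eq_bigr => i _; rewrite cpE.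
have oD1 : open D1 by exact: ball_open.
have strong (a1 a2 : E -> R) (l1 l2 : 'I_n -> E -> R) (b : E -> R) : smooth_on D1 a1 ->
    smooth_on D1 a2 -> (forall i, smooth_on D1 (l1 i)) -> (forall i, smooth_on D1 (l2 i)) ->
    bounded_supp b -> (forall phi, test_function D phi ->
    - (\int[mu]_(x in D) (a1 x * (\sum_i partial i (fun y => l1 i y * phi y) x) +
        a2 x * (\sum_i partial i (fun y => l2 i y * phi y) x))) =
    \int[mu]_(x in D) (b x * phi x)) ->
    exists2 G : E -> R, smooth_on D G & mu.-negligible (D `&` [set x | b x <> G x]).
  move=> s1 s2 sl1 sl2 bb Hb.
  pose F i (x : E) := partial i a1 x * l1 i x + partial i a2 x * l2 i x.
  have sF i : xpredT i -> smooth_on D1 (F i).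
    move=> _; exact: (smooth_onD oD1 (smooth_onM oD1 (smooth_on_partial i s1) (sl1 i))
      (smooth_onM oD1 (smooth_on_partial i s2) (sl2 i))).
  have sG := smooth_on_sum (index_enum 'I_n) oD1 sF.
  have [B1 HB1] := smooth_bounded r10 (@subset_refl _ D1) rr1 r0 sG.
  have bound : exists r : R, forall x, D x -> `|x| < r.
    exists (`|c q| + r) => x; rewrite /D -ball_normE /= => bx.
    rewrite -[x](subrK (c q)); apply: le_lt_trans (ler_normD _ _) _.
    by rewrite addrC ltrD2l distrC.
  have [sG' nG'] := weak_to_strong oD (smooth_on_sub DD1 s1) (smooth_on_sub DD1 s2)
    (fun i => smooth_on_sub DD1 (sl1 i)) (fun i => smooth_on_sub DD1 (sl2 i)) bb HB1 bound Hb.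
  by exists (fun x => \sum_i F i x).
have slr i : smooth_on D1 (lr i) by have [] := sl i.
have sli i : smooth_on D1 (li i) by have [] := sl i.
(* The sign in the real part of a complex product is carried by the imaginary part of [g]. *)
have [Gr sGr nGr] := strong _ _ _ _ _ sgr (smooth_onN oD1 sgi) slr sli bvr Re_part.
have [Gi sGi nGi] := strong _ _ _ _ _ sgr sgi sli slr bvi Im_part.
have Dq : D (c q) by exact: ballxx.
apply: (ae_smooth_chart (c := c) sc cq oD Dq Dc sGr sGi).
  apply: negligibleS (negligibleU nr nGr) => x [Dx /= vx].
  have [e1|e1] := pselect (vr x = Gr x); last by right.
  by left; split; [exact: DD1|rewrite /= e1].
apply: negligibleS (negligibleU ni nGi) => x [Dx /= vx].
have [e1|e1] := pselect (vi x = Gi x); last by right.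
by left; split; [exact: DD1|rewrite /= e1].
Qed.

End lie_step.

(** * Normal crossings *)

Section normal_crossing.
Variables (R : realType) (n : nat) (M : smooth_manifold R n) (V : involutive_structure M).
Local Notation E := 'rV[R]_n.
Local Notation C := R[i].
Local Notation mu := (@lebesgue_rV R n).
Local Notation Re := complex.Re.
Local Notation Im := complex.Im.
Variables (U : set M) (X : M -> 'rV[R]_n).
Hypotheses (oU : open U) (bX : locally_bounded_measurable U X).

Lemma pairingDl (a b v : 'rV[C]_n) : pairing (a + b) v = pairing a v + pairing b v.
Proof. by rewrite -big_split; apply: eq_bigr => i _; rewrite mxE mulrDl. Qed.

Lemma pairingZl (k : C) (a v : 'rV[C]_n) : pairing (k *: a) v = k * pairing a v.
Proof. by rewrite mulr_sumr; apply: eq_bigr => i _; rewrite mxE mulrA. Qed.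

Lemma pairing0l (v : 'rV[C]_n) : pairing 0 v = 0.
Proof. by rewrite /pairing big1// => i _; rewrite mxE mul0r. Qed.

Lemma pairing_conj (a : 'rV[C]_n) (v : 'rV[R]_n) :
  pairing (map_mx (@conjc R) a) (cplx v) = conjc (pairing a (cplx v)).
Proof.
rewrite /pairing rmorph_sum; apply: eq_bigr => i _.
by rewrite rmorphM !mxE; congr (_ * _); rewrite /= oppr0.
Qed.

Lemma span_coeffs N (f : 'I_N -> 'rV[C]_n) : span [seq f k | k : 'I_N] = fullv ->
  exists P : 'M[C]_(n, N), P *m (\matrix_k f k) = 1%:M.
Proof.
move=> sp.
have H (s : seq 'I_N) v : v \in span [seq f k | k <- s] ->
    exists c : 'I_N -> C, v = \sum_k c k *: f k.
  elim: s v => [|k s IH] v /=.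
    by rewrite span_nil memv0 => /eqP ->; exists (fun=> 0); rewrite big1// => k _; rewrite scale0r.
  rewrite span_cons => /memv_addP[_ /vlineP[a ->] [u /IH[c ->] ->]].
  exists (fun l => (if l == k then a else 0) + c l).
  under [RHS]eq_bigr do rewrite scalerDl.
  rewrite big_split/=; congr (_ + _).
  rewrite (bigD1 k)//= eqxx big1 ?addr0// => l lk.
  by rewrite (negbTE lk) scale0r.
have /choice[c Hc] : forall l : 'I_n, exists c : 'I_N -> C,
    (delta_mx ord0 l : 'rV[C]_n) = \sum_k c k *: f k.
  by move=> l; apply: (H (enum 'I_N)); rewrite sp memvf.
exists (\matrix_(l, k) c l k); apply/matrixP => l j.
rewrite !mxE; have := congr1 (fun v : 'rV[C]_n => v ord0 j) (Hc l).
rewrite summxE mxE eqxx eq_sym => ->; apply: eq_bigr => k _.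
by rewrite !mxE.
Qed.

(** The functions [g] are components in the chart [x]; the field [Y] must be given by its components
    in the preferred chart at each point, hence the Jacobian. *)
Lemma smooth_near_of_coords (x : chart R n M) p (D : set E) (g : 'I_n -> E -> R) :
  smooth_chart x -> chart_dom x p -> open D -> D (x p) -> D `<=` x @` chart_dom x ->
  (forall j, smooth_on D (g j)) ->
  mu.-negligible (D `&` [set y | ~ forall j, real_coord x X j y = g j y]) ->
  smooth_near p X.
Proof.
move=> sx xp oD Dp Dx sg ng.
pose Y (r : M) : 'rV[R]_n := (\row_j g j (x r)) *m coord_jacobian x (chart_at r) r.
pose W := chart_preimage x D.
have oW : open W by exact: chart_preimage_open.
have Wx : W `<=` chart_dom x by move=> r [].
have IW : coord_image x W = D by exact: coord_image_preimage.
exists W, Y; split => //.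
  move=> d sd j.
  pose W' := W `&` chart_dom d.
  have oW' : open W' by apply: openI => //; exact: chart_dom_open.
  have -> : coord_image d W = coord_image d W'.
    apply/seteqP; split; last by apply: coord_image_sub => r [].
    by move=> _ [r [Wr dr] <-]; exists r.
  have W'x : W' `<=` chart_dom x by move=> r [/Wx].
  apply: (csmooth_transport (f := fun r => vfield_coord d (real_vfield Y) r ord0 j) oW' sx sd W'x).
  have oI := coord_image_open (c := x) oW'.
  pose F (z : E) : R := \sum_i g i z * partial i (fun z => transition x d z ord0 j) z.
  have sF : smooth_on (coord_image x W') F.
    have ID : coord_image x W' `<=` D by rewrite -IW; apply: coord_image_sub => r [].
    have sT : smooth_on (coord_image x W') (fun z => transition x d z ord0 j).
      by apply: transition_smooth_image => // r [].
    have sFi i : xpredT i -> smooth_on (coord_image x W')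
        (fun z => g i z * partial i (fun z => transition x d z ord0 j) z).
      move=> _; exact: (smooth_onM oI (smooth_on_sub ID (sg i)) (smooth_on_partial i sT)).
    exact: (smooth_on_sum (index_enum 'I_n) oI sFi).
  apply: (csmooth_on_congr oI _ (csmooth_on_real sF)) => _ [r [[Wr dr] xr] <-].
  rewrite chart_mapK// vfield_coord_real mxE; congr (real_complex R _).
  rewrite /Y -mulmxA (coord_jacobian_chain sx (smooth_chart_at r) sd xr (chart_at_dom r) dr).
  rewrite mxE /F; apply: eq_bigr => i _; rewrite mxE; congr (_ * _).
  by apply/esym; exact: coord_jacobianE.
apply: (ae_on_chart oW sx Wx).
apply: negligibleS ng => _ [r [[[xr Dr] XY] _] <-]; split => //= H; apply: XY.
have E1 : X r *m coord_jacobian (chart_at r) x r = \row_j g j (x r).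
  apply/rowP => j; rewrite [RHS]mxE -H /real_coord chart_mapK// vfield_coord_real.
  by rewrite [in RHS]mxE.
rewrite /Y -E1 -mulmxA (coord_jacobian_chain (smooth_chart_at r) sx (smooth_chart_at r)
  (chart_at_dom r) xr (chart_at_dom r)).
by rewrite (coord_jacobian_id (smooth_chart_at r) (chart_at_dom r)) mulmx1.
Qed.

(** Since [X] is real, the conjugate of [eta] pairs with it to the conjugate of [eta(X)]. The
    monomial times [w(X)] is therefore almost everywhere smooth; the monomial is real, so real and
    imaginary parts are divided separately. *)
Lemma divide_pairing (x : chart R n M) p Uw (w : M -> 'rV[C]_n) (al : 'I_n -> nat) W0
    (th eta : M -> 'rV[C]_n) : smooth_chart x -> chart_dom x p ->
  open Uw -> Uw p -> Uw `<=` U -> smooth_form Uw w -> open W0 -> W0 p -> W0 `<=` chart_dom x ->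
  (forall q, W0 q -> real_complex R (\prod_(j < n) x q ord0 j ^+ al j) *: w q =
     th q + map_mx (@conjc R) (eta q)) ->
  ae_smooth_at (fun r => pairing (th r) (real_vfield X r)) p ->
  ae_smooth_at (fun r => pairing (eta r) (real_vfield X r)) p ->
  exists (D : set E) (gr gi : E -> R),
  let u y := pairing (w (chart_inv x y)) (real_vfield X (chart_inv x y)) in
  [/\ open D /\ D (x p), smooth_on D gr, smooth_on D gi,
    mu.-negligible (D `&` [set y | Re (u y) <> gr y]) &
    mu.-negligible (D `&` [set y | Im (u y) <> gi y])].
Proof.
move=> sx xp oUw Uwp UwU sw oW0 W0p W0x mw [W5 [g5 [oW5 W5p sg5 ug5]]] [W6 [g6 [oW6 W6p sg6 ug6]]].
pose W4 := W0 `&` W5 `&` W6.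
have oW4 : open W4 by do !apply: openI.
have oI := coord_image_open (c := x) oW4.
have Ip : coord_image x W4 (x p) by exists p.
have [r [B [ur [ui [[r0 rp] rW uB _ _]]]]] :=
  local_pairing oU bX sx oUw UwU sw Uwp xp oI Ip.
pose D : set E := ball (x p) r.
have oD : open D by exact: ball_open.
have Dp : D (x p) by exact: ballxx.
have DI : D `<=` coord_image x W4 by move=> y /rW [].
pose u y := pairing (w (chart_inv x y)) (real_vfield X (chart_inv x y)).
pose g5' y := g5 (chart_inv x y); pose g6' y := g6 (chart_inv x y).
have [s5r s5i] : csmooth_on D g5'.
  by apply: csmooth_on_sub (sg5 x sx); apply: subset_trans DI _; apply: coord_image_sub => s [[]].
have [s6r s6i] : csmooth_on D g6'.
  by apply: csmooth_on_sub (sg6 x sx); apply: subset_trans DI _; apply: coord_image_sub => s [].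
have nN := negligibleU (ug5 x sx) (ug6 x sx).
have key y : D y -> ~ (coord_image x (W5 `&` [set q | pairing (th q) (real_vfield X q) <> g5 q]) `|`
     coord_image x (W6 `&` [set q | pairing (eta q) (real_vfield X q) <> g6 q])) y ->
   (\prod_(j < n) y ord0 j ^+ al j) * Re (u y) = Re (g5' y) + Re (g6' y) /\
   (\prod_(j < n) y ord0 j ^+ al j) * Im (u y) = Im (g5' y) - Im (g6' y).
  move=> /DI [s [[[W0s W5s] W6s] xs] <-] Ny.
  have e5 : pairing (th s) (real_vfield X s) = g5 s.
    by apply: contrapT => e5; apply: Ny; left; exists s.
  have e6 : pairing (eta s) (real_vfield X s) = g6 s.
    by apply: contrapT => e6; apply: Ny; right; exists s.
  have := congr1 (fun a => pairing a (real_vfield X s)) (mw s W0s).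
  rewrite pairingZl pairingDl e5 /real_vfield pairing_conj -/(real_vfield X s) e6.
  rewrite /u /g5' /g6' chart_mapK// => e.
  have := congr1 (@complex.Re R) e; have := congr1 (@complex.Im R) e.
  rewrite !cReM !cImM !cReD !cImD /= !mul0r subr0 addr0.
  by case: (g6 s) => a b /= -> ->.
have mono (f g : E -> R) : (forall y, D y -> `|f y| <= B) -> smooth_on D g ->
    mu.-negligible (D `&` [set y : E | (\prod_(j < n) y ord0 j ^+ al j) * f y <> g y]) ->
    exists (D' : set E) (h : E -> R), [/\ open D', D' (x p), D' `<=` D, smooth_on D' h &
      mu.-negligible (D' `&` [set y | f y <> h y])].
  exact: (divisible_by_monomial oD Dp).
have nr : mu.-negligible (D `&` [set y : E | (\prod_(j < n) y ord0 j ^+ al j) * Re (u y) <>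
    Re (g5' y) + Re (g6' y)]).
  apply: negligibleS nN => y [Dy /= uy]; apply: contrapT => Ny.
  by apply: uy; have [] := key y Dy Ny.
have ni : mu.-negligible (D `&` [set y : E | (\prod_(j < n) y ord0 j ^+ al j) * Im (u y) <>
    Im (g5' y) - Im (g6' y)]).
  apply: negligibleS nN => y [Dy /= uy]; apply: contrapT => Ny.
  by apply: uy; have [] := key y Dy Ny.
have [D1 [gr [oD1 D1p D1D sgr ngr]]] :=
  mono _ _ (fun y Dy => (uB y Dy).1) (smooth_onD oD s5r s6r) nr.
have [D2 [gi [oD2 D2p D2D sgi ngi]]] :=
  mono _ _ (fun y Dy => (uB y Dy).2) (smooth_onB oD s5i s6i) ni.
exists (D1 `&` D2), gr, gi; split.
- by split; [exact: openI|].
- by apply: smooth_on_sub sgr => y [].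
- by apply: smooth_on_sub sgi => y [].
- by apply: negligibleS ngr => y [[D1y _] uy].
- by apply: negligibleS ngi => y [[_ D2y] uy].
Qed.

(** The pairings of [X] with the spanning forms form a complex linear system for its components,
    with possibly more equations than unknowns. Multiplying by a constant matrix makes the
    coefficient matrix the identity at [p]; as [X] is real, the real part is a square real system,
    invertible near [p]. *)
Lemma normal_crossing_smooth p U0 : normal_crossing_at V p -> U p -> open U0 -> U0 p ->
  (forall W w q, open W -> W `<=` U0 -> form_section V W w -> W q -> U q ->
    ae_smooth_at (fun r => pairing (w r) (real_vfield X r)) q) ->
  smooth_near p X.
Proof.
move=> [x [Uw [N [w [al [[sx xp] [oUw Uwp] sw spw [W0 [oW0 W0p W0sub HW]]]]]]]] Up oU0 U0p HS.
pose W' := Uw `&` U.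
have oW' : open W' by exact: openI.
have sw' k : smooth_form W' (w k).
  by move=> d sd j; apply: csmooth_on_sub (sw k d sd j); apply: coord_image_sub => r [].
have W0x : W0 `<=` chart_dom x by move=> r /W0sub [].
have HD k : exists DG : set E * (E -> R) * (E -> R),
  let u y := pairing (w k (chart_inv x y)) (real_vfield X (chart_inv x y)) in
  [/\ open DG.1.1 /\ DG.1.1 (x p), smooth_on DG.1.1 DG.1.2, smooth_on DG.1.1 DG.2,
    mu.-negligible (DG.1.1 `&` [set y | Re (u y) <> DG.1.2 y]) &
    mu.-negligible (DG.1.1 `&` [set y | Im (u y) <> DG.2 y])].
  have [th [eta [fth feta mw]]] := HW k.
  have oW4 : open (W0 `&` U0) by exact: openI.
  have sec f : form_section V W0 f -> ae_smooth_at (fun r => pairing (f r) (real_vfield X r)) p.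
    move=> ff; apply: (HS (W0 `&` U0)) => //.
    by apply: form_section_sub ff => r [].
  have [D [gr [gi H]]] := divide_pairing sx xp oW' (conj Uwp Up) (@subIsetr _ _ _) (sw' k)
    oW0 W0p W0x mw (sec _ fth) (sec _ feta).
  by exists (D, gr, gi).
have /choice[DG HDG] := HD.
pose D : set E := coord_image x W' `&` [set y | forall k, (DG k).1.1 y].
have oD : open D.
  apply: openI; first exact: coord_image_open.
  rewrite openE => y Dy.
  apply: (@filter_forall _ _ (fun k (y : E) => (DG k).1.1 y) (nbhs y)) => k.
  by have [[oDk _] _ _ _ _] := HDG k; apply: open_nbhs_nbhs; split => //; exact: Dy.
have Dp : D (x p).
  by split; [exists p|move=> k; have [[]] := HDG k].
have [P0 HP0] := span_coeffs spw.
pose J := coord_jacobian (chart_at p) x p.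
(* [P0] inverts the forms on the left in the preferred chart at [p]; the Jacobian transports this to
   the chart [x]. *)
pose P : 'M[C]_(n, N) := (cplx J)^T *m P0.
pose fc k j (y : E) : C := form_coord x (w k) (chart_inv x y) ord0 j.
pose Bm l j (y : E) : R := Re (\sum_k P l k * fc k j y).
pose h l (y : E) : R := Re (\sum_k P l k * Complex ((DG k).1.2 y) ((DG k).2 y)).
have sB l j : smooth_on D (Bm l j).
  suff [h1 _] : csmooth_on D (fun y => \sum_k P l k * fc k j y) by exact: h1.
  apply: csmooth_on_sum => [|k]; [exact: oD|apply: csmooth_onM; first exact: oD].
    by split; exact: smooth_on_cst.
  by apply: csmooth_on_sub (sw' k x sx j) => y [].
have sh l : smooth_on D (h l).
  suff [h1 _] : csmooth_on D (fun y => \sum_k P l k * Complex ((DG k).1.2 y) ((DG k).2 y)).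
    exact: h1.
  apply: csmooth_on_sum => [|k]; [exact: oD|apply: csmooth_onM; first exact: oD].
    by split; exact: smooth_on_cst.
  have [_ s1 s2 _ _] := HDG k.
  by split; [apply: smooth_on_sub s1|apply: smooth_on_sub s2] => y [_]; exact.
have B0 l j : Bm l j (x p) = (l == j)%:R.
  have A0 : (\matrix_(k, j) fc k j (x p)) = (\matrix_k w k p) *m (cplx (coord_jacobian x (chart_at p) p))^T.
    apply/matrixP => k i; rewrite !mxE /fc chart_mapK// /form_coord mxE.
    by apply: eq_bigr => m _; rewrite !mxE.
  have : P *m (\matrix_(k, j) fc k j (x p)) = 1%:M.
    rewrite A0 /P mulmxA -[_ *m P0 *m _]mulmxA HP0 mulmx1 -trmx_mul -map_mxM.
    rewrite (coord_jacobian_chain sx (smooth_chart_at p) sx xp (chart_at_dom p) xp).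
    by rewrite coord_jacobian_id// map_mx1 trmx1.
  move=> /matrixP /(_ l j); rewrite !mxE => e.
  rewrite /Bm (_ : \sum_k P l k * fc k j (x p) = (l == j)%:R) ?(rmorph_nat)//; last first.
    by rewrite -e; apply: eq_bigr => k _; rewrite !mxE.
  by case: (l == j).
have nD : mu.-negligible (D `&` [set y | ~ forall l, \sum_j Bm l j y * real_coord x X j y = h l y]).
  have : mu.-negligible [set y | exists k : 'I_N, (((DG k).1.1 `&` [set y |
      Re (pairing (w k (chart_inv x y)) (real_vfield X (chart_inv x y))) <> (DG k).1.2 y]) `|`
      ((DG k).1.1 `&` [set y |
      Im (pairing (w k (chart_inv x y)) (real_vfield X (chart_inv x y))) <> (DG k).2 y])) y].
    by apply: negligible_exists => k; have [_ _ _ n1 n2] := HDG k; exact: negligibleU.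
  apply: negligibleS => y [[Iy Dy] /= hy]; apply: contrapT => /forallNP Hk; apply: hy => l.
  have uE k : pairing (w k (chart_inv x y)) (real_vfield X (chart_inv x y)) =
      Complex ((DG k).1.2 y) ((DG k).2 y).
    apply: complex_eq => /=; apply: contrapT => e; apply: (Hk k); [left|right]; split => //; exact: Dy.
  rewrite /h -(eq_bigr _ (fun k _ => congr1 _ (uE k))).
  have [s [_ xs] sy] := Iy.
  have -> : \sum_j Bm l j y * real_coord x X j y =
      Re (\sum_j (\sum_k P l k * fc k j y) * real_complex R (real_coord x X j y)).
    by rewrite Re_sum; apply: eq_bigr => j _; rewrite cReM /= mulr0 subr0.
  congr complex.Re.
  transitivity (\sum_j \sum_k P l k * fc k j y * real_complex R (real_coord x X j y)).
    by apply: eq_bigr => j _; rewrite mulr_suml.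
  rewrite exchange_big; apply: eq_bigr => k _ /=.
  rewrite -sy chart_mapK// (pairing_real_coord _ _ sx xs) mulr_sumr.
  by apply: eq_bigr => j _; rewrite /fc chart_mapK// mulrA.
have [D' [g [oD' D'p D'D sg ng]]] := invert_smooth oD Dp sB sh B0 nD.
apply: (smooth_near_of_coords sx xp oD' D'p _ sg ng).
by move=> y /D'D [[s [_ xs] <-] _]; exists s.
Qed.

End normal_crossing.

(** * Existence of smooth pairings on the hull *)

Section main.
Variables (R : realType) (n : nat) (M : smooth_manifold R n) (V : involutive_structure M).
Local Notation E := 'rV[R]_n.
Local Notation C := R[i].
Local Notation mu := (@lebesgue_rV R n).

(* Excludes the junk case in which no hull exists at all: membership in the hull is an
   intersection over subsheaves, and an empty family would give every [w], smooth or not. *)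
Lemma smooth_form_not_total (W : set M) (p : M) : 'I_n -> open W -> W p ->
  exists w : M -> 'rV[C]_n, ~ smooth_form W w.
Proof.
move=> i oW Wp.
pose w (q : M) : 'rV[C]_n := if `[< q = p >] then delta_mx ord0 i else 0.
exists w => sw; pose c := chart_at p.
have sc : smooth_chart c by exact: smooth_chart_at.
have cp : chart_dom c p by exact: chart_at_dom.
have [s1 _] := sw c sc i.
have Ip : coord_image c W (c p) by exists p.
pose f y := complex.Re (form_coord c w (chart_inv c y) ord0 i).
have fp : f (c p) = 1.
  rewrite /f chart_mapK// /form_coord coord_jacobian_id//.
  by rewrite /cplx map_mx1 trmx1 mulmx1 /w asboolT// mxE !eqxx.
have f12 : 2^-1 < f (c p) by rewrite fp; lra.
have [e e0 ef] := continuous_gt_ball (smooth_on_continuous s1 Ip) f12.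
have oG : open (coord_image c W `&` ball (c p) e).
  by apply: openI; [exact: coord_image_open|exact: ball_open].
have [|y [[Iy by_]] yi] := null_set_codense (hyperplane_null i (c p ord0 i)) oG (x := c p).
  by split => //; exact: ballxx.
have := ef y by_; rewrite /=.
have [s [Ws cs] sy] := Iy.
rewrite -sy chart_mapK// /form_coord /w asboolF; last first.
  by move=> sp; apply: yi; rewrite /= -sy sp.
rewrite mul0mx mxE /= => h0; lra.
Qed.

End main.

Theorem theorem1p3 (R : realType) (n : nat) (M : smooth_manifold R n)
    (V : involutive_structure M) (p : M) :
  nondegenerate_at V p -> normal_crossing_at V p ->
  forall (U : set M) (X : M -> 'rV[R]_n), open U -> U p ->
    locally_bounded_measurable U X ->
    infinitesimal_automorphism V U X ->
    extends_microlocally V U X ->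
    smooth_near p X.
Proof.
move=> [U0 [oU0 U0p ndeg]] nc U X oU Up bX iX eX.
(* In dimension 0 there are no components and [X] is its own smooth representative; a coordinate is
   needed below to produce a form that is not smooth. *)
have [[i _]|n0] := pselect (exists i : 'I_n, True); last first.
  exists setT, X; split => //; first exact: openT.
    by move=> c sc j; case: n0; exists j.
  move=> c sc; apply: negligibleS (negligible_set0 _).
  by move=> y [q [[_ XX] _] _]; case: XX.
apply: (normal_crossing_smooth oU bX nc Up oU0 U0p) => W w q oW WU0 fw Wq Uq.
(* The sections with almost everywhere smooth pairing are tested inside some [S0] of the family
   defining the hull, so that [lie_deriv L w] is again a smooth section of T'. *)
have [S0 [sS0 lS0 cS0]] : exists S0, [/\ form_subsheaf V S0, lie_closed V S0 &
    forall W' w', open W' -> characteristic_section V W' w' -> S0 W' w'].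
  apply: contrapT => noS.
  have [w' nsw] := smooth_form_not_total i oU0 U0p.
  have [H _] := ndeg U0 w' oU0 (@subset_refl _ U0).
  have [] // := H _.
  by move=> S sS lS cS; case: noS; exists S.
(* The hull is tested on all open sets, while [X] lives on [U]; the pairing condition is therefore
   imposed at points of [U] only. *)
pose S (W : set M) (w : M -> 'rV[R[i]]_n) := S0 W w /\ forall q, W q -> U q ->
  ae_smooth_at (fun r => pairing (w r) (real_vfield X r)) q.
suff [_ HS] : S W w by exact: HS.
(* Nondegeneracy puts [w] in the hull, so it lies in [S] as soon as [S] belongs to the family
   defining the hull. *)
have [_ /(_ fw)] := ndeg W w oW WU0; apply.
- split.
  + by move=> W1 w1 oW1 [h1 _]; exact: subsheaf_sub sS0 _ _ oW1 h1.
  + move=> W1 w1 w2 oW1 e12 [h1 h2]; split; first exact: subsheaf_ext sS0 _ _ _ oW1 e12 h1.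
    move=> r Wr Ur; apply: (ae_smooth_congr oW1 Wr) (h2 r Wr Ur) => s Ws.
    by rewrite e12.
  + move=> W1 W2 w1 oW1 oW2 W21 [h1 h2]; split; first exact: subsheaf_res sS0 _ _ _ oW1 oW2 W21 h1.
    by move=> r /W21; exact: h2.
  + move=> W1 w1 oW1 H; split.
      apply: (subsheaf_glue sS0 oW1) => r /H [W2 [oW2 W2r W21 [h1 _]]].
      by exists W2.
    by move=> r /H [W2 [oW2 W2r W21 [_ h2]]]; exact: h2.
  + move=> W1 oW1; split; first exact: subsheaf0 sS0 _ oW1.
    move=> r Wr Ur; exists W1, (fun=> 0); split => //.
      by move=> c sc; split; exact: smooth_on_cst.
    move=> c sc; apply: negligibleS (negligible_set0 _).
    by move=> y [s [[_ e] _] _]; case: e; rewrite pairing0l.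
  + move=> W1 w1 w2 oW1 [h1 h2] [h3 h4]; split; first exact: subsheafD sS0 _ _ _ oW1 h1 h3.
    move=> r Wr Ur; have := ae_smoothD (h2 r Wr Ur) (h4 r Wr Ur).
    by apply: (ae_smooth_congr oW1 Wr) => s _; rewrite pairingDl.
  + move=> W1 f w1 oW1 sf [h1 h2]; split; first exact: subsheafZ sS0 _ _ _ oW1 sf h1.
    move=> r Wr Ur; have := ae_smoothM oW1 Wr sf (h2 r Wr Ur).
    by apply: (ae_smooth_congr oW1 Wr) => s _; rewrite pairingZl.
- move=> W1 L w1 oW1 sL [h1 h2]; have h3 := lS0 _ _ _ oW1 sL h1; split => // r Wr Ur.
  apply: (lie_smooth oU bX iX oW1 _ sL _ Wr Ur (h2 r Wr Ur)).
    exact: subsheaf_sub sS0 _ _ oW1 h1.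
  exact: subsheaf_sub sS0 _ _ oW1 h3.
- move=> W1 w1 oW1 cw; split; first exact: cS0.
  by move=> r Wr Ur; exact: (characteristic_smooth oU bX eX oW1 cw Wr Ur).
Qed.
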